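(* Let $n \ge 2$ and let $(S_1,\dots,S_n)$ be a commuting $n$-tuple of $2\times 2$ complex matrices, regarded as operators on $\mathbb{C}^2$, which is a $\Gamma_n$-contraction. Then $(S_1,\dots,S_n)$ has a $\Gamma_n$-isometric dilation.
   Context: Let $\mathbf{s}=(s_1,\dots,s_n):\mathbb{C}^n\to\mathbb{C}^n$ be the symmetrization map, $s_i(z_1,\dots,z_n)=\sum_{1\le k_1<\dots<k_i\le n} z_{k_1}\cdots z_{k_i}$ for $1\le i\le n$. Let $\mathbb{D}$ be the open unit disc and $\mathbb{T}$ the unit circle. Put $\mathbb{G}_n=\mathbf{s}(\mathbb{D}^n)$ and $\Gamma_n=\mathbf{s}(\overline{\mathbb{D}}^n)$ (the closure of $\mathbb{G}_n$), and let $b\Gamma_n=\mathbf{s}(\mathbb{T}^n)$ be the distinguished boundary of $\Gamma_n$. For a compact set $\Omega\subset\mathbb{C}^n$, $\mathcal{O}(\Omega)$ is the algebra of functions that are bounded and holomorphic in some neighbourhood of $\Omega$, with the norm $\|f\|_{\infty,\Omega}=\sup_{z\in\Omega}|f(z)|$. $\Omega$ is a spectral set for a commuting $n$-tuple $\mathbf{T}=(T_1,\dots,T_n)$ of bounded Hilbert space operators if the joint spectrum satisfies $\sigma(\mathbf{T})\subset\Omega$ and $\|f(\mathbf{T})\|\le\|f\|_{\infty,\Omega}$ for all $f\in\mathcal{O}(\Omega)$ (holomorphic functional calculus). For commuting matrices the joint spectrum is the set of joint eigenvalues. A commuting $n$-tuple of bounded operators $(S_1,\dots,S_n)$ on a Hilbert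 space $\mathcal{H}$ is: - a $\Gamma_n$-contraction if $\Gamma_n$ is a spectral set for it; - a $\Gamma_n$-unitary if $S_1,\dots,S_n$ are normal and $\sigma(S_1,\dots,S_n)\subseteq b\Gamma_n$; - a $\Gamma_n$-isometry if there are a Hilbert space $\mathcal{K}\supseteq\mathcal{H}$ and a $\Gamma_n$-unitary $(N_1,\dots,N_n)$ on $\mathcal{K}$ such that $\mathcal{H}$ is a common invariant subspace of $N_1,\dots,N_n$ and $S_i=N_i|_{\mathcal{H}}$ for $1\le i\le n$. A $\Gamma_n$-isometric dilation of a $\Gamma_n$-contraction $(S_1,\dots,S_n)$ on $\mathcal{H}$ is a $\Gamma_n$-isometry $(V_1,\dots,V_n)$ on a Hilbert space $\mathcal{K}\supseteq\mathcal{H}$ such that $P_{\mathcal{H}}V_1^{m_1}\cdots V_n^{m_n}|_{\mathcal{H}}=S_1^{m_1}\cdots S_n^{m_n}$ for all integers $m_1,\dots,m_n\ge 0$, where $P_{\mathcal{H}}$ is the orthogonal projection onto $\mathcal{H}$. *)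

(* Defs.v *)
From HB Require Import structures.
From mathcomp Require Import all_boot all_order all_algebra.
From mathcomp Require Import all_classical all_reals all_analysis.
From mathcomp Require Import complex.

Set Implicit Arguments.
Unset Strict Implicit.
Unset Printing Implicit Defensive.

Import Order.TTheory GRing.Theory Num.Theory.
Import numFieldNormedType.Exports.

Local Open Scope classical_set_scope.
Local Open Scope ring_scope.

(* [R[i]], seen as an abstract [numClosedFieldType] so that it carries the
   topology and the norm that MathComp-Analysis puts on such fields. *)
Definition complexC (R : realType) : numClosedFieldType := R[i].

(* Norms in [normedModType (complexC R)] take their values in [complexC R];
   [rnorm x] is the same number in [R]. *)
Definition rnorm (R : realType) (V : normedModType (complexC R)) (x : V) : R :=
  complex.Re (`|x| : R[i]).

HB.mixin Record CompleteNormedModule_isHilbert (R : realType) H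
    & CompleteNormedModule (complexC R) H := {
  inner : {dot H for (@Num.conj (complexC R))} ;
  sqr_normE : forall x : H, `|x| ^+ 2 = inner x x
}.

#[short(type="hilbertType")]
HB.structure Definition Hilbert (R : realType) :=
  {H of CompleteNormedModule (complexC R) H
      & CompleteNormedModule_isHilbert R H}.

Section ComplexComplete.
Variable R : realType.
Local Notation C := (complexC R).

Lemma part_cvg (V : normedModType C) (f : V -> R) (F : set_system V) :
  (forall x y, ((`|f x - f y|)%:C : C) <= `|x - y|)%C ->
  ProperFilter F -> cauchy F -> exists l : R, f x @[x --> F] --> l.
Proof.
move=> fle FF Fc; apply/cvg_ex; apply: (@R_complete R _ _); apply: cauchy_exP => e e0.
have e0C : 0 < (e%:C : C)%C by rewrite ltcR.
have [x Fx] := (cauchyP F).1 Fc _ e0C; exists (f x).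
apply: (@filterS _ F _ _ _ _ Fx) => y; rewrite -!ball_normE /ball_ /= => xy.
by rewrite -ltcR; exact: le_lt_trans (fle _ _) xy.
Qed.

Lemma part_bound (z : C) : `|z| <= ((`|complex.Re z| + `|complex.Im z|)%:C)%C.
Proof.
case: z => a b /=; rewrite [leLHS](normc_def (a +i* b)%C) lecR /=.
rewrite -[leRHS]ger0_norm ?addr_ge0 // -sqrtr_sqr ler_wsqrtr //.
by rewrite sqrrD !real_normK ?num_real // lerD2r lerDl mulrn_wge0 ?mulr_ge0.
Qed.

Lemma complexC_complete (F : set_system C) :
  ProperFilter F -> cauchy F -> cvg F.
Proof.
move=> FF Fc.
have [|a Fa] := @part_cvg C (@complex.Re R) F _ FF Fc.
  by move=> x y; rewrite -raddfB normc_ge_Re.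
have [|b Fb] := @part_cvg C (@complex.Im R) F _ FF Fc.
  move=> x y; rewrite -raddfB normc_def lecR -sqrtr_sqr ler_wsqrtr //.
  by rewrite lerDr sqr_ge0.
apply/cvg_ex; exists ((a +i* b)%C : C); apply/cvgrPdist_lt => /= e e0.
have /andP[/eqP eI eR] : (complex.Im e == 0) && (0 < complex.Re e).
  by move: e0; rewrite ltcE.
have -> : e = (complex.Re e)%:C%C by case: e eI {e0 eR} => ? ? /= ->.
have e2 : 0 < complex.Re e / 2 by rewrite divr_gt0.
near=> x.
apply: le_lt_trans (part_bound _) _; rewrite ltcR (splitr (complex.Re e)).
rewrite !raddfB /= ltrD //.
  by near: x; move/cvgrPdist_lt : Fa; apply.
by near: x; move/cvgrPdist_lt : Fb; apply.
Unshelve. all: by end_near. Qed.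

End ComplexComplete.

(* The Euclidean space C^d; the library's own norm on ['cV_d] is the sup norm. *)
Definition euclid (R : realType) (d : nat) : Type := 'cV[complexC R]_d.

HB.instance Definition _ (R : realType) d := GRing.Lmodule.on (euclid R d).

Section EuclidInner.
Variables (R : realType) (d : nat).
Local Notation C := (complexC R).
Local Notation E := (euclid R d).
Implicit Types x y z : E.

Definition euclid_inner (x y : E) : C := \sum_(i < d) x i 0 * (y i 0)^*.

Lemma euclid_inner_bilinear :
  bilinear_for ( *%R : GRing.Scale.law C C)
    ((@Num.conj C) \; *%R : GRing.Scale.law C C) euclid_inner.
Proof.
split=> [y a x z|x a y z]; rewrite /euclid_inner /= mulr_sumr -big_split /=;
  apply: eq_bigr => i _; rewrite !mxE.
- by rewrite mulrDl mulrA.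
- by rewrite rmorphD rmorphM mulrDr mulrCA.
Qed.

HB.instance Definition _ := bilinear_isBilinear.Build C E E C
  ( *%R : GRing.Scale.law C C)
  ((@Num.conj C) \; *%R : GRing.Scale.law C C) euclid_inner
  euclid_inner_bilinear.

Lemma euclid_inner_herm x y :
  euclid_inner x y = (-1) ^+ false * (euclid_inner y x)^*.
Proof.
rewrite mul1r /euclid_inner rmorph_sum; apply: eq_bigr => i _.
by rewrite rmorphM /= conjCK mulrC.
Qed.

HB.instance Definition _ := isHermitianSesquilinear.Build C E false
  (@Num.conj C) euclid_inner euclid_inner_herm.

Lemma euclid_inner_gt0 x : x != 0 -> 0 < euclid_inner x x.
Proof.
move=> x0; have [i xi0] : exists i, x i 0 != 0.
  apply/existsP; apply: contraNT x0; rewrite negb_exists => /forallP x0.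
  by apply/eqP/matrixP => i j; rewrite ord1 mxE; apply/eqP; have := x0 i;
    rewrite negbK.
rewrite /euclid_inner (bigD1 i) //= ltr_wpDr ?sumr_ge0 ?mul_conjC_gt0 //.
by move=> j _; rewrite mul_conjC_ge0.
Qed.

HB.instance Definition _ := isDotProduct.Build C E euclid_inner euclid_inner_gt0.

Definition euclid_dot : {dot E for (@Num.conj C)} := euclid_inner.

Definition euclid_norm x : C := sqrtC (euclid_dot x x).

Lemma euclid_normD x y : euclid_norm (x + y) <= euclid_norm x + euclid_norm y.
Proof.
exact: (@triangle_lerif C 'cV[C]_d euclid_dot x y).
Qed.

Lemma euclid_normZ (a : C) x : euclid_norm (a *: x) = `|a| * euclid_norm x.
Proof.
by rewrite /euclid_norm dnormZ sqrtCM ?nnegrE ?exprn_ge0 // sqrCK.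
Qed.

Lemma euclid_norm_eq0 x : euclid_norm x = 0 -> x = 0.
Proof. by move/eqP; rewrite sqrtC_eq0 dnorm_eq0 => /eqP. Qed.

HB.instance Definition _ :=
  Lmodule_isNormed.Build C E euclid_normD euclid_normZ euclid_norm_eq0.

Lemma euclid_normE x : `|x| = euclid_norm x. Proof. by []. Qed.

Lemma euclid_coord (i : 'I_d) (x : E) : `|(x : 'cV[C]_d) i 0| <= `|x|.
Proof.
rewrite euclid_normE /euclid_norm -(sqrCK (normr_ge0 _)) ler_sqrtC ?nnegrE ?exprn_ge0 ?dnorm_ge0 //.
rewrite /= /euclid_inner (bigD1 i) //= normCK lerDl sumr_ge0 // => j _.
by rewrite mul_conjC_ge0.
Qed.

Lemma euclid_complete (F : set_system E) :
  ProperFilter F -> cauchy F -> cvg F.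
Proof.
move=> FF Fc.
have /choice[l Fl] (i : 'I_d) : exists l : C, (x : 'cV[C]_d) i 0 @[x --> F] --> l.
  apply/cvg_ex; apply: complexC_complete; apply: cauchy_exP => e e0.
  have [x Fx] := (cauchyP F).1 Fc _ e0; exists ((x : 'cV[C]_d) i 0).
  apply: (@filterS _ F _ _ _ _ Fx) => y; rewrite -!ball_normE /ball_ /=.
  by apply: le_lt_trans; have := euclid_coord i (x - y); rewrite !mxE.
pose e_ (i : 'I_d) : E := delta_mx i 0.
have Ex (x : E) : x = \sum_i ((x : 'cV[C]_d) i 0) *: e_ i.
  rewrite [LHS](matrix_sum_delta (x : 'cV[C]_d)); apply: eq_bigr => i _.
  by rewrite big_ord1.
apply/cvg_ex; exists (\sum_i l i *: e_ i).
have -> : F = (\sum_i ((x : 'cV[C]_d) i 0) *: e_ i) @[x --> F].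
  by rewrite (_ : (fun x => _) = id) //; apply/funext => x; rewrite -Ex.
apply: cvg_big => [|i _]; [exact: add_continuous|].
by apply: cvgZr_tmp; exact: Fl.
Qed.

HB.instance Definition _ := Uniform_isComplete.Build E euclid_complete.

Lemma euclid_sqr_norm x : `|x| ^+ 2 = euclid_dot x x.
Proof. exact: sqrtCK. Qed.

HB.instance Definition _ :=
  CompleteNormedModule_isHilbert.Build R E euclid_sqr_norm.

End EuclidInner.

Section Operators.
Variable R : realType.
Local Notation C := (complexC R).

Definition bounded_operator (H : hilbertType R) (A : H -> H) : Prop :=
  linear A /\ continuous A.

Definition opnorm (H : hilbertType R) (A : H -> H) : R :=
  sup [set rnorm (A x) | x in [set x : H | rnorm x <= 1]].

Definition normal_operator (H : hilbertType R) (A : H -> H) : Prop :=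
  exists B : H -> H,
    [/\ bounded_operator B,
        forall x y, inner (A x) y = inner x (B y) &
        forall x, A (B x) = B (A x)].

Definition commuting_tuple (H : hilbertType R) (n : nat)
    (T : 'I_n -> H -> H) : Prop :=
  (forall i, bounded_operator (T i)) /\
  (forall i j x, T i (T j x) = T j (T i x)).

(* T_1^{m_1} ... T_n^{m_n} *)
Definition monomial_op (H : Type) (n : nat) (T : 'I_n -> H -> H)
    (m : 'I_n -> nat) : H -> H :=
  \big[(fun f g => f \o g)/id]_(i < n) iter (m i) (T i).

(* The Koszul complex of a commuting tuple T on H, with H (x) /\(C^n)
   identified with the functions from subsets of {0, .., n-1} to H:
   v (x) e_i1 /\ .. /\ e_ip, with i1 < .. < ip, is the function with value v at
   {i1, .., ip} and 0 elsewhere, and the differential is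
   v (x) e_I |-> \sum_i T_i v (x) e_i /\ e_I. *)
Definition koszul_d (H : hilbertType R) (n : nat) (T : 'I_n -> H -> H)
    (w : {set 'I_n} -> H) : {set 'I_n} -> H :=
  fun I => \sum_(i in I)
    (-1) ^+ #|[set j in I | (j < i)%N]%SET| *: T i (w (I :\ i)%SET).

Definition koszul_exact (H : hilbertType R) (n : nat)
    (T : 'I_n -> H -> H) : Prop :=
  forall w, koszul_d T w =1 (fun=> 0) -> exists u, koszul_d T u =1 w.

(* The Taylor joint spectrum. *)
Definition joint_spectrum (H : hilbertType R) (n : nat)
    (T : 'I_n -> H -> H) : set 'rV[C]_n :=
  [set l | ~ koszul_exact (fun i x => T i x - l 0 i *: x)].

Definition holomorphic_on (n : nat) (U : set 'rV[C]_n) (f : 'rV[C]_n -> C) :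
    Prop := open U /\ forall z, U z -> differentiable f z.

Definition holomorphic_near (n : nat) (K : set 'rV[C]_n) (f : 'rV[C]_n -> C) :
    Prop := exists2 U, K `<=` U & holomorphic_on U f.

(* Taylor's holomorphic functional calculus f |-> f(T) = Phi f, for f
   holomorphic near the joint spectrum (Phi f is irrelevant for other f).  By
   Putinar's theorem at most one calculus has these properties, and Taylor's
   does.  [hc_cont] also makes Phi f depend only on the germ of f. *)
Record holomorphic_calculus (H : hilbertType R) (n : nat) (T : 'I_n -> H -> H)
    (Phi : ('rV[C]_n -> C) -> H -> H) : Prop := {
  hc_bounded : forall f, holomorphic_near (joint_spectrum T) f ->
    bounded_operator (Phi f) ;
  hc_cst : forall (c : C) x, Phi (fun=> c) x = c *: x ;
  hc_coord : forall i x, Phi (fun z => z 0 i) x = T i x ;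
  hc_add : forall f g, holomorphic_near (joint_spectrum T) f ->
    holomorphic_near (joint_spectrum T) g ->
    forall x, Phi (fun z => f z + g z) x = Phi f x + Phi g x ;
  hc_mul : forall f g, holomorphic_near (joint_spectrum T) f ->
    holomorphic_near (joint_spectrum T) g ->
    forall x, Phi (fun z => f z * g z) x = Phi f (Phi g x) ;
  hc_cont : forall (U : set 'rV[C]_n) (f : nat -> 'rV[C]_n -> C) g,
    joint_spectrum T `<=` U ->
    (forall k, holomorphic_on U (f k)) -> holomorphic_on U g ->
    (forall K, compact K -> K `<=` U -> {uniform K, f @ \oo --> g}) ->
    opnorm (fun x => Phi (f k) x - Phi g x) @[k --> \oo] --> (0 : R) ;
  hc_spectral_mapping : forall m (F : 'I_m -> 'rV[C]_n -> C),
    (forall j, holomorphic_near (joint_spectrum T) (F j)) ->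
    joint_spectrum (fun j => Phi (F j)) =
      [set \row_j F j z | z in joint_spectrum T]
}.

(* O(K) *)
Definition bounded_holomorphic_near (n : nat) (K : set 'rV[C]_n)
    (f : 'rV[C]_n -> C) : Prop :=
  exists U, [/\ K `<=` U, holomorphic_on U f &
    exists M : C, forall z, U z -> `|f z| <= M].

Definition sup_norm (n : nat) (K : set 'rV[C]_n) (f : 'rV[C]_n -> C) : R :=
  sup [set rnorm (f z) | z in K].

Definition spectral_set (H : hilbertType R) (n : nat) (K : set 'rV[C]_n)
    (T : 'I_n -> H -> H) : Prop :=
  joint_spectrum T `<=` K /\
  exists2 Phi, holomorphic_calculus T Phi &
    forall f, bounded_holomorphic_near K f -> opnorm (Phi f) <= sup_norm K f.

Definition symmetrization (n : nat) (z : 'rV[C]_n) : 'rV[C]_n :=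
  \row_(i < n) \sum_(I : {set 'I_n} | #|I| == i.+1) \prod_(k in I) z 0 k.

Definition Gamma (n : nat) : set 'rV[C]_n :=
  [set symmetrization z | z in [set z : 'rV[C]_n | forall i, `|z 0 i| <= 1]].

Definition bGamma (n : nat) : set 'rV[C]_n :=
  [set symmetrization z | z in [set z : 'rV[C]_n | forall i, `|z 0 i| = 1]].

Arguments Gamma : clear implicits.
Arguments bGamma : clear implicits.

Definition Gamma_contraction (H : hilbertType R) (n : nat)
    (S : 'I_n -> H -> H) : Prop :=
  commuting_tuple S /\ spectral_set (Gamma n) S.

Definition Gamma_unitary (H : hilbertType R) (n : nat)
    (S : 'I_n -> H -> H) : Prop :=
  [/\ commuting_tuple S, forall i, normal_operator (S i) &
      joint_spectrum S `<=` bGamma n].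

(* An inclusion of Hilbert spaces H \subseteq K is a linear isometry J from H
   to K. *)
Definition hilbert_embedding (H K : hilbertType R) (J : H -> K) : Prop :=
  linear J /\ forall x y, inner (J x) (J y) = inner x y.

(* h is the orthogonal projection of w onto H, identified with J(H). *)
Definition is_projection (H K : hilbertType R) (J : H -> K) (w : K) (h : H) :
    Prop := forall y, inner (w - J h) (J y) = 0.

Definition Gamma_isometry (H : hilbertType R) (n : nat)
    (S : 'I_n -> H -> H) : Prop :=
  commuting_tuple S /\
  exists (K : hilbertType R) (J : H -> K) (N : 'I_n -> K -> K),
    [/\ hilbert_embedding J, Gamma_unitary N &
        forall i x, N i (J x) = J (S i x)].

Definition Gamma_isometric_dilation (H K : hilbertType R) (n : nat)
    (S : 'I_n -> H -> H) (J : H -> K) (V : 'I_n -> K -> K) : Prop :=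
  [/\ hilbert_embedding J, Gamma_isometry V &
      forall (m : 'I_n -> nat) x,
        is_projection J (monomial_op V m (J x)) (monomial_op S m x)].

Definition has_Gamma_isometric_dilation (H : hilbertType R) (n : nat)
    (S : 'I_n -> H -> H) : Prop :=
  exists (K : hilbertType R) (J : H -> K) (V : 'I_n -> K -> K),
    Gamma_isometric_dilation S J V.

Definition matrix_op (d : nat) (A : 'M[C]_d) : euclid R d -> euclid R d :=
  fun x => A *m x.

End Operators.

(* Main.v *)
From HB Require Import structures.
From mathcomp Require Import all_boot all_order all_algebra.
From mathcomp Require Import all_classical all_reals all_analysis.
From mathcomp Require Import complex cyclic separable cyclotomic zify ring lra.
Require Import Defs.

(** A 2 x 2 spectral set is a complete spectral set, and a complete spectral set
has a normal dilation to the Shilov boundary.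

By Stinespring and Arveson, a dilation of the tuple [S] amounts to a positive
functional on the bounded functions on the torus with values in the 2 x 2 matrices,
whose value at a function [P] with polynomial entries in the symmetric functions is
[\sum_ij <P_ij(S) e_j, e_i>]. If the prescribed functional is nonnegative on the
polynomial functions with nonnegative real part, the theorem of M. Riesz
[positive_extension] extends it ([calc_functional]). The extended functional [L]
defines a semidefinite form on row-valued functions, [L (outer w v)], and the space
[gns] of its bounded functionals is a Hilbert space on which bounded functions act
by multiplication. Multiplications by the symmetric functions are normal, and their
Koszul complex is exact at every point outside the distinguished boundary, since
there a combination of them is bounded below on the torus ([outside_bGamma],
[torus_Gamma_unitary]). Constant rows embed the given space, and the values of [L]
on polynomials say that the embedding is a dilation ([embed_dilates]). The dilation
so obtained is unitary, hence isometric.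

It remains to see that the prescribed functional is positive ([calc_trace_ge0]); this
is where the size 2 matters. Let [P] have nonnegative real part on the torus. By the
maximum principle it has nonnegative real part on [Gamma] ([calc_re_polydisc]).
Commuting 2 x 2 matrices have the form [S_i = x_i + nu_i M] with [M] of rank one
([commuting_structure]), so that [f(S) = f(x) + f' M] for every polynomial [f], and
[M f(S) = f(y) M] at the second joint eigenvalue [y = x + tr(M) nu]. The Cayley
transform [W] of [P] centred at [x] is contractive on [Gamma] and vanishes at [x]:
this is the Schwarz lemma for the matrix ball, whose homogeneity is essential
([schwarz_pick_bound]). Hence [W(S)] is the tensor product of a matrix [W'] with
[M], and its norm is the supremum of the norms of its scalar matrix coefficients,
which are controlled by the spectral set hypothesis ([spectral_set_quotient]).
Undoing the Cayley transform gives the positivity ([strict_trace_ge0]). *)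

Set Implicit Arguments.
Unset Strict Implicit.
Unset Printing Implicit Defensive.

Import Order.TTheory GRing.Theory Num.Theory.
Import numFieldNormedType.Exports.

Local Open Scope classical_set_scope.
Local Open Scope ring_scope.

(** * Real and imaginary parts *)

Section ComplexParts.
Variable R : realType.
Local Notation C := (complexC R).
Implicit Types (z w : C) (t : R).

(** The order of the complex numbers compares only numbers with equal imaginary
parts; estimates are carried out in the ordered field [R], through [re] and the
embedding [rc]. *)
Definition re z : R := complex.Re (z : R[i]).
Definition im z : R := complex.Im (z : R[i]).
Definition rc t : C := (t%:C)%C.

Lemma complex_parts z : z = rc (re z) + 'i * rc (im z).
Proof. by rewrite [LHS](complexE (z : R[i])). Qed.

Lemma reD z w : re (z + w) = re z + re w. Proof. exact: raddfD. Qed.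
Lemma reN z : re (- z) = - re z. Proof. exact: raddfN. Qed.
Lemma reB z w : re (z - w) = re z - re w. Proof. exact: raddfB. Qed.
Lemma re0 : re 0 = 0. Proof. by []. Qed.
Lemma reM z w : re (z * w) = re z * re w - im z * im w.
Proof. by case: z w => [a b] [c d]. Qed.
Lemma imM z w : im (z * w) = re z * im w + im z * re w.
Proof. by case: z w => [a b] [c d]. Qed.
Lemma imD z w : im (z + w) = im z + im w. Proof. exact: raddfD. Qed.
Lemma imN z : im (- z) = - im z. Proof. exact: raddfN. Qed.
Lemma re_conj z : re z^* = re z. Proof. by case: z. Qed.
Lemma im_conj z : im z^* = - im z. Proof. by case: z. Qed.
Lemma re_rc t : re (rc t) = t. Proof. by []. Qed.
Lemma im_rc t : im (rc t) = 0. Proof. by []. Qed.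
Lemma re_i : re 'i = 0. Proof. by []. Qed.
Lemma im_i : im 'i = 1. Proof. by []. Qed.
Lemma rcD s t : rc (s + t) = rc s + rc t. Proof. exact: rmorphD. Qed.
Lemma rcN t : rc (- t) = - rc t. Proof. exact: rmorphN. Qed.
Lemma rcM s t : rc (s * t) = rc s * rc t. Proof. exact: rmorphM. Qed.
Lemma rcV t : rc t^-1 = (rc t)^-1. Proof. exact: fmorphV. Qed.
Lemma rcX t n : rc (t ^+ n) = rc t ^+ n. Proof. exact: rmorphXn. Qed.
Lemma rc1 : rc 1 = 1. Proof. by []. Qed.
Lemma rc0 : rc 0 = 0. Proof. by []. Qed.
Lemma rc_conj t : (rc t)^* = rc t.
Proof. by apply/eqP; rewrite eq_complex /= oppr0 !eqxx. Qed.
Lemma re_rcM t z : re (rc t * z) = t * re z.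
Proof. by rewrite reM re_rc im_rc mul0r subr0. Qed.
Lemma re_iM z : re ('i * z) = - im z.
Proof. by rewrite reM re_i im_i mul0r mul1r sub0r. Qed.
Lemma ler_rc s t : (rc s <= rc t) = (s <= t). Proof. exact: lecR. Qed.
Lemma ltr_rc s t : (rc s < rc t) = (s < t). Proof. exact: ltcR. Qed.
Lemma rc_re z : 0 <= z -> rc (re z) = z.
Proof.
rewrite /rc /re; case: z => a b; rewrite lecE /= => /andP[/eqP -> _].
by [].
Qed.
Lemma re_ge0 z : 0 <= z -> 0 <= re z.
Proof. by move=> z0; rewrite -ler_rc (rc_re z0). Qed.
Lemma le_re z w : z <= w -> re z <= re w.
Proof. by rewrite -subr_ge0 => /re_ge0; rewrite reB subr_ge0. Qed.
Lemma eq_re_im z w : re z = re w -> im z = im w -> z = w.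
Proof. by move=> h1 h2; rewrite (complex_parts z) (complex_parts w) h1 h2. Qed.
Lemma sqr_norm z : re (`|z| ^+ 2) = re z ^+ 2 + im z ^+ 2.
Proof. by rewrite normCK reM re_conj im_conj !expr2; ring. Qed.
Lemma sqr_normB_le z w :
  re (`|z - w| ^+ 2) <= 2 * re (`|z| ^+ 2) + 2 * re (`|w| ^+ 2).
Proof.
rewrite !sqr_norm reB imD imN.
have := sqr_ge0 (re z + re w); have := sqr_ge0 (im z + im w); lra.
Qed.
Lemma norm_rc z : `|z| = rc (re `|z|). Proof. by rewrite rc_re. Qed.
Lemma re_le_norm z : re z <= re `|z|.
Proof.
have h := sqr_norm z; have n0 := re_ge0 (normr_ge0 z).
have e : re (`|z| ^+ 2) = re `|z| ^+ 2.
  by rewrite expr2 {1}norm_rc re_rcM.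
move: h; rewrite e => h.
have [//|lt] := lerP (re z) 0; first by move=> h1; exact: le_trans n0.
rewrite -(ler_pXn2r (n:=2)) ?nnegrE ?(ltW lt) // h.
by rewrite lerDl sqr_ge0.
Qed.

End ComplexParts.

(** * Extension of positive functionals *)

Section PositiveExtension.
Variables (R : realType) (E : lmodType (complexC R)).
Local Notation C := (complexC R).
Implicit Types (p q : E -> R) (x y : E).

Definition sublinear p := (forall x y, p (x + y) <= p x + p y) /\
  forall t x, 0 < t -> p (rc t *: x) = t * p x.

Definition real_linear p := (forall x y, p (x + y) = p x + p y) /\
  forall t x, p (rc t *: x) = t * p x.

Lemma real_linearN p x : real_linear p -> p (- x) = - p x.
Proof. by move=> [_ pZ]; have := pZ (-1) x; rewrite rcN rc1 scaleN1r mulN1r. Qed.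

Lemma sublinear0 p : sublinear p -> p 0 = 0.
Proof.
move=> [_ pZ]; have := pZ 2 0 (ltr0Sn _ 1); rewrite scaler0; lra.
Qed.

Lemma sublinear_opp p x : sublinear p -> - p (- x) <= p x.
Proof.
move=> sp; have := sp.1 x (- x); rewrite subrr sublinear0 //; lra.
Qed.

Lemma inf_le_of (A : set R) (m a : R) : (forall b, A b -> m <= b) -> A a ->
  inf A <= a.
Proof. by move=> lb Aa; apply: ge_inf => //; exists m. Qed.

Lemma le_inf_of (A : set R) (m a : R) : A a -> (forall b, A b -> m <= b) ->
  m <= inf A.
Proof. by move=> Aa lb; apply: lb_le_inf => //; exists a. Qed.

Lemma inf_scale (A B : set R) (t m a : R) : 0 < t -> A a ->
  (forall b, A b -> m <= b) -> (forall b, A b -> B (t * b)) ->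
  (forall b, B b -> A (t^-1 * b)) -> inf B = t * inf A.
Proof.
move=> t0 Aa lb AB BA; apply/le_anti/andP; split.
  rewrite mulrC -ler_pdivrMr //; apply: le_inf_of Aa _ => b Ab.
  rewrite ler_pdivrMr // mulrC; apply: (@inf_le_of _ (t * m)); last exact: AB.
  by move=> c /BA /lb; rewrite ler_pdivlMl.
apply: le_inf_of (AB _ Aa) _ => b /BA Bb.
by rewrite -ler_pdivlMl //; exact: inf_le_of lb Bb.
Qed.

(** Zorn's lemma applies because the pointwise infimum of a chain of sublinear
functionals below [p] is sublinear; it is finite since [- p (- x)] bounds all of
them from below at [x]. *)
Lemma minimal_sublinear p : sublinear p ->
  exists q, [/\ sublinear q, forall x, q x <= p x &
    forall r, sublinear r -> (forall x, r x <= q x) -> r = q].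
Proof.
move=> sp; pose T := {q | sublinear q /\ forall x, q x <= p x}.
pose le (q r : T) := `[< forall x, sval r x <= sval q x >].
have [||||[q [sq qp]] qmin] := @Zorn T le.
- by move=> q; apply/asboolP.
- move=> q r s /asboolP h1 /asboolP h2; apply/asboolP => x.
  exact: le_trans (h2 x) (h1 x).
- move=> [q hq] [r hr] /asboolP /= h1 /asboolP /= h2.
  have qr : q = r by apply/funext => x; apply/le_anti; rewrite h2 h1.
  by subst r; congr exist; exact: Prop_irrelevance.
- move=> A Atot; have [[q0 Aq0]|A0] := pselect (exists q : T, A q); last first.
    by exists (exist _ p (conj sp (fun x => lexx _))) => s As; case: A0; exists s.
  pose V x := [set sval q x | q in (A : set T)].
  have Vlb x b : V x b -> - p (- x) <= b.
    move=> [[q [sq qp]] Aq <-] /=; apply: le_trans (sublinear_opp x sq).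
    by rewrite lerN2.
  have Vq0 x : V x (sval q0 x) by exists q0.
  pose r x := inf (V x).
  have rle (q : T) x : A q -> r x <= sval q x.
    by move=> Aq; apply: inf_le_of (Vlb x) _; exists q.
  have sr : sublinear r.
    split=> [x y|t x t0].
      rewrite -lerBlDr; apply: le_inf_of (Vq0 x) _ => _ [q Aq <-].
      rewrite lerBlDr -lerBlDl; apply: le_inf_of (Vq0 y) _ => _ [q' Aq' <-].
      rewrite lerBlDl.
      have [/asboolP h|/asboolP h] := Atot _ _ Aq Aq'.
        apply: le_trans (rle _ _ Aq') _.
        by apply: le_trans ((svalP q').1.1 _ _) _; rewrite lerD2r.
      apply: le_trans (rle _ _ Aq) _.
      by apply: le_trans ((svalP q).1.1 _ _) _; rewrite lerD2l.
    apply: (inf_scale t0 (Vq0 x) (Vlb x) _ _).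
      by move=> _ [q Aq <-]; exists q => //; have [[_ qZ] _] := svalP q; exact: qZ.
    move=> _ [q Aq <-]; exists q => //.
    have [[_ qZ] _] := svalP q.
    by rewrite qZ // mulrA mulVf ?mul1r // gt_eqF.
  have rp x : r x <= p x by apply: le_trans (rle _ _ Aq0) ((svalP q0).2 x).
  by exists (exist _ r (conj sr rp)) => s As; apply/asboolP => x; exact: rle.
exists q; split=> // r sr rq.
have rp x : r x <= p x by exact: le_trans (rq x) (qp x).
have e := qmin (exist _ r (conj sr rp)).
by have /(congr1 sval) := e (introT (asboolP _) rq).
Qed.

(** A minimal sublinear functional is linear, which avoids extending functionals
from subspace to subspace. *)
Lemma dominated_linear p : sublinear p ->
  exists2 l, real_linear l & forall x, l x <= p x.
Proof.
move=> /minimal_sublinear [q [sq qp qmin]]; exists q => //.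
have q0 := sublinear0 sq; have [qD qZ] := sq.
have qadd x y : q (x + y) = q x + q y.
  apply/le_anti; rewrite qD /=.
  (* The sublinear functional inf_t (q (z + t x) - t q x) is below q, hence equal
     to it; its term t = 1 at z = y gives q x + q y <= q (x + y). *)
  pose V z := [set r : R | exists2 t : R, 0 <= t & r = q (z + rc t *: x) - t * q x].
  have qZ0 t z : 0 <= t -> q (rc t *: z) = t * q z.
    rewrite le_eqVlt => /orP[/eqP <-|/qZ//].
    by rewrite rc0 scale0r q0 mul0r.
  have Vlb z b : V z b -> - q (- z) <= b.
    move=> [t t0 ->]; have := qD (z + rc t *: x) (- z).
    by rewrite addrAC subrr add0r qZ0 //; lra.
  have Vq z : V z (q z).
    by exists 0 => //; rewrite rc0 scale0r addr0 mul0r subr0.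
  pose r z := inf (V z).
  have rq z : r z <= q z by exact: inf_le_of (Vlb z) (Vq z).
  have sr : sublinear r.
    split=> [u v|t u t0].
      rewrite -lerBlDr; apply: le_inf_of (Vq u) _ => _ [s s0 ->].
      rewrite lerBlDr -lerBlDl; apply: le_inf_of (Vq v) _ => _ [t t0 ->].
      rewrite lerBlDl.
      apply: le_trans (inf_le_of (Vlb (u + v)) (a := q (u + v + rc (s + t) *: x) - (s + t) * q x) _) _.
        by exists (s + t) => //; exact: addr_ge0.
      have := qD (u + rc s *: x) (v + rc t *: x).
      rewrite addrACA -scalerDl -rcD; lra.
    apply: (inf_scale t0 (Vq u) (Vlb u) _ _).
      move=> _ [s s0 ->]; exists (t * s); first by rewrite mulr_ge0 // ltW.
      by rewrite mulrBr -qZ // scalerDr scalerA -rcM mulrA.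
    move=> _ [s s0 ->]; exists (t^-1 * s); first by rewrite mulr_ge0 // invr_ge0 ltW.
    rewrite mulrBr -qZ ?invr_gt0 // scalerDr !scalerA -!rcM mulrA.
    by rewrite mulVf ?rc1 ?scale1r // gt_eqF.
  have rE : r = q by exact: qmin.
  have : r y <= q (y + rc 1 *: x) - 1 * q x.
    by apply: inf_le_of (Vlb y) _; exists 1.
  rewrite rE rc1 scale1r (addrC y); lra.
split=> // t x.
have qN y : q (- y) = - q y by have := qadd y (- y); rewrite subrr q0; lra.
have [->|] := eqVneq t 0; first by rewrite rc0 scale0r q0 mul0r.
rewrite neq_lt => /orP[t0|t0]; last exact: qZ.
by rewrite -{1}[t]opprK rcN scaleNr qN qZ ?oppr_gt0 // mulNr opprK.
Qed.

(** The extension theorem of M. Riesz, the prescribed functional being given by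
a linear relation [F]: that [F] is single-valued follows from positivity. It is
the Hahn-Banach theorem for the sublinear functional
[p x = inf {r | (f, r) in F, f - x in P}]. *)
Lemma positive_extension (P : set E) (F : set (E * R)) :
  P 0 ->
  (forall x y, P x -> P y -> P (x + y)) ->
  (forall t x, 0 < t -> P x -> P (rc t *: x)) ->
  (forall u v, F u -> F v -> F (u.1 + v.1, u.2 + v.2)) ->
  (forall t u, F u -> F (rc t *: u.1, t * u.2)) ->
  (forall u, F u -> P u.1 -> 0 <= u.2) ->
  (forall x, exists2 u, F u & P (u.1 - x)) ->
  exists l, [/\ real_linear l, forall x, P x -> 0 <= l x &
    forall u, F u -> l u.1 = u.2].
Proof.
move=> P0 PD PZ FD FZ Fpos Fmaj.
pose V x := [set r : R | exists2 u, F u /\ P (u.1 - x) & r = u.2].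
have FN u : F u -> F (- u.1, - u.2).
  by move=> /(FZ (-1)); rewrite rcN rc1 scaleN1r mulN1r.
have Vne x : exists r, V x r.
  by have [u Fu Pu] := Fmaj x; exists u.2; exists u.
have Vlb x : exists m, forall b, V x b -> m <= b.
  have [v Fv Pv] := Fmaj (- x); exists (- v.2) => _ [u [Fu Pu] ->].
  have := Fpos _ (FD _ _ Fu Fv) => /=.
  rewrite opprK in Pv; have := PD _ _ Pu Pv.
  by rewrite addrACA addNr addr0 => h /(_ h); lra.
pose p x := inf (V x).
have ple x r : V x r -> p x <= r.
  by have [m lb] := Vlb x => Vr; exact: inf_le_of lb Vr.
have sp : sublinear p.
  split=> [x y|t x t0].
    have [a Va] := Vne x; have [b Vb] := Vne y.
    rewrite -lerBlDr; apply: le_inf_of Va _ => _ [u [Fu Pu] ->].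
    rewrite lerBlDr -lerBlDl; apply: le_inf_of Vb _ => _ [v [Fv Pv] ->].
    rewrite lerBlDl; apply: ple; exists (u.1 + v.1, u.2 + v.2) => //=.
    by split; [exact: FD|rewrite opprD addrACA; exact: PD].
  have [a Va] := Vne x; have [m lb] := Vlb x.
  apply: (inf_scale t0 Va lb _ _).
    move=> _ [u [Fu Pu] ->]; exists (rc t *: u.1, t * u.2) => //=.
    by split; [exact: FZ|rewrite -scalerBr; exact: PZ].
  move=> _ [u [Fu Pu] ->]; exists (rc t^-1 *: u.1, t^-1 * u.2) => //=.
  split; first exact: FZ.
  have -> : rc t^-1 *: u.1 - x = rc t^-1 *: (u.1 - rc t *: x).
    by rewrite scalerBr scalerA -rcM mulVf ?rc1 ?scale1r // gt_eqF.
  by apply: PZ => //; rewrite invr_gt0.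
have [l ll lp] := dominated_linear sp; exists l; split=> //.
- move=> x Px; have [lD lZ] := ll.
  have [u Fu _] := Fmaj 0.
  have : p (- x) <= 0.
    apply: ple; exists (rc 0 *: u.1, 0 * u.2); last by rewrite mul0r.
    by split; [exact: FZ|rewrite /= rc0 scale0r opprK add0r].
  have := lp (- x); have := lZ (-1) x; rewrite rcN rc1 scaleN1r; lra.
- move=> u Fu; apply/le_anti/andP; split.
    by apply: le_trans (lp _) _; apply: ple; exists u => //; rewrite subrr.
  have := lp (- u.1); have := ll.2 (-1) u.1; rewrite rcN rc1 scaleN1r.
  have : p (- u.1) <= - u.2.
    by apply: ple; exists (- u.1, - u.2) => //; split; [exact: FN|rewrite subrr].
  lra.
Qed.

End PositiveExtension.

Record psd_form (R : realType) (V : lmodType (complexC R)) := PsdForm {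
  psd_fun :> V -> V -> complexC R ;
  psd_linear : forall (a : complexC R) u v w,
    psd_fun (a *: u + v) w = a * psd_fun u w + psd_fun v w ;
  psd_conj : forall u v, psd_fun u v = (psd_fun v u)^* ;
  psd_ge0 : forall v, 0 <= re (psd_fun v v)
}.

(** * The Hilbert space of a positive semidefinite form *)

Section Elementary.
Variable R : realType.

Lemma le0_small (a b : R) : (forall s, 0 < s -> a <= s * b) -> a <= 0.
Proof.
move=> h; rewrite leNgt; apply/negP => a0.
have b0 : 0 < b by have := h 1 ltr01; lra.
have s0 : 0 < a / (2 * b) by rewrite divr_gt0 // mulr_gt0.
have := h _ s0; have -> : a / (2 * b) * b = a / 2 by field; rewrite gt_eqF.
by lra.
Qed.

(** The difference with [t * f 1] is additive, vanishes on integers and is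
bounded, hence is zero. *)
Lemma additive_bounded_linear (f : R -> R) (B : R) :
  (forall s t, f (s + t) = f s + f t) ->
  (forall t, 0 <= t <= 1 -> `|f t| <= B) -> forall t, f t = t * f 1.
Proof.
move=> fD fB t; pose g s := f s - s * f 1.
have gD s u : g (s + u) = g s + g u by rewrite /g fD; ring.
have g0 : g 0 = 0 by have := gD 0 0; rewrite addr0; lra.
have gN s : g (- s) = - g s by have := gD s (- s); rewrite subrr g0; lra.
have gnat n s : g (n%:R * s) = n%:R * g s.
  elim: n => [|n IHn]; first by rewrite !mul0r g0.
  by rewrite -addn1 natrD !mulrDl gD IHn !mul1r.
have g1 : g 1 = 0 by rewrite /g mul1r subrr.
have gint (z : int) : g z%:~R = 0.
  case: z => n; first by have := gnat n 1; rewrite mulr1 g1 mulr0.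
  by rewrite NegzE mulrNz gN; have := gnat n.+1 1; rewrite mulr1 g1 mulr0 => ->; rewrite oppr0.
have gB s : `|g s| <= B + `|f 1|.
  have -> : g s = g (s - (Num.floor s)%:~R) by rewrite gD gN gint subr0.
  have /andP[h1 h2] := mem_rg1_floor s.
  set u := s - _; have u01 : 0 <= u <= 1 by rewrite /u; apply/andP; split; lra.
  rewrite /g; apply: le_trans (ler_normB _ _) _; rewrite lerD ?fB //.
  rewrite normrM ger0_norm; last by case/andP: u01.
  by rewrite ler_piMl //; case/andP: u01.
have gt0 : `|g t| <= 0.
  apply: (@le0_small _ (B + `|f 1|)) => s s0.
  have [n hn] : exists n : nat, s^-1 < n%:R.
    by exists (Num.bound s^-1); rewrite archi_boundP // invr_ge0 ltW.
  have := gB (n%:R * t); rewrite gnat normrM ger0_norm // => h.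
  have n0 : 0 < n%:R :> R by apply: lt_trans hn; rewrite invr_gt0.
  rewrite -ler_pdivrMl // ; apply: le_trans h.
  by rewrite ler_wpM2r // ltW.
by move: gt0; rewrite normr_le0 /g subr_eq0 => /eqP.
Qed.

End Elementary.

Lemma complex_mul_parts (R : realType) (a : complexC R) (p q r s : R) :
  rc (re a * p - im a * q + r) + 'i * rc (re a * q - im a * - p + s) =
  a * (rc p + 'i * rc q) + (rc r + 'i * rc s).
Proof.
by apply: eq_re_im; rewrite !(reD, imD, reM, imM, re_rc, im_rc, re_i, im_i); ring.
Qed.

Lemma complex_conj_parts (R : realType) (p q : R) :
  (rc p + 'i * rc q)^* = rc p + 'i * rc (- q).
Proof.
by apply: eq_re_im; rewrite ?re_conj ?im_conj !(reD, imD, reM, imM, re_rc, im_rc, re_i, im_i); ring.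
Qed.

Section Gns.
Variables (R : realType) (V : lmodType (complexC R)) (Q : psd_form V).
Local Notation C := (complexC R).
Implicit Types (u v w : V) (h g f : V -> C) (a : C) (t : R).

Lemma psdD u v w : Q (u + v) w = Q u w + Q v w.
Proof. by have := psd_linear Q 1 u v w; rewrite scale1r mul1r. Qed.
Lemma psd0 w : Q 0 w = 0.
Proof. by have /eqP := psdD 0 0 w; rewrite addr0 -subr_eq0 opprD addrA subrr sub0r oppr_eq0 => /eqP. Qed.
Lemma psdZ a u w : Q (a *: u) w = a * Q u w.
Proof. by have := psd_linear Q a u 0 w; rewrite psd0 !addr0. Qed.
Lemma psdDr u v w : Q w (u + v) = Q w u + Q w v.
Proof. by rewrite psd_conj psdD rmorphD /= -!psd_conj. Qed.
Lemma psdZr a u w : Q w (a *: u) = a^* * Q w u.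
Proof. by rewrite psd_conj psdZ rmorphM /= -psd_conj. Qed.
Lemma psd_real v : Q v v = rc (re (Q v v)).
Proof.
apply: eq_re_im => //; have := congr1 (@im R) (psd_conj Q v v).
by rewrite im_conj /=; lra.
Qed.
Lemma psdNr v w : Q w (- v) = - Q w v.
Proof. by rewrite -scaleN1r psdZr rmorphN /= conjC1 mulN1r. Qed.
Lemma psdNN v : Q (- v) (- v) = Q v v.
Proof. by rewrite psdNr -[- v]scaleN1r psdZ mulN1r opprK. Qed.
Lemma psdZZ a v : re (Q (a *: v) (a *: v)) = (re a ^+ 2 + im a ^+ 2) * re (Q v v).
Proof.
rewrite psdZ psdZr mulrA psd_real mulrC re_rcM mulrC reM re_conj im_conj.
congr (_ * _); ring.
Qed.
Lemma psdDD u v : re (Q (u + v) (u + v)) =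
  re (Q u u) + re (Q v v) + 2 * re (Q u v).
Proof.
rewrite psdD !psdDr !reD [Q v u]psd_conj re_conj; ring.
Qed.

(** The supremum of [gap h] over [v] is the squared norm of the functional [h]
for the seminorm of [Q]: it is the Legendre transform of [re (Q v v)], and being
a supremum of expressions affine in [h] it makes sense without any completion. *)
Definition gap h v := 2 * re (h v) - re (Q v v).

Lemma gap_form_le v w : gap (Q v) w <= re (Q v v).
Proof.
by rewrite /gap; have := psd_ge0 Q (v - w); rewrite psdDD psdNN psdNr reN; lra.
Qed.

Definition antilinear h := forall a u v, h (a *: u + v) = a^* * h u + h v.

Definition gns_pred : {pred V -> C} :=
  [pred h | `[< antilinear h /\ exists B, forall v, gap h v <= B >]].

Lemma antilinearD h u v : antilinear h -> h (u + v) = h u + h v.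
Proof. by move=> ah; have := ah 1 u v; rewrite scale1r conjC1 mul1r. Qed.
Lemma antilinear0 h : antilinear h -> h 0 = 0.
Proof.
move=> ah; have /eqP := antilinearD 0 0 ah.
by rewrite addr0 -subr_eq0 opprD addrA subrr sub0r oppr_eq0 => /eqP.
Qed.
Lemma antilinearZ h a v : antilinear h -> h (a *: v) = a^* * h v.
Proof. by move=> ah; have := ah a v 0; rewrite antilinear0 // !addr0. Qed.

Lemma gapZ h a v : antilinear h -> a != 0 ->
  gap (fun v => a * h v) v = (re a ^+ 2 + im a ^+ 2) * gap h (a^-1 *: v).
Proof.
move=> ah a0; rewrite /gap antilinearZ // psdZZ mulrBr.
have e : rc (re a ^+ 2 + im a ^+ 2) = a * a^*.
  by rewrite -normCK -[RHS]rc_re ?exprn_ge0 // sqr_norm.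
have aa : (re a ^+ 2 + im a ^+ 2) * (re a^-1 ^+ 2 + im a^-1 ^+ 2) = 1.
  rewrite -!sqr_norm -re_rcM rc_re ?exprn_ge0 // -exprMn -normrM mulfV //.
  by rewrite normr1 expr1n.
congr (_ - _); last by rewrite mulrA aa mul1r.
rewrite mulrCA; congr (2 * _); rewrite -[RHS]re_rcM e fmorphV /=.
by rewrite -mulrA mulVKf // conjC_eq0.
Qed.

(** Substituting [v = a + b], [w = a - b] turns the parallelogram law of [Q]
into that of its dual norm. *)
Lemma gap_parallelogram h g u v : antilinear h -> antilinear g ->
  gap (fun v => h v + g v) u + gap (fun v => h v - g v) v =
  2 * gap h (2^-1 *: (u + v)) + 2 * gap g (2^-1 *: (u - v)).
Proof.
move=> ah ag; rewrite /gap (antilinearZ _ _ ah) (antilinearZ _ _ ag).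
rewrite (antilinearD _ _ ah) (antilinearD _ _ ag).
have hN w : h (- w) = - h w by rewrite -scaleN1r antilinearZ // rmorphN /= conjC1 mulN1r.
have gN w : g (- w) = - g w by rewrite -scaleN1r antilinearZ // rmorphN /= conjC1 mulN1r.
rewrite gN !psdZZ !psdDD.
have e : (2^-1 : C) = rc 2^-1 by rewrite /rc fmorphV rmorph_nat.
rewrite psdNN psdNr reN.
rewrite e rc_conj re_rc im_rc !re_rcM !reD !reN; by field.
Qed.

Lemma gap_bound_Z h a B : antilinear h -> a != 0 -> (forall v, gap h v <= B) ->
  forall v, gap (fun v => a * h v) v <= (re a ^+ 2 + im a ^+ 2) * B.
Proof.
move=> ah a0 hB v; rewrite gapZ // ler_wpM2l ?hB //.
by rewrite addr_ge0 ?sqr_ge0.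
Qed.

Lemma gap_bound_D h g B B' : antilinear h -> antilinear g ->
  (forall v, gap h v <= B) -> (forall v, gap g v <= B') ->
  forall v, gap (fun v => h v + g v) v <= 2 * B + 2 * B'.
Proof.
move=> ah ag hB gB v.
have -> : gap (fun v => h v + g v) v =
          gap (fun v => h v + g v) v + gap (fun v => h v - g v) 0.
  by rewrite [X in _ + X]/gap psd0 !antilinear0 // subrr !re0 mulr0 subrr addr0.
rewrite gap_parallelogram // lerD // ler_wpM2l //.
Qed.

Lemma gns_submod : submod_closed gns_pred.
Proof.
split=> [|a h g].
  apply/asboolP; split=> [a u v|]; first by rewrite mulr0 addr0.
  by exists 0 => v; rewrite /gap mulr0 sub0r oppr_le0 psd_ge0.
move=> /asboolP[ah [B hB]] /asboolP[ag [B' gB]]; apply/asboolP; split.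
  move=> b u v.
  change (a * h (b *: u + v) + g (b *: u + v) =
    b^* * (a * h u + g u) + (a * h v + g v)).
  by rewrite ah ag; ring.
have [->|a0] := eqVneq a 0; first by exists B'; rewrite scale0r add0r.
exists (2 * ((re a ^+ 2 + im a ^+ 2) * B) + 2 * B') => v.
apply: (@gap_bound_D (fun v => a * h v)) => //; last exact: gap_bound_Z.
by move=> b u w; rewrite ah; ring.
Qed.

HB.instance Definition _ := GRing.isSubmodClosed.Build C (V -> C) gns_pred
  (GRing.submod_closed_semi gns_submod).

(** The completion of [V] modulo the null space of [Q], realized as the space of
bounded antilinear functionals on [V]: [x] stands for [v |-> inner x v]. This
avoids quotients and Cauchy sequences, and an operator with an adjoint on [V]
acts by composition with the adjoint. *)
Record gns := GnsMk { gns_val :> V -> C ; _ : gns_val \in gns_pred }.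
HB.instance Definition _ := [isSub for gns_val].
HB.instance Definition _ := [Choice of gns by <:].
HB.instance Definition _ := [SubChoice_isSubLmodule of gns by <:].

Implicit Types x y z : gns.

Lemma gns_antilinear x : antilinear x.
Proof. by case: x => h /= /asboolP[]. Qed.
Lemma gnsD x y v : (x + y) v = x v + y v. Proof. by []. Qed.
Lemma gnsZ a x v : (a *: x) v = a * x v. Proof. by []. Qed.
Lemma gnsN x v : (- x) v = - x v. Proof. by []. Qed.
Lemma gns0 v : (0 : gns) v = 0. Proof. by []. Qed.
Lemma gns_ext x y : (forall v, x v = y v) -> x = y.
Proof. by move=> h; apply/val_inj/funext. Qed.

Definition gns_sqn x : R := sup (range (gap x)).

Lemma gap_le x v : gap x v <= gns_sqn x.
Proof.
case: x => h hP; have /asboolP[_ [B hB]] := hP.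
by apply: ub_le_sup; [exists B => _ [w _ <-]; exact: hB|exists v].
Qed.

Lemma gns_sqn_le x B : (forall v, gap x v <= B) -> gns_sqn x <= B.
Proof.
move=> hB; apply: ge_sup; first by exists (gap x 0); exists 0.
by move=> _ [v _ <-].
Qed.

Lemma gap0 x : gap x 0 = 0.
Proof. by rewrite /gap psd0 antilinear0 ?re0; [lra|exact: gns_antilinear]. Qed.

Lemma gns_sqn_ge0 x : 0 <= gns_sqn x.
Proof. by rewrite -(gap0 x) gap_le. Qed.

Lemma gns_sqnZ a x : gns_sqn (a *: x) = (re a ^+ 2 + im a ^+ 2) * gns_sqn x.
Proof.
have [->|a0] := eqVneq a 0.
  rewrite scale0r !re0 expr0n /= addr0 mul0r; apply/le_anti.
  rewrite gns_sqn_ge0 andbT; apply: gns_sqn_le => v.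
  by rewrite /gap gns0 re0 mulr0 sub0r oppr_le0 psd_ge0.
have le b y : b != 0 -> gns_sqn (b *: y) <= (re b ^+ 2 + im b ^+ 2) * gns_sqn y.
  move=> b0; apply: gns_sqn_le => v; apply: (@gap_bound_Z y) => //.
    exact: gns_antilinear.
  exact: gap_le.
apply/le_anti; rewrite le //=.
have a2 : 0 < re a ^+ 2 + im a ^+ 2.
  by rewrite -sqr_norm -ltr_rc rc_re ?exprn_ge0 // exprn_gt0 ?normr_gt0.
rewrite -ler_pdivlMl //; have := le a^-1 (a *: x).
rewrite scalerA mulVf // scale1r invr_eq0 => /(_ a0) /le_trans; apply.
rewrite ler_wpM2r ?gns_sqn_ge0 //.
rewrite -!sqr_norm -ler_rc rc_re ?exprn_ge0 // normfV exprVn.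
by rewrite rcV rc_re ?exprn_ge0.
Qed.

Lemma gns_parallelogram x y :
  gns_sqn (x + y) + gns_sqn (x - y) = 2 * gns_sqn x + 2 * gns_sqn y.
Proof.
have le x' y' :
    gns_sqn (x' + y') + gns_sqn (x' - y') <= 2 * gns_sqn x' + 2 * gns_sqn y'.
  rewrite -lerBrDr; apply: gns_sqn_le => u.
  rewrite lerBrDr -lerBrDl; apply: gns_sqn_le => v.
  rewrite lerBrDl.
  have := gap_parallelogram u v (gns_antilinear x') (gns_antilinear y').
  rewrite -[gap (fun v => x' v + y' v) u]/(gap (x' + y') u).
  rewrite -[gap (fun v => x' v - y' v) v]/(gap (x' - y') v) => ->.
  by rewrite lerD // ler_wpM2l // gap_le.
have two z : gns_sqn (z + z) = 4 * gns_sqn z.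
  have -> : z + z = rc 2 *: z by rewrite -[2]/(1 + 1) rcD rc1 scalerDl scale1r.
  by rewrite gns_sqnZ re_rc im_rc; ring.
apply/le_anti; rewrite le /=.
have := le (x + y) (x - y).
have -> : x + y + (x - y) = x + x by rewrite addrACA subrr addr0.
have -> : x + y - (x - y) = y + y by rewrite opprD opprK addrACA subrr add0r.
rewrite !two; lra.
Qed.

Definition gns_re x y : R := (gns_sqn (x + y) - gns_sqn (x - y)) / 4.

Lemma gns_sqnN x : gns_sqn (- x) = gns_sqn x.
Proof. by rewrite -scaleN1r gns_sqnZ reN imN oppr0 expr0n /= addr0 sqrrN expr1n mul1r. Qed.

Lemma gns_reC x y : gns_re x y = gns_re y x.
Proof. by rewrite /gns_re -(opprB y x) gns_sqnN [x + y]addrC. Qed.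

Lemma gns_re0 y : gns_re 0 y = 0.
Proof. by rewrite /gns_re add0r sub0r gns_sqnN subrr mul0r. Qed.

(** The Jordan-von Neumann argument: a norm satisfying the parallelogram law
comes from an inner product. *)
Lemma gns_reD x y z : gns_re (x + y) z = gns_re x z + gns_re y z.
Proof.
have half2 x1 x2 : gns_re (x1 + x2) z + gns_re (x1 - x2) z = 2 * gns_re x1 z.
  have e1 := gns_parallelogram (x1 + z) x2.
  have e2 := gns_parallelogram (x1 - z) x2.
  rewrite /gns_re.
  have -> : x1 + x2 + z = x1 + z + x2 by rewrite addrAC.
  have -> : x1 - x2 + z = x1 + z - x2 by rewrite addrAC.
  have -> : x1 + x2 - z = x1 - z + x2 by rewrite addrAC.
  have -> : x1 - x2 - z = x1 - z - x2 by rewrite addrAC.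
  move: (gns_sqn (x1 + z + x2)) (gns_sqn (x1 + z - x2)) (gns_sqn (x1 - z + x2))
    (gns_sqn (x1 - z - x2)) (gns_sqn (x1 + z)) (gns_sqn (x1 - z)) e1 e2.
  by move=> a b c d e f e1 e2; lra.
have dbl x1 : gns_re (x1 + x1) z = 2 * gns_re x1 z.
  by rewrite -(half2 x1 x1) subrr gns_re0 addr0.
have hf : rc (2^-1 : R) + rc 2^-1 = 1.
  by rewrite -rcD -rc1; congr rc; field.
have h2 x1 : rc 2^-1 *: x1 + rc 2^-1 *: x1 = x1.
  by rewrite -scalerDl hf scale1r.
have := half2 (rc 2^-1 *: (x + y)) (rc 2^-1 *: (x - y)).
have -> : rc 2^-1 *: (x + y) + rc 2^-1 *: (x - y) = x.
  by rewrite -scalerDr addrACA subrr addr0 scalerDr h2.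
have -> : rc 2^-1 *: (x + y) - rc 2^-1 *: (x - y) = y.
  by rewrite -scalerBr opprD opprK addrACA subrr add0r scalerDr h2.
by rewrite -(dbl (rc 2^-1 *: (x + y))) h2 => ->.
Qed.

Lemma gns_sqn_form v x (ix : forall w, x w = Q v w) : gns_sqn x = re (Q v v).
Proof.
apply/le_anti/andP; split; last by have := gap_le x v; rewrite /gap ix; lra.
apply: gns_sqn_le => w; rewrite /gap ix; exact: gap_form_le.
Qed.

(** For a functional [y] represented by a vector [v], translating the supremum by
[v] computes the norm of [x + y]; this is the reproducing property. *)
Lemma gns_sqnD_form v x y (iy : forall w, y w = Q v w) :
  gns_sqn (x + y) = gns_sqn x + 2 * re (x v) + re (Q v v).
Proof.
have key z (w : V) : gap (z + y) (w + v) = gap z w + 2 * re (z v) + re (Q v v).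
  rewrite /gap gnsD !iy psdDD psdDr !reD (antilinearD _ _ (gns_antilinear z)).
  rewrite reD [Q v w]psd_conj re_conj; lra.
apply/le_anti/andP; split.
  apply: gns_sqn_le => w; rewrite -(subrK v w) key.
  by rewrite !lerD2r gap_le.
rewrite -addrA -lerBrDr; apply: gns_sqn_le => w.
by rewrite lerBrDr addrA -key gap_le.
Qed.

Lemma gns_reZ t x y : gns_re (rc t *: x) y = t * gns_re x y.
Proof.
rewrite -[in RHS](scale1r x) -rc1.
apply: (@additive_bounded_linear _ (fun t => gns_re (rc t *: x) y)
  ((gns_sqn x + gns_sqn y) / 2)) => [s u|u /andP[u0 u1]].
  by rewrite rcD scalerDl gns_reD.
have := gns_parallelogram (rc u *: x) y; rewrite gns_sqnZ re_rc im_rc /gns_re.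
have := gns_sqn_ge0 (rc u *: x + y); have := gns_sqn_ge0 (rc u *: x - y).
have : (u ^+ 2 + 0 ^+ 2) * gns_sqn x <= gns_sqn x.
  by rewrite expr0n addr0 ler_piMl ?gns_sqn_ge0 // expr_le1.
rewrite ler_norml => h1 h2 h3 h4; apply/andP; split; lra.
Qed.

Definition gns_inner x y : C := rc (gns_re x y) + 'i * rc (gns_re x ('i *: y)).

Lemma gns_reii x y : gns_re ('i *: x) ('i *: y) = gns_re x y.
Proof.
by rewrite /gns_re -scalerDr -scalerBr !gns_sqnZ re_i im_i expr0n add0r expr1n !mul1r.
Qed.

Lemma gns_reN x y : gns_re (- x) y = - gns_re x y.
Proof. by rewrite -scaleN1r -rc1 -rcN gns_reZ mulN1r. Qed.

Lemma gns_rei x y : gns_re ('i *: x) y = - gns_re x ('i *: y).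
Proof. by rewrite -gns_reii scalerA -expr2 sqrCi scaleN1r gns_reN. Qed.

Lemma gns_inner_linear a x y z :
  gns_inner (a *: x + y) z = a * gns_inner x z + gns_inner y z.
Proof.
have re_a (w : gns) : gns_re (a *: x) w = re a * gns_re x w - im a * gns_re x ('i *: w).
  rewrite [in LHS](complex_parts a) scalerDl gns_reD gns_reZ -scalerA gns_rei gns_reZ.
  by [].
rewrite /gns_inner !gns_reD !re_a scalerA -expr2 sqrCi scaleN1r.
rewrite [gns_re x (- z)]gns_reC gns_reN [gns_re z x]gns_reC.
exact: complex_mul_parts.
Qed.

Lemma gns_inner_conj x y : gns_inner x y = (gns_inner y x)^*.
Proof.
rewrite /gns_inner complex_conj_parts -gns_rei [gns_re x y]gns_reC.
by rewrite [gns_re x ('i *: y)]gns_reC.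
Qed.

Lemma gns_sqn0 : gns_sqn 0 = 0.
Proof. by rewrite -(scale0r 0) gns_sqnZ !re0 expr0n /= addr0 mul0r. Qed.

Lemma gns_inner_sqn x : gns_inner x x = rc (gns_sqn x).
Proof.
have h : gns_re x ('i *: x) = 0 by have := gns_rei x x; rewrite gns_reC; lra.
rewrite /gns_inner h mulr0 addr0; congr rc.
have := gns_parallelogram x x.
rewrite /gns_re subrr gns_sqn0; lra.
Qed.

Lemma gns_sqn_eq0 x : gns_sqn x = 0 -> x = 0.
Proof.
move=> x0; apply: gns_ext => v; rewrite gns0.
apply/eqP; rewrite -normr_eq0 -sqrf_eq0; apply/eqP.
rewrite -[LHS]rc_re ?exprn_ge0 // -[RHS]rc0; congr rc.
apply/le_anti; rewrite (re_ge0 (exprn_ge0 _ _)) // andbT.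
rewrite sqr_norm.
apply: (@le0_small _ _ ((re (x v) ^+ 2 + im (x v) ^+ 2) * re (Q v v))) => s s0.
have := gap_le x ((rc s * x v) *: v); rewrite x0 /gap psdZZ.
rewrite antilinearZ; last exact: gns_antilinear.
rewrite rmorphM /= rc_conj -mulrA re_rcM [(x v)^* * _]mulrC -normCK.
rewrite !sqr_norm !(reM, imM) re_rc im_rc.
set p := _ + _ ^+ 2; set q := re (Q v v).
have -> : (s * re (x v) - 0 * im (x v)) ^+ 2 + (s * im (x v) + 0 * re (x v)) ^+ 2
   = s * (s * p) by rewrite /p; ring.
move=> hh; have : s * (2 * p) <= s * (s * p * q).
  rewrite -subr_le0; move: hh; congr (_ <= 0); ring.
rewrite ler_pM2l // => h.
have p0 : 0 <= p by rewrite addr_ge0 ?sqr_ge0.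
by rewrite mulrA; lra.
Qed.

Lemma gns_inner_bilinear :
  bilinear_for ( *%R : GRing.Scale.law C C)
    ((@Num.conj C) \; *%R : GRing.Scale.law C C) gns_inner.
Proof.
split=> [y a x z|x a y z]; first exact: gns_inner_linear.
rewrite [LHS]gns_inner_conj gns_inner_linear rmorphD rmorphM /=.
by congr (_ * _ + _); rewrite [RHS]gns_inner_conj.
Qed.

HB.instance Definition _ := bilinear_isBilinear.Build C gns gns C
  ( *%R : GRing.Scale.law C C)
  ((@Num.conj C) \; *%R : GRing.Scale.law C C) gns_inner gns_inner_bilinear.

Lemma gns_inner_herm x y : gns_inner x y = (-1) ^+ false * (gns_inner y x)^*.
Proof. by rewrite mul1r gns_inner_conj. Qed.

HB.instance Definition _ := isHermitianSesquilinear.Build C gns false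
  (@Num.conj C) gns_inner gns_inner_herm.

Lemma gns_inner_gt0 x : x != 0 -> 0 < gns_inner x x.
Proof.
move=> x0; rewrite gns_inner_sqn -rc0 ltr_rc lt_neqAle gns_sqn_ge0 andbT eq_sym.
by apply: contraNN x0 => /eqP /gns_sqn_eq0 ->.
Qed.

HB.instance Definition _ := isDotProduct.Build C gns gns_inner gns_inner_gt0.

Definition gns_dot : {dot gns for (@Num.conj C)} := gns_inner.

Lemma gns_sqnD x y : gns_sqn (x + y) = gns_sqn x + 2 * gns_re x y + gns_sqn y.
Proof. by have := gns_parallelogram x y; rewrite /gns_re; lra. Qed.

Lemma gns_cauchy_schwarz x y : gns_re x y ^+ 2 <= gns_sqn x * gns_sqn y.
Proof.
have h t : 0 <= t ^+ 2 * gns_sqn x + 2 * (t * gns_re x y) + gns_sqn y.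
  have := gns_sqn_ge0 (rc t *: x + y).
  by rewrite gns_sqnD gns_reZ gns_sqnZ re_rc im_rc expr0n addr0.
have [x0|x0] := eqVneq (gns_sqn x) 0.
  by rewrite (gns_sqn_eq0 x0) gns_re0 expr0n mulr_ge0 // gns_sqn_ge0.
have xp : 0 < gns_sqn x by rewrite lt_neqAle eq_sym x0 gns_sqn_ge0.
have := h (- (gns_re x y / gns_sqn x)).
set r := gns_re x y; set p := gns_sqn x; set q := gns_sqn y => hh.
have : 0 <= p * ((- (r / p)) ^+ 2 * p + 2 * (- (r / p) * r) + q).
  by rewrite mulr_ge0 // ltW.
suff -> : p * ((- (r / p)) ^+ 2 * p + 2 * (- (r / p) * r) + q) = p * q - r ^+ 2.
  by rewrite subr_ge0.
by field.
Qed.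

Definition gns_norm x : C := rc (Num.sqrt (gns_sqn x)).

Lemma gns_normD x y : gns_norm (x + y) <= gns_norm x + gns_norm y.
Proof.
rewrite -rcD ler_rc -(ler_pXn2r (n:=2)) ?nnegrE ?addr_ge0 ?sqrtr_ge0 //.
rewrite sqrrD !sqr_sqrtr ?gns_sqn_ge0 // gns_sqnD lerD2r lerD2l.
rewrite -[leRHS]mulr_natl ler_wpM2l //.
rewrite -sqrtrM ?gns_sqn_ge0 //; apply: le_trans (ler_norm _) _.
by rewrite -sqrtr_sqr ler_wsqrtr // gns_cauchy_schwarz.
Qed.

Lemma gns_normZ a x : gns_norm (a *: x) = `|a| * gns_norm x.
Proof.
rewrite /gns_norm gns_sqnZ sqrtrM ?addr_ge0 ?sqr_ge0 // rcM; congr (_ * _).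
by rewrite [RHS](normc_def (a : R[i])).
Qed.

Lemma gns_norm_eq0 x : gns_norm x = 0 -> x = 0.
Proof.
move=> /(congr1 (@re R)) /eqP; rewrite re_rc sqrtr_eq0 => x0.
by apply: gns_sqn_eq0; apply/le_anti; rewrite x0 gns_sqn_ge0.
Qed.

HB.instance Definition _ :=
  Lmodule_isNormed.Build C gns gns_normD gns_normZ gns_norm_eq0.

End Gns.

Section GnsComplete.
Variables (R : realType) (V : lmodType (complexC R)) (Q : psd_form V).
Local Notation C := (complexC R).
Local Notation gns := (gns Q).
Implicit Types (u v w : V) (x y z : gns) (a : C) (t : R).

Lemma gns_normE x : `|x| = rc (Num.sqrt (gns_sqn x)). Proof. by []. Qed.

Lemma gns_sqr_normE x : `|x| ^+ 2 = gns_dot Q x x.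
Proof.
by rewrite gns_normE [RHS]gns_inner_sqn expr2 -rcM -expr2 sqr_sqrtr ?gns_sqn_ge0.
Qed.

Lemma gns_sqn_norm x (e : R) : 0 <= e -> (`|x| <= rc e) = (gns_sqn x <= e ^+ 2).
Proof.
move=> e0; rewrite gns_normE ler_rc -(ler_pXn2r (n:=2)) ?nnegrE ?sqrtr_ge0 //.
by rewrite sqr_sqrtr ?gns_sqn_ge0.
Qed.

Lemma iota_subproof v : (fun w => Q v w) \in gns_pred Q.
Proof.
apply/asboolP; split; first by move=> a u w; rewrite psdDr psdZr.
exists (re (Q v v)) => w; exact: gap_form_le.
Qed.

Definition iota v : gns := GnsMk (iota_subproof v).

Lemma iotaE v w : iota v w = Q v w. Proof. by []. Qed.

Lemma iota_linear : linear iota.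
Proof. by move=> a u v; apply: gns_ext => w; rewrite /= psdD psdZ. Qed.

Lemma gns_re_iota x v : gns_re x (iota v) = re (x v).
Proof.
have := gns_sqnD x (iota v); rewrite (gns_sqnD_form x (iotaE v)).
by rewrite (gns_sqn_form (iotaE v)); lra.
Qed.

Lemma gns_inner_iota x v : gns_inner x (iota v) = x v.
Proof.
have e : 'i *: iota v = iota ('i *: v).
  by apply: gns_ext => w; rewrite gnsZ /= psdZ.
rewrite /gns_inner e !gns_re_iota (antilinearZ _ _ (gns_antilinear x)).
by rewrite conjCi mulNr reN re_iM opprK -complex_parts.
Qed.

Lemma gns_re_inner x y : re (gns_inner x y) = gns_re x y.
Proof. by rewrite /gns_inner reD re_rc re_iM im_rc oppr0 addr0. Qed.

Lemma gns_inner_le x y :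
  re (`|gns_inner x y| ^+ 2) <= gns_sqn x * gns_sqn y.
Proof.
set a := gns_inner x y; have := gns_cauchy_schwarz x (a *: y).
rewrite -gns_re_inner.
have -> : gns_inner x (a *: y) = `|a| ^+ 2.
  by rewrite gns_inner_conj -[a *: y]addr0 gns_inner_linear -/(gns_dot Q 0 x)
     linear0l addr0 rmorphM /= -gns_inner_conj normCK mulrC.
rewrite gns_sqnZ -sqr_norm; set r := re _ => h.
have r0 : 0 <= r by apply: re_ge0; rewrite exprn_ge0.
have := gns_sqn_ge0 x; have := gns_sqn_ge0 y => y0 x0.
move: r0; rewrite le_eqVlt => /orP[/eqP <-|r0]; first exact: mulr_ge0.
by rewrite -(ler_pM2l r0) mulrCA -expr2.
Qed.

Lemma gns_eval_le x v : `|x v| <= `|x| * `|iota v|.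
Proof.
rewrite -gns_inner_iota -(ler_pXn2r (n:=2)) ?nnegrE ?mulr_ge0 //.
rewrite exprMn !gns_sqr_normE [gns_dot Q x x]gns_inner_sqn [gns_dot Q _ _]gns_inner_sqn.
rewrite -rcM -[leLHS]rc_re ?exprn_ge0 // ler_rc; exact: gns_inner_le.
Qed.

(** Evaluations are Lipschitz, so a Cauchy filter converges pointwise; bounds on
[gap] pass to pointwise limits, hence so do bounds on the norm. *)
Lemma gns_complete (F : set_system gns) : ProperFilter F -> cauchy F -> cvg F.
Proof.
move=> FF Fc.
have /choice[l Fl] v : exists l : C, (x : gns) v @[x --> F] --> l.
  apply/cvg_ex; apply: complexC_complete; apply: cauchy_exP => e e0.
  have n0 : 0 < `|iota v| + 1 by rewrite ltr_wpDl.
  have [x Fx] := (cauchyP F).1 Fc _ (divr_gt0 e0 n0); exists (x v).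
  apply: (@filterS _ F _ _ _ _ Fx) => y; rewrite -!ball_normE /ball_ /= => xy.
  rewrite -gnsN -gnsD; apply: le_lt_trans (gns_eval_le _ _) _.
  apply: (@le_lt_trans _ _ (`|x - y| * (`|iota v| + 1))).
    by rewrite ler_wpM2l // lerDl.
  by rewrite -ltr_pdivlMr.
have lanti : antilinear l.
  move=> a u v; apply: (@cvg_unique _ (@norm_hausdorff _ _) _ _ _ _ (Fl _)).
  have -> : (fun x : gns => x (a *: u + v)) = (fun x : gns => a^* * x u + x v).
    by apply/funext => x; exact: gns_antilinear.
  by apply: cvgD => //; apply: cvgM => //; exact: cvg_cst.
have gapl x0 v B : F [set x | gap Q (x - x0 : gns) v <= B] ->
    gap Q (fun v => l v - x0 v) v <= B.
  move=> FB; apply/ler_addgt0Pr => e e0.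
  have e20 : 0 < rc (e / 2) by rewrite -rc0 ltr_rc divr_gt0.
  have Fv : F [set x : gns | `|l v - x v| < rc (e / 2)].
    by move: (Fl v) => /cvgrPdist_lt; apply.
  have [x [/= xB xl]] := filter_ex (filterI FB Fv).
  have : re (l v - x v) <= e / 2.
    by apply: le_trans (re_le_norm _) _; rewrite -ler_rc rc_re // ltW.
  have : gap Q (x - x0 : gns) v <= B := xB.
  by rewrite /gap gnsD gnsN !reB; lra.
have ball_gap x0 e v : 0 < e -> F (ball x0 (rc e)) ->
    F [set x | gap Q (x - x0 : gns) v <= e ^+ 2].
  move=> e0; apply: filterS => y; rewrite -ball_normE /ball_ /= => xy.
  change (is_true (gap Q (y - x0 : gns) v <= e ^+ 2)).
  apply: le_trans (gap_le _ _) _; rewrite -gns_sqn_norm ?(ltW e0) //.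
  by rewrite distrC ltW.
have lin : l \in gns_pred Q.
  have r1 : 0 < rc (1 : R) by rewrite rc1.
  have [x0 Fx0] := (cauchyP F).1 Fc _ r1.
  have -> : l = (fun v => l v - x0 v) + gns_val x0.
    by apply/funext => v; rewrite fctE /= subrK.
  apply: rpredD; last by case: (x0).
  apply/asboolP; split.
    move=> a u v; rewrite lanti (gns_antilinear x0); ring.
  exists (1 ^+ 2) => v; apply: gapl; exact: ball_gap.
apply/cvg_ex; exists (GnsMk lin); apply/cvgrPdist_lt => /= e e0.
have re0 : 0 < re e / 2.
  by rewrite divr_gt0 // -ltr_rc rc_re // ltW.
have rce : e = rc (re e / 2) + rc (re e / 2).
  by rewrite -rcD -splitr rc_re // ltW.
have r2 : 0 < rc (re e / 2) by rewrite -rc0 ltr_rc.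
have [x0 Fx0] := (cauchyP F).1 Fc _ r2.
apply: filterS (Fx0) => x; rewrite -ball_normE /ball_ /= => xx0.
rewrite -(subrK x0 (GnsMk lin)) -addrA rce; apply: le_lt_trans (ler_normD _ _) _.
rewrite ler_ltD // gns_sqn_norm ?(ltW re0) //.
apply: gns_sqn_le => v; exact: gapl (ball_gap _ _ _ re0 Fx0).
Qed.

HB.instance Definition _ := Uniform_isComplete.Build gns gns_complete.

HB.instance Definition _ :=
  CompleteNormedModule_isHilbert.Build R gns gns_sqr_normE.

Lemma inner_iota x v : inner x (iota v) = x v.
Proof. exact: gns_inner_iota. Qed.

(** If [v] nearly attains the supremum defining the norm of [x], then
[x - iota v] is small, because translating by [v] subtracts [gap x v]. *)
Lemma iota_dense x (e : R) : 0 < e -> exists v, gns_sqn (x - iota v) <= e.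
Proof.
move=> e0.
have [_ [v _ <-] hv] : exists2 b, range (gap Q x) b & gns_sqn x - e < b.
  by apply: sup_adherent => //; split; [exists (gap Q x 0); exists 0|
    exists (gns_sqn x) => _ [v _ <-]; exact: gap_le].
exists v; apply: gns_sqn_le => w.
have := gap_le x (w + v).
have -> : gap Q x (w + v) = gap Q (x - iota v : gns) w + gap Q x v.
  rewrite /gap psdDD (antilinearD _ _ (gns_antilinear x)) gnsD gnsN iotaE.
  rewrite !reD reN [Q w v]psd_conj re_conj; lra.
by lra.
Qed.

End GnsComplete.

(** The operator induced on the completion by the operator of [V] whose adjoint
is [B]; that [B] is bounded for [Q] is left to the lemmas. *)
HB.lock Definition gns_op (R : realType) (V : lmodType (complexC R)) (Q : psd_form V)
  (B : V -> V) (x : gns Q) : gns Q := insubd 0 (fun w => x (B w)).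

Section GnsOperators.
Variables (R : realType) (V : lmodType (complexC R)) (Q : psd_form V).
Local Notation C := (complexC R).
Local Notation gns := (gns Q).
Implicit Types (u v w : V) (x y z : gns) (a : C) (t c : R) (A B : V -> V).

Local Notation gns_op := (@gns_op R V Q).

Definition form_bounded B := linear B /\
  exists2 c, 0 < c & forall v, re (Q (B v) (B v)) <= c * re (Q v v).

Lemma gap_comp_le B c x v : 0 < c ->
  (forall v, re (Q (B v) (B v)) <= c * re (Q v v)) ->
  gap Q (fun w => x (B w)) v <= c * gns_sqn x.
Proof.
move=> c0 hB; rewrite /gap.
have := gap_le (rc c *: x) (B v); rewrite gns_sqnZ /gap gnsZ re_rcM re_rc im_rc.
have -> : (c ^+ 2 + 0 ^+ 2) * gns_sqn x = c * (c * gns_sqn x) by ring.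
have := hB v => h1 h2; rewrite -(ler_pM2l c0) mulrBr mulrCA.
by apply: le_trans h2; rewrite lerD2l lerN2.
Qed.

Lemma gns_opE B x w : form_bounded B -> gns_op B x w = x (B w).
Proof.
move=> [lB [c c0 hB]]; rewrite gns_op.unlock /insubd insubT //=.
apply/asboolP; split=> [a u v|]; first by rewrite lB gns_antilinear.
exists (c * gns_sqn x) => v; exact: gap_comp_le.
Qed.

Lemma gns_op_sqn B : form_bounded B ->
  exists2 c, 0 < c & forall x, gns_sqn (gns_op B x) <= c * gns_sqn x.
Proof.
move=> fB; have [lB [c c0 hB]] := fB; exists c => // x.
apply: gns_sqn_le => v; rewrite /gap gns_opE //; exact: gap_comp_le.
Qed.

Lemma gns_op_linear B : form_bounded B -> linear (gns_op B).
Proof.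
by move=> fB a x y; apply: gns_ext => w; rewrite gnsD gnsZ !gns_opE.
Qed.

Lemma gns_op_bounded B : form_bounded B -> bounded_operator (gns_op B : gns -> gns).
Proof.
move=> fB; split; first exact: gns_op_linear.
have [c c0 hc] := gns_op_sqn fB.
pose f : {linear gns -> gns} := HB.pack (gns_op B)
  (GRing.isLinear.Build _ _ _ _ _ (gns_op_linear fB)).
apply: (@bounded_linear_continuous _ _ _ f); apply/linear_boundedP.
near=> r => x.
apply: (@le_trans _ _ (rc (Num.sqrt c) * `|x|)).
  rewrite /= !gns_normE -rcM ler_rc -sqrtrM ?(ltW c0) //.
  by rewrite ler_wsqrtr.
rewrite ler_wpM2r //; near: r; apply: nbhs_pinfty_ge.
by rewrite realE -rc0 ler_rc sqrtr_ge0.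
Unshelve. all: by end_near. Qed.

Lemma gns_op_iota A B v : form_bounded B ->
  (forall u w, Q (A u) w = Q u (B w)) -> gns_op B (iota Q v) = iota Q (A v).
Proof. by move=> fB AB; apply: gns_ext => w; rewrite gns_opE //= AB. Qed.

(** Both sides agree when [y] comes from [V], by definition of the operators, and
both are continuous in [y]. *)
Lemma gns_op_adjoint A B : form_bounded A -> form_bounded B ->
  (forall u w, Q (A u) w = Q u (B w)) ->
  forall x y, inner (gns_op B x) y = inner x (gns_op A y).
Proof.
move=> fA fB AB x y; apply/eqP; rewrite -subr_eq0 -normr_eq0 -sqrf_eq0; apply/eqP.
have BA u w : Q (B u) w = Q u (A w) by rewrite psd_conj -AB -psd_conj.
have [ca ca0 hca] := gns_op_sqn fA; have [cb cb0 hcb] := gns_op_sqn fB.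
set d := inner _ _ - _; have d0 : 0 <= re (`|d| ^+ 2) by rewrite re_ge0 ?exprn_ge0.
rewrite -[LHS]rc_re ?exprn_ge0 // -rc0; congr rc; apply/le_anti; rewrite d0 andbT.
apply: (@le0_small _ _ (2 * (cb * gns_sqn x) + 2 * (gns_sqn x * ca))) => s s0.
have [v hv] := iota_dense y s0.
have -> : d = gns_inner (gns_op B x) (y - iota Q v) -
    gns_inner x (gns_op A (y - iota Q v)).
  rewrite /d -[inner (gns_op B x) y]/(gns_inner (gns_op B x) y).
  rewrite -[inner x _]/(gns_inner x (gns_op A y)).
  have e1 : gns_inner (gns_op B x) (iota Q v) = gns_inner x (gns_op A (iota Q v)).
    by rewrite (gns_op_iota v fA BA) !gns_inner_iota gns_opE.
  have e2 (u1 u2 u3 : gns) : gns_inner u1 (u2 - u3) = gns_inner u1 u2 - gns_inner u1 u3 :> C.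
    exact: (linearBr (gns_dot Q)).
  have e3 (u1 u2 : gns) : gns_op A (u1 - u2) = gns_op A u1 - gns_op A u2.
    by apply: gns_ext => w; rewrite gnsD gnsN !gns_opE.
  by rewrite e3 !e2 e1; ring.
set p := gns_inner _ _; set q := gns_inner _ _.
have hp : re (`|p| ^+ 2) <= s * (cb * gns_sqn x).
  apply: le_trans (gns_inner_le _ _) _; rewrite mulrC.
  by rewrite ler_pM ?gns_sqn_ge0.
have hq : re (`|q| ^+ 2) <= s * (gns_sqn x * ca).
  apply: le_trans (gns_inner_le _ _) _; rewrite mulrCA ler_wpM2l ?gns_sqn_ge0 //.
  apply: le_trans (hca _) _; rewrite mulrC.
  by rewrite ler_wpM2r // ltW.
apply: le_trans (sqr_normB_le _ _) _.
rewrite [leRHS]mulrDr; apply: lerD; rewrite [leRHS]mulrCA; exact: ler_wpM2l.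
Qed.

End GnsOperators.

(** * Bounded matrix-valued functions and positive functionals on them *)

Section ConjugateTranspose.
Variable R : realType.
Local Notation C := (complexC R).

Definition ctr m k (A : 'M[C]_(m, k)) : 'M[C]_(k, m) := map_mx (@Num.conj C) A^T.

Lemma ctrE m k (A : 'M[C]_(m, k)) i j : ctr A i j = (A j i)^*.
Proof. by rewrite !mxE. Qed.
Lemma ctrK m k (A : 'M[C]_(m, k)) : ctr (ctr A) = A.
Proof. by apply/matrixP => i j; rewrite !ctrE conjCK. Qed.
Lemma ctrM m k l (A : 'M[C]_(m, k)) (B : 'M[C]_(k, l)) : ctr (A *m B) = ctr B *m ctr A.
Proof. by rewrite /ctr trmx_mul map_mxM. Qed.
Lemma ctrD m k (A B : 'M[C]_(m, k)) : ctr (A + B) = ctr A + ctr B.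
Proof. by apply/matrixP => i j; rewrite !mxE rmorphD. Qed.
Lemma ctrN m k (A : 'M[C]_(m, k)) : ctr (- A) = - ctr A.
Proof. by apply/matrixP => i j; rewrite !mxE rmorphN. Qed.
Lemma ctrZ m k a (A : 'M[C]_(m, k)) : ctr (a *: A) = a^* *: ctr A.
Proof. by apply/matrixP => i j; rewrite !mxE rmorphM. Qed.

Lemma ctr_sqr_ge0 k (A : 'M[C]_(k, 1)) : 0 <= re ((ctr A *m A) 0 0).
Proof.
apply: re_ge0; rewrite mxE sumr_ge0 // => i _; rewrite ctrE mulrC.
exact: mul_conjC_ge0.
Qed.

End ConjugateTranspose.

Section BoundedMatrixFunctions.
Variables (R : realType) (X : Type) (m k : nat).
Local Notation C := (complexC R).

(** All bounded functions are allowed, measurable or not: the functionals at stake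
only need an order unit. *)
Definition bmx_pred : {pred X -> 'M[C]_(m, k)} :=
  [pred f : X -> 'M[C]_(m, k) | `[< exists M : C, forall x i j, `|f x i j| <= M >]].

Lemma bmx_submod : submod_closed bmx_pred.
Proof.
split=> [|a f g].
  by apply/asboolP; exists 0 => x i j; rewrite mxE normr0.
move=> /asboolP[M fM] /asboolP[N gN]; apply/asboolP; exists (`|a| * M + N).
move=> x i j; rewrite !mxE; apply: le_trans (ler_normD _ _) _.
by rewrite lerD // normrM ler_wpM2l.
Qed.

HB.instance Definition _ := GRing.isSubmodClosed.Build C (X -> 'M[C]_(m, k))
  bmx_pred (GRing.submod_closed_semi bmx_submod).

Record bmx := BmxMk { bmx_val :> X -> 'M[C]_(m, k) ; _ : bmx_val \in bmx_pred }.
HB.instance Definition _ := [isSub for bmx_val].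
HB.instance Definition _ := [Choice of bmx by <:].
HB.instance Definition _ := [SubChoice_isSubLmodule of bmx by <:].

Implicit Types f g : bmx.

Lemma bmxP f : exists M : C, forall x i j, `|f x i j| <= M.
Proof. by case: f => f /= /asboolP. Qed.
Lemma bmxD f g x : (f + g) x = f x + g x. Proof. by []. Qed.
Lemma bmxN f x : (- f) x = - f x. Proof. by []. Qed.
Lemma bmxZ a f x : (a *: f) x = a *: f x. Proof. by []. Qed.
Lemma bmx_ext f g : (forall x, f x = g x) -> f = g.
Proof. by move=> h; apply/val_inj/funext. Qed.

(** Boundedness of [f] is left to the lemmas, so that [f] alone determines the term. *)
Definition to_bmx (f : X -> 'M[C]_(m, k)) : bmx := insubd 0 f.

Lemma to_bmxE (f : X -> 'M[C]_(m, k)) (M : C) :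
  (forall x i j, `|f x i j| <= M) -> to_bmx f = f :> (X -> _).
Proof. by move=> fM; rewrite insubdK //; apply/asboolP; exists M. Qed.

End BoundedMatrixFunctions.

HB.lock Definition mulb (R : realType) (X : Type) (k : nat) (f : X -> complexC R)
  (v : bmx R X 1 k) : bmx R X 1 k := to_bmx (fun x => f x *: v x).

Section FormOfFunctional.
Variables (R : realType) (X : Type) (k : nat).
Local Notation C := (complexC R).
Local Notation E := (bmx R X k k).
Local Notation V := (bmx R X 1 k).
Implicit Types (G H : E) (u v w : V).

(** The Hermitian part of [A] is positive semidefinite. *)
Definition posre (A : 'M[C]_k) :=
  forall c : 'rV[C]_k, 0 <= re ((c *m A *m ctr c) 0 0).

Definition cone : set E := [set G | forall x, posre (G x)].

Lemma to_bmx_mul m l n (f : X -> 'M[C]_(m, l)) (g : X -> 'M[C]_(l, n)) :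
  (exists M : C, forall x i j, `|f x i j| <= M) ->
  (exists M : C, forall x i j, `|g x i j| <= M) ->
  to_bmx (fun x => f x *m g x) = (fun x => f x *m g x) :> (X -> _).
Proof.
move=> [M fM] [N gN]; apply: (@to_bmxE _ _ _ _ _ (\sum_(p < l) M * N)).
move=> x i j; rewrite mxE; apply: le_trans (ler_norm_sum _ _ _) _.
by apply: ler_sum => p _; rewrite normrM ler_pM.
Qed.

(** A positive functional [L] turns the rank-one function [outer w v] into the form
[L (outer w v)] on row-valued functions; for [L] an integral against a positive
matrix of measures this is the inner product of the corresponding [L^2] space. *)
Definition outer w v : E := to_bmx (fun x => ctr (w x) *m v x).

Lemma outerE w v x : outer w v x = ctr (w x) *m v x.
Proof.
rewrite /outer to_bmx_mul //; last exact: bmxP.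
have [M wM] := bmxP w; exists M => y i j; rewrite ctrE norm_conjC; exact: wM.
Qed.

Lemma cone_outer v : cone (outer v v).
Proof.
move=> x c; rewrite outerE.
have -> : c *m (ctr (v x) *m v x) *m ctr c = ctr (v x *m ctr c) *m (v x *m ctr c).
  by rewrite ctrM ctrK !mulmxA.
exact: ctr_sqr_ge0.
Qed.

Variable L : E -> R.
Hypotheses (lL : real_linear L) (pL : forall G, cone G -> 0 <= L G).

(** The complex-linear functional with real part [L]. *)
Definition cplx_fun G : C := rc (L G) + 'i * rc (- L ('i *: G)).

Lemma cplx_fun_linear a G H : cplx_fun (a *: G + H) = a * cplx_fun G + cplx_fun H.
Proof.
have [LD LZ] := lL.
have La b G' : L (b *: G') = re b * L G' + im b * L ('i *: G').
  rewrite [in LHS](complex_parts b) scalerDl LD LZ ['i * _]mulrC -scalerA LZ.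
  by [].
rewrite /cplx_fun -complex_mul_parts !scalerDr !LD scalerA ['i * a]mulrC -scalerA.
rewrite (La a G) (La a ('i *: G)) scalerA -expr2 sqrCi scaleN1r.
rewrite (real_linearN G lL).
congr (rc _ + 'i * rc _); ring.
Qed.

(** The cone contains the functions with skew-Hermitian values together with their
opposites, so a functional positive on it vanishes on them. *)
Lemma cone_sym_eq G H : (forall x, H x = ctr (G x)) -> L H = L G.
Proof.
move=> HG; have [LD LZ] := lL.
have sym (A : 'M[C]_k) c : re ((c *m ctr A *m ctr c) 0 0) = re ((c *m A *m ctr c) 0 0).
  have -> : c *m ctr A *m ctr c = ctr (c *m A *m ctr c).
    by rewrite !ctrM ctrK mulmxA.
  by rewrite ctrE re_conj.
have c1 : cone (H - G).
  move=> x c; rewrite bmxD bmxN HG mulmxBr mulmxBl mxE [X in _ + X]mxE reB sym.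
  by rewrite subrr.
have c2 : cone (G - H).
  move=> x c; rewrite bmxD bmxN HG mulmxBr mulmxBl mxE [X in _ + X]mxE reB sym.
  by rewrite subrr.
have := pL c1; have := pL c2; rewrite !LD !(real_linearN _ lL); lra.
Qed.

Definition outer_form_fun v w : C := cplx_fun (outer w v).

Lemma outer_form_linear (a : C) u v w :
  outer_form_fun (a *: u + v) w = a * outer_form_fun u w + outer_form_fun v w.
Proof.
rewrite -cplx_fun_linear; congr cplx_fun; apply: bmx_ext => x.
by rewrite bmxD bmxZ !outerE bmxD bmxZ mulmxDr -scalemxAr.
Qed.

Lemma outer_form_conj u v : outer_form_fun u v = (outer_form_fun v u)^*.
Proof.
rewrite /outer_form_fun /cplx_fun complex_conj_parts opprK.
have -> : L (outer v u) = L (outer u v).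
  by apply: cone_sym_eq => x; rewrite !outerE ctrM ctrK.
have -> : L ('i *: outer v u) = L (- ('i *: outer u v)).
  apply: cone_sym_eq => x; rewrite bmxZ bmxN bmxZ !outerE ctrN ctrZ ctrM ctrK.
  by rewrite conjCi scaleNr opprK.
by rewrite real_linearN ?opprK.
Qed.

Lemma outer_form_ge0 v : 0 <= re (outer_form_fun v v).
Proof. by rewrite /outer_form_fun /cplx_fun reD re_rc re_iM oppr0 addr0 pL //; exact: cone_outer. Qed.

Definition outer_form : psd_form V :=
  PsdForm outer_form_linear outer_form_conj outer_form_ge0.

Lemma re_outer_form v w : re (outer_form v w) = L (outer w v).
Proof.
rewrite -[outer_form v w]/(cplx_fun (outer w v)) /cplx_fun.
by rewrite reD re_rc re_iM im_rc oppr0 addr0.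
Qed.

Definition bounded_fun (f : X -> C) := exists M : R, forall x, `|f x| <= rc M.

Local Notation mulb := (@mulb R X k).

Lemma mulbE f v x : bounded_fun f -> mulb f v x = f x *: v x.
Proof.
move=> [M fM]; have [N vN] := bmxP v; rewrite mulb.unlock.
rewrite (@to_bmxE _ _ _ _ _ (rc M * N)) // => y i j.
by rewrite mxE normrM ler_pM.
Qed.

Lemma mulb_linear f : bounded_fun f -> linear (mulb f).
Proof.
move=> bf a u v; apply: bmx_ext => x.
by rewrite bmxD bmxZ !mulbE // bmxD bmxZ scalerDr !scalerA mulrC.
Qed.

(** If [f] is bounded by [M], multiplying by the nonnegative function
[M ^ 2 - f * conj f] keeps [outer v v] in the cone. *)
Lemma mulb_form_bounded f : bounded_fun f -> form_bounded outer_form (mulb f).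
Proof.
move=> bf; split; first exact: mulb_linear.
have [M fM] := bf; exists (M ^+ 2 + 1); first by rewrite ltr_wpDl ?sqr_ge0.
move=> v; have [LD LZ] := lL.
rewrite !re_outer_form -LZ -subr_ge0.
have -> : L (rc (M ^+ 2 + 1) *: outer v v) - L (outer (mulb f v) (mulb f v)) =
   L (rc (M ^+ 2 + 1) *: outer v v - outer (mulb f v) (mulb f v)).
  by rewrite LD (real_linearN _ lL).
apply: pL => x c; rewrite bmxD bmxN bmxZ !outerE !mulbE // ctrZ.
rewrite -scalemxAl -scalemxAr scalerA [(f x)^* * _]mulrC -normCK.
rewrite -scalerBl -scalemxAr -scalemxAl mxE.
have h : 0 <= re ((c *m (ctr (v x) *m v x) *m ctr c) 0 0).
  by rewrite -outerE; exact: cone_outer.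
have -> : `|f x| ^+ 2 = rc (re (`|f x| ^+ 2)) by rewrite rc_re // exprn_ge0.
rewrite -rcN -rcD re_rcM mulr_ge0 // subr_ge0.
have f2 : re (`|f x| ^+ 2) <= M ^+ 2.
  rewrite -ler_rc rc_re ?exprn_ge0 //.
  have -> : rc (M ^+ 2) = rc M ^+ 2 by rewrite !expr2 rcM.
  by rewrite ler_pXn2r ?nnegrE //; apply: le_trans (fM x).
by rewrite (le_trans f2) // lerDl.
Qed.

Lemma bounded_fun_conj f : bounded_fun f -> bounded_fun (fun x => (f x)^*).
Proof. by move=> [M fM]; exists M => x; rewrite norm_conjC. Qed.

Lemma mulb_adjoint f u w : bounded_fun f ->
  outer_form (mulb f u) w = outer_form u (mulb (fun x => (f x)^*) w).
Proof.
move=> bf; rewrite /= /outer_form_fun; congr cplx_fun; apply: bmx_ext => x.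
rewrite !outerE !mulbE //; last exact: bounded_fun_conj.
by rewrite ctrZ conjCK -scalemxAr -scalemxAl.
Qed.

End FormOfFunctional.

(** * Exactness of the Koszul complex *)

Section KoszulHomotopy.
Variables (R : realType) (H : hilbertType R) (n : nat).
Local Notation C := (complexC R).
Implicit Types (I : {set 'I_n}) (i k : 'I_n).

Definition koszul_sign i I : C := (-1) ^+ #|[set j in I | (j < i)%N]%SET|.

Lemma koszul_sign_sqr i I : koszul_sign i I * koszul_sign i I = 1.
Proof. by rewrite /koszul_sign -expr2 -exprM mulnC exprM sqrrN expr1n expr1n. Qed.

Lemma koszul_signD1 i k I : i \in I ->
  koszul_sign k I = (-1) ^+ (i < k)%N * koszul_sign k (I :\ i)%SET.
Proof.
move=> iI; rewrite /koszul_sign -exprD; congr (_ ^+ _).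
rewrite (cardsD1 i) !inE iI /=; congr (_ + _)%N.
by apply: eq_card => j; rewrite !inE andbA.
Qed.

Lemma koszul_signU1 i k I : k \notin I ->
  koszul_sign i (k |: I)%SET = (-1) ^+ (k < i)%N * koszul_sign i I.
Proof.
by move=> kI; rewrite (@koszul_signD1 k) ?setU11 // setU1K.
Qed.

Lemma koszul_sign_anti i k I : i \in I -> k \notin I ->
  koszul_sign i I * koszul_sign k (I :\ i)%SET =
  - (koszul_sign k I * koszul_sign i (k |: I)%SET).
Proof.
move=> iI kI; rewrite koszul_signU1 // (@koszul_signD1 i k I) //.
have : i != k by apply: contraNneq kI => <-.
rewrite neq_ltn => /orP[] h; have := ltnW h; rewrite leqNgt => /negbTE h';
  rewrite h h' /= expr0 expr1; ring.
Qed.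

Variables (T B : 'I_n -> H -> H).
Hypotheses (lT : forall i, linear (T i)) (lB : forall i, linear (B i)).
Hypothesis TB : forall i k x, T i (B k x) = B k (T i x).
Hypothesis TB1 : forall x, \sum_i T i (B i x) = x.

(** If the commuting family [T] has a left inverse [B] commuting with it, then
contraction along [B] is a homotopy from the identity of the Koszul complex to
zero: the cross terms cancel by [koszul_sign_anti]. *)
Lemma koszul_exact_of_inverse : koszul_exact T.
Proof.
move=> w dw.
pose Tl i : {linear H -> H} := HB.pack (T i) (GRing.isLinear.Build _ _ _ _ _ (lT i)).
pose Bl i : {linear H -> H} := HB.pack (B i) (GRing.isLinear.Build _ _ _ _ _ (lB i)).
have Tsum i I (P : pred 'I_n) (F : 'I_n -> H) :
    T i (\sum_(k | P k) F k) = \sum_(k | P k) T i (F k).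
  exact: (raddf_sum (Tl i)).
have Bsum i I (P : pred 'I_n) (F : 'I_n -> H) :
    B i (\sum_(k | P k) F k) = \sum_(k | P k) B i (F k).
  exact: (raddf_sum (Bl i)).
have TZ i a x : T i (a *: x) = a *: T i x by exact: (linearZ_LR (Tl i)).
have BZ i a x : B i (a *: x) = a *: B i x by exact: (linearZ_LR (Bl i)).
exists (fun I => \sum_(k | k \notin I) koszul_sign k I *: B k (w (k |: I)%SET)) => I.
have eq0 : \sum_(k | k \notin I) koszul_sign k I *:
    B k (koszul_d T w (k |: I)%SET) = 0.
  apply: big1 => k _; rewrite dw.
  by have := BZ k 0 0; rewrite !scale0r => ->; rewrite scaler0.
have cross : \sum_(k | k \notin I) koszul_sign k I *: B k (koszul_d T w (k |: I)%SET) =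
    \sum_(k | k \notin I) T k (B k (w I)) -
    \sum_(i in I) \sum_(k | k \notin I)
      (koszul_sign i I * koszul_sign k (I :\ i)%SET) *:
        T i (B k (w (k |: (I :\ i))%SET)).
  rewrite exchange_big /= -sumrB; apply: eq_bigr => k kI.
  rewrite /koszul_d (bigD1 k) ?setU11 //= setU1K //.
  rewrite (eq_bigl (fun i => i \in I)); last first.
    move=> i; rewrite !inE; have [->|] //= := eqVneq i k.
      by rewrite (negbTE kI).
    by rewrite andbT.
  rewrite -[X in X *: T k _]/(koszul_sign k (k |: I)%SET).
  rewrite koszul_signU1 // ltnn expr0 mul1r.
  have BD x y : B k (x + y) = B k x + B k y by exact: (raddfD (Bl k)).
  rewrite BD scalerDr BZ scalerA koszul_sign_sqr scale1r TB; congr (_ + _).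
  rewrite Bsum // scaler_sumr -sumrN; apply: eq_bigr => i iI.
  rewrite -[X in X *: T i _]/(koszul_sign i (k |: I)%SET).
  rewrite BZ scalerA koszul_sign_anti // scaleNr opprK TB; congr (_ *: B k (T i (w _))).
  have ik : i != k by apply: contraNneq kI => <-.
  apply/setP => j; rewrite !inE; have [->|] := eqVneq j k; last by [].
  by rewrite (eq_sym k) ik.
have tot : \sum_(i in I) T i (B i (w I)) + \sum_(i | i \notin I) T i (B i (w I)) = w I.
  by rewrite -[RHS]TB1 [RHS](bigID (fun i => i \in I)).
rewrite /koszul_d -[RHS]tot.
have -> : \sum_(i | i \notin I) T i (B i (w I)) =
  \sum_(i in I) \sum_(k | k \notin I)
      (koszul_sign i I * koszul_sign k (I :\ i)%SET) *:
        T i (B k (w (k |: (I :\ i))%SET)).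
  by apply/eqP; rewrite -subr_eq0 -cross eq0.
rewrite -big_split /=; apply: eq_bigr => i iI.
rewrite Tsum // scaler_sumr (bigD1 i) ?setD11 //=.
rewrite TZ scalerA -[X in (X * _) *: _]/(koszul_sign i I).
rewrite (@koszul_signD1 i i) // ltnn expr0 mul1r koszul_sign_sqr scale1r.
rewrite finset.setD1K //; congr (_ + _).
rewrite (eq_bigl (fun k => k \notin I)); last first.
  move=> k; rewrite !inE; have [->|] //= := eqVneq k i; last by rewrite andbT.
  by rewrite iI.
apply: eq_bigr => k kI; rewrite TZ scalerA -/(koszul_sign i I).
by rewrite (@koszul_signD1 i i) // ltnn expr0 mul1r.
Qed.

End KoszulHomotopy.

(** * Points outside the distinguished boundary *)

Section Vieta.
Variables (R : realType) (n : nat).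
Local Notation C := (complexC R).
Implicit Types (z l : 'rV[C]_n) (a : C).

(** The monic polynomial whose elementary symmetric functions of the roots are the
entries of [l]. *)
Definition vieta_poly l : {poly C} :=
  'X^n + \sum_(i < n) ((-1) ^+ i.+1 * l 0 i) *: 'X^(n - i.+1).

Lemma prod_vieta z :
  \prod_(j < n) ('X - (z 0 j)%:P) = vieta_poly (symmetrization z).
Proof.
under eq_bigr do rewrite addrC.
rewrite bigA_distr /=.
have term (J : {set 'I_n}) :
    \prod_(i < n) (if i \in J then - (z 0 i)%:P else 'X) =
    ((-1) ^+ #|J| * \prod_(i in J) z 0 i) *: 'X^(n - #|J|).
  rewrite (bigID (fun i => i \in J)) /=.
  rewrite (eq_bigr (fun i => (- z 0 i)%:P)) => [|i ->]; last by rewrite polyCN.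
  rewrite [X in _ * X](eq_bigr (fun=> 'X)) => [|i /negbTE->] //.
  rewrite prodr_const -rmorph_prod mul_polyC prodrN /=; congr (_ *: 'X^_).
  have h := cardC (mem J); rewrite card_ord in h.
  have -> : #|[pred i | i \notin J]| = #|predC (mem J)| by apply: eq_card => i; rewrite !inE.
  exact: (canRL (addKn _) h).
under eq_bigr do rewrite term.
pose f (J : {set 'I_n}) : 'I_n.+1 := inord #|J|.
have cJ (J : {set 'I_n}) : (#|J| < n.+1)%N.
  by rewrite ltnS -[X in (_ <= X)%N]card_ord max_card.
rewrite (partition_big f xpredT) //= big_ord_recl; congr (_ + _).
  rewrite (big_pred1 finset.set0) => [|J].
    by rewrite cards0 big_set0 expr0 mulr1 scale1r subn0.
  by rewrite /f -val_eqE /= inordK // cards_eq0.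
apply: eq_bigr => i _; rewrite !mxE mulr_sumr scaler_suml.
apply: eq_big => [J|J]; rewrite /f -val_eqE /= inordK // => /eqP ->.
by rewrite /bump leq0n add1n.
Qed.

Lemma coef_vieta l (i : 'I_n) : (vieta_poly l)`_(n - i.+1) = (-1) ^+ i.+1 * l 0 i.
Proof.
rewrite coefD coefXn coef_sum (bigD1 i) //= coefZ coefXn eqxx mulr1.
rewrite big1 => [|j ji]; last first.
  rewrite coefZ coefXn; case: eqVneq => [h|_]; last by rewrite mulr0.
  case/eqP: ji; apply/val_inj => /=; have := ltn_ord i; have := ltn_ord j; lia.
rewrite addr0; case: eqVneq => [h|_]; last by rewrite add0r.
have := ltn_ord i; lia.
Qed.

Lemma vieta_inj l l' : vieta_poly l = vieta_poly l' -> l = l'.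
Proof.
move=> e; apply/rowP => i; have := coef_vieta l i; rewrite e coef_vieta.
by move/(congr1 (fun c => (-1) ^+ i.+1 * c)); rewrite !mulrA -!expr2 -!exprM mulnC !exprM sqrrN !expr1n !mul1r.
Qed.

Lemma size_vieta l : size (vieta_poly l) = n.+1.
Proof.
rewrite size_polyDl ?size_polyXn // ltnS.
apply: leq_trans (size_sum _ _ _) _; apply/bigmax_leqP => i _.
apply: leq_trans (size_scale_leq _ _) _; rewrite size_polyXn.
have := ltn_ord i; lia.
Qed.

Lemma vieta_split l : exists z, l = symmetrization z /\ forall j, root (vieta_poly l) (z 0 j).
Proof.
have [r Dr] := closed_field_poly_normal (vieta_poly l).
have lc1 : lead_coef (vieta_poly l) = 1.
  rewrite lead_coefE size_vieta /= coefD coefXn eqxx coef_sum big1 ?addr0 // => i _.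
  rewrite coefZ coefXn; case: eqVneq => [h|_]; last by rewrite mulr0.
  have := ltn_ord i; lia.
rewrite lc1 scale1r in Dr.
have sr : size r = n.
  by have := size_vieta l; rewrite Dr size_prod_XsubC => -[].
pose z : 'rV[C]_n := \row_j r`_j.
have Dz : vieta_poly l = \prod_(j < n) ('X - (z 0 j)%:P).
  rewrite Dr (big_nth 0) sr big_mkord; apply: eq_bigr => j _; by rewrite mxE.
exists z; split; first by apply: vieta_inj; rewrite -prod_vieta.
move=> j; rewrite Dz -(big_map (fun j : 'I_n => z 0 j) xpredT (fun a => 'X - a%:P)).
rewrite root_prod_XsubC; apply: map_f; exact: mem_index_enum.
Qed.

(** If [l] is not in the distinguished boundary, its polynomial has a root [a] with
[`|a| != 1]. Evaluated at [a], the difference of the polynomials of a torus point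
[z] and of [l] is [\prod_j (a - z j)], which stays away from 0 on the torus; it is
a linear combination of the [s_i z - l_i]. *)
Lemma outside_bGamma l : ~ @bGamma R n l ->
  exists c : 'I_n -> C, exists2 d : R, 0 < d &
    forall z, (forall i, `|z 0 i| = 1) ->
      rc d <= `|\sum_i c i * (symmetrization z 0 i - l 0 i)|.
Proof.
move=> nl; have [w [lw rw]] := vieta_split l.
have [j wj] : exists j, `|w 0 j| != 1.
  apply: contrapT => h; apply: nl; exists w => //= i.
  by apply: contrapT => /eqP wi; apply: h; exists i.
set a := w 0 j in wj; exists (fun i : 'I_n => (-1) ^+ i.+1 * a ^+ (n - i.+1)).
have na : 0 < `| `|a| - 1 | by rewrite normr_gt0 subr_eq0.
exists (re (`| `|a| - 1 | ^+ n)).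
  by rewrite -ltr_rc rc_re ?exprn_ge0 // exprn_gt0.
move=> z z1; rewrite rc_re ?exprn_ge0 //.
have -> : \sum_(i < n) (-1) ^+ i.+1 * a ^+ (n - i.+1) * (symmetrization z 0 i - l 0 i) =
    (vieta_poly (symmetrization z)).[a] - (vieta_poly l).[a].
  rewrite !hornerE !horner_sum opprD addrACA subrr add0r -sumrB.
  by apply: eq_bigr => i _; rewrite !hornerE; ring.
have /rootP -> := rw j; rewrite subr0 -prod_vieta horner_prod normr_prod.
have -> : `| `|a| - 1 | ^+ n = \prod_(i < n) `| `|a| - 1 | :> C.
  by rewrite prodr_const card_ord.
apply: ler_prod => i _; rewrite normr_ge0 /= hornerXsubC -(z1 i).
exact: ler_dist_dist.
Qed.

End Vieta.

(** * The maximum principle for polynomials *)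

Section MaximumPrinciple.
Variables (R : realType).
Local Notation C := (complexC R).

Lemma prim_root_exists N : (0 < N)%N -> exists z : C, N.-primitive_root z.
Proof.
move=> N0; pose p : {poly C} := 'X^N - 1.
have [r Dp] := closed_field_poly_normal p.
have sz_p : size p = N.+1 by rewrite size_XnsubC.
rewrite (monicP (monicXnsubC _ N0)) scale1r in Dp.
have sz_r : size r = N by have := sz_p; rewrite Dp size_prod_XsubC => -[].
have Ur : uniq r.
  by rewrite -separable_prod_XsubC -Dp; apply: separable_Xn_sub_1; rewrite pnatr_eq0 -lt0n.
have hr : all N.-unity_root r by apply/allP => z; rewrite -root_prod_XsubC -Dp.
have /hasP[z _ hz] : has N.-primitive_root r.
  by apply: has_prim_root => //; rewrite sz_r.
by exists z.
Qed.

Lemma coef_average (N : nat) (z : C) (u : {poly C}) k :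
  N.-primitive_root z -> (size u <= N)%N -> (k < N)%N ->
  N%:R * u`_k = \sum_(i < N) (z ^+ i) ^- k * u.[z ^+ i].
Proof.
move=> pz su kN; have N0 := prim_order_gt0 pz.
have z0 : z != 0.
  apply/eqP => z0; have /eqP := prim_expr_order pz.
  by rewrite z0 expr0n (gtn_eqF N0) eq_sym oner_eq0.
under eq_bigr => i _ do rewrite (horner_coef_wide _ su) mulr_sumr.
rewrite exchange_big /= (bigD1 (Ordinal kN)) //= [X in _ + X]big1 => [|j jk]; last first.
  pose w := z ^+ j * z ^- k.
  rewrite (eq_bigr (fun i : 'I_N => u`_j * w ^+ i)) => [|i _]; last first.
    rewrite /= mulrCA; congr (_ * _).
    by rewrite /w exprMn exprVn -!exprM mulrC (mulnC i j) (mulnC i k).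
  rewrite -mulr_sumr; have wN : w ^+ N = 1.
    by rewrite /w exprMn exprVn -!exprM mulnC [(k * _)%N]mulnC !exprM (prim_expr_order pz) !expr1n invr1 mulr1.
  have w1 : w != 1.
    apply/eqP => /(congr1 (fun c => c * z ^+ k)); rewrite /w mul1r mulfVK ?expf_neq0 //.
    move/eqP; rewrite (eq_prim_root_expr pz) !modn_small // => /eqP h.
    by case/eqP: jk; apply/val_inj.
  have := subrX1 w N; rewrite wN subrr => /esym/eqP.
  rewrite mulf_eq0 subr_eq0 (negbTE w1) /= => /eqP ->.
  by rewrite mulr0.
rewrite addr0 (eq_bigr (fun=> u`_k)) => [|i _]; last first.
  by rewrite /= mulrCA mulVf ?mulr1 // !expf_neq0.
by rewrite sumr_const card_ord mulr_natl.
Qed.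

(** Cauchy's estimate, with the average over roots of unity of large order in place
of an integral. *)
Lemma coef_bound (u : {poly C}) (M : C) k :
  (forall z, `|z| = 1 -> `|u.[z]| <= M) -> `|u`_k| <= M.
Proof.
move=> uM; set N := maxn (size u) k.+1.
have N0 : (0 < N)%N by rewrite leq_max orbT.
have [z pz] := prim_root_exists N0.
have z1 : `|z| = 1.
  by apply/eqP; rewrite -(@pexpr_eq1 _ _ N) // -normrX (prim_expr_order pz) normr1.
have Nr : 0 < N%:R :> C by rewrite ltr0n.
rewrite -(ler_pM2l Nr) -[N%:R in leLHS]ger0_norm ?ler0n // -normrM.
rewrite (coef_average pz) ?leq_maxl ?leq_maxr //.
apply: le_trans (ler_norm_sum _ _ _) _.
have -> : N%:R * M = \sum_(i < N) M by rewrite sumr_const card_ord mulr_natl.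
apply: ler_sum => i _; rewrite normrM normfV !normrX z1 !expr1n invr1 mul1r.
by apply: uM; rewrite normrX z1 expr1n.
Qed.

Lemma crude_max (u : {poly C}) (M : C) w :
  (forall z, `|z| = 1 -> `|u.[z]| <= M) -> `|w| <= 1 ->
  `|u.[w]| <= (size u)%:R * M.
Proof.
move=> uM w1; rewrite horner_coef; apply: le_trans (ler_norm_sum _ _ _) _.
have -> : (size u)%:R * M = \sum_(i < size u) M by rewrite sumr_const card_ord mulr_natl.
apply: ler_sum => i _; rewrite normrM -[leRHS]mulr1 ler_pM ?coef_bound //.
by rewrite normrX exprn_ile1.
Qed.

Lemma le1_of_power_growth (a : R) d : 0 <= a ->
  (forall N : nat, a ^+ N <= (N * d + 1)%:R) -> a <= 1.
Proof.
move=> a0 h; rewrite leNgt; apply/negP => a1.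
pose b := Num.sqrt a; have b1 : 1 < b by rewrite -sqrtr1 ltr_sqrt // (lt_trans ltr01).
have ab : a = b ^+ 2 by rewrite sqr_sqrtr.
pose e := b - 1; have e0 : 0 < e by rewrite subr_gt0.
have bern N : 1 + N%:R * e <= b ^+ N.
  elim: N => [|N IHN]; first by rewrite mul0r addr0 expr0.
  rewrite exprS; apply: (@le_trans _ _ (b * (1 + N%:R * e))); last first.
    by rewrite ler_wpM2l // ltW // (lt_trans ltr01).
  rewrite -natr1; have : 0 <= N%:R * e * e by rewrite !mulr_ge0 // ltW.
  have -> : b = 1 + e by rewrite /e; ring.
  lra.
have [N hN] : exists N : nat, (d%:R + 1) / e ^+ 2 < N%:R.
  exists (Num.bound ((d%:R + 1) / e ^+ 2)).
  by apply: archi_boundP; rewrite divr_ge0 ?sqr_ge0 // addr_ge0.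
have e20 : 0 < e ^+ 2 by rewrite exprn_gt0.
rewrite ltr_pdivrMr // in hN.
have := h N; rewrite ab -exprM mulnC exprM natrD natrM.
have := bern N; have Ne : 0 <= N%:R * e by rewrite mulr_ge0 // ltW.
move=> h1 h2.
have h3 : (1 + N%:R * e) ^+ 2 <= b ^+ N ^+ 2.
  by rewrite ler_pXn2r // nnegrE ?addr_ge0 ?exprn_ge0 // (le_trans ler01) // ltW.
have N0 : 0 < N%:R :> R.
  rewrite ltr0n lt0n; apply: contraTneq hN => ->; rewrite mul0r -leNgt.
  by rewrite addr_ge0.
have h4 : N%:R * (d%:R + 1) < N%:R * (N%:R * e ^+ 2) by rewrite ltr_pM2l.
nra.
Qed.

(** The crude bound by [size u * M] applied to all powers of [u]: its size grows
linearly with the exponent, so the factor disappears after taking roots. *)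
Lemma max_principle (u : {poly C}) (M : R) w : 0 <= M ->
  (forall z, `|z| = 1 -> `|u.[z]| <= rc M) -> `|w| <= 1 -> `|u.[w]| <= rc M.
Proof.
rewrite le_eqVlt => /orP[/eqP <-|M0] uM w1.
  by have := crude_max uM w1; rewrite mulr0.
have Mc : 0 < rc M by rewrite -rc0 ltr_rc.
rewrite -(mul1r (rc M)) -ler_pdivrMr // -[_ / _]rc_re ?divr_ge0 ?(ltW Mc) // -rc1 ler_rc.
apply: (@le1_of_power_growth _ (size u)) => [|N].
  by rewrite re_ge0 // divr_ge0 // ltW.
have uN z : `|z| = 1 -> `|(u ^+ N).[z]| <= rc M ^+ N.
  by move=> z1; rewrite horner_exp normrX lerXn2r ?nnegrE ?uM // ltW.
have := crude_max uN w1; rewrite horner_exp normrX.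
rewrite -ler_pdivrMr ?exprn_gt0 // -expr_div_n => h.
have e : rc (re (`|u.[w]| / rc M)) = `|u.[w]| / rc M by rewrite rc_re // divr_ge0 // ltW.
rewrite -ler_rc; have -> : rc (re (`|u.[w]| / rc M) ^+ N) = (`|u.[w]| / rc M) ^+ N.
  by rewrite -[in RHS]e /rc rmorphXn.
apply: le_trans h _; rewrite [rc _]rmorph_nat ler_nat.
apply: leq_trans (size_exp_leq _ _) _; rewrite addn1 ltnS mulnC leq_mul2l.
by rewrite leq_pred orbT.
Qed.

(** For large [t] the modulus of [u - t] on the circle is at most
[sqrt (K + t ^ 2)] when the real part of [u] is nonnegative there; the maximum
principle for [u - t] and [t] going to infinity give the claim. *)
Lemma re_max_principle (u : {poly C}) w :
  (forall z, `|z| = 1 -> 0 <= re u.[z]) -> `|w| <= 1 -> 0 <= re u.[w].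
Proof.
move=> u0 w1.
have [K [K0 uK]] : exists K : R, 0 <= K /\ forall z, `|z| = 1 -> re (`|u.[z]| ^+ 2) <= K.
  exists (re ((\sum_(i < size u) `|u`_i|) ^+ 2)).
  split=> [|z z1]; first by rewrite re_ge0 // exprn_ge0 // sumr_ge0.
  apply: le_re; rewrite ler_pXn2r ?nnegrE ?sumr_ge0 //.
  rewrite horner_coef; apply: le_trans (ler_norm_sum _ _ _) _.
  by apply: ler_sum => i _; rewrite normrM normrX z1 expr1n mulr1.
have key t : 0 < t -> - (2 * re u.[w]) <= t^-1 * K.
  move=> t0; pose v := u - (rc t)%:P.
  have hv z : re (`|v.[z]| ^+ 2) = re (`|u.[z]| ^+ 2) - 2 * t * re u.[z] + t ^+ 2.
    by rewrite /v !hornerE !sqr_norm !(reB, imD, imN) re_rc im_rc; ring.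
  pose M := Num.sqrt (K + t ^+ 2).
  have sM : M ^+ 2 = K + t ^+ 2 by rewrite sqr_sqrtr // addr_ge0 // sqr_ge0.
  have le2 (c : C) : (`|c| <= rc M) = (re (`|c| ^+ 2) <= M ^+ 2).
    have -> : (re (`|c| ^+ 2) <= M ^+ 2) = (`|c| ^+ 2 <= rc M ^+ 2).
      by rewrite -ler_rc rc_re ?exprn_ge0 // /rc rmorphXn.
    by rewrite ler_pXn2r ?nnegrE // -rc0 ler_rc sqrtr_ge0.
  have := @max_principle v M w (sqrtr_ge0 _) _ w1.
  rewrite le2 hv sM => h.
  have : re (`|u.[w]| ^+ 2) - 2 * t * re u.[w] + t ^+ 2 <= K + t ^+ 2.
    apply: h => z z1; rewrite le2 hv sM lerD2r.
    apply: le_trans (uK z z1); rewrite gerBl.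
    by rewrite !mulr_ge0 ?u0 // ltW.
  have : 0 <= re (`|u.[w]| ^+ 2) by rewrite re_ge0 // exprn_ge0.
  move=> h1 h2; rewrite -ler_pdivrMl ?invr_gt0 // invrK; lra.
have : - (2 * re u.[w]) <= 0.
  by apply: (@le0_small _ _ K) => s s0; rewrite -[s]invrK key // invr_gt0.
lra.
Qed.

End MaximumPrinciple.

(** * Polynomials in a commuting tuple of matrices *)

Section PolynomialCalculus.
Variables (R : realType) (n d : nat) (S : 'I_n -> 'M[complexC R]_d).
Local Notation C := (complexC R).
Implicit Types (f g : 'rV[C]_n -> C) (z : 'rV[C]_n) (A B : 'M[C]_d).

(** The graph of the polynomial calculus. A polynomial is represented by the pair of
its function and its value at [S], which makes every property of polynomials
available by induction on their construction. *)
Inductive calc : ('rV[C]_n -> C) -> 'M[C]_d -> Prop :=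
| calc_cst c : calc (fun=> c) c%:M
| calc_coord i : calc (fun z => z 0 i) (S i)
| calc_add f g A B : calc f A -> calc g B -> calc (fun z => f z + g z) (A + B)
| calc_mul f g A B : calc f A -> calc g B -> calc (fun z => f z * g z) (A *m B).

Definition polyfun f := exists A, calc f A.

Lemma calc_scale a f A : calc f A -> calc (fun z => a * f z) (a *: A).
Proof. by move=> fA; rewrite -mul_scalar_mx; apply: calc_mul => //; exact: calc_cst. Qed.

Lemma calc_sum I (r : seq I) (F : I -> 'rV[C]_n -> C) (A : I -> 'M[C]_d) :
  (forall i, calc (F i) (A i)) ->
  calc (fun z => \sum_(i <- r) F i z) (\sum_(i <- r) A i).
Proof.
move=> h; elim: r => [|i r IHr].
  have -> : (fun z => \sum_(i <- [::]) F i z) = fun=> 0.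
    by apply/funext => z; rewrite big_nil.
  rewrite big_nil; have -> : (0 : 'M[C]_d) = (0 : C)%:M by rewrite raddf0.
  exact: calc_cst.
have -> : (fun z => \sum_(j <- i :: r) F j z) = fun z => F i z + \sum_(j <- r) F j z.
  by apply/funext => z; rewrite big_cons.
by rewrite big_cons; exact: calc_add.
Qed.

Lemma polyfun_sum I (r : seq I) (F : I -> 'rV[C]_n -> C) :
  (forall i, polyfun (F i)) -> polyfun (fun z => \sum_(i <- r) F i z).
Proof.
by move=> /choice[A hA]; exists (\sum_(i <- r) A i); exact: calc_sum.
Qed.

Lemma polyfun_cst c : polyfun (fun=> c).
Proof. by exists c%:M; exact: calc_cst. Qed.

Lemma polyfun_add f g : polyfun f -> polyfun g -> polyfun (fun z => f z + g z).
Proof. by move=> [A fA] [B gB]; exists (A + B); exact: calc_add. Qed.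

Lemma polyfun_mul f g : polyfun f -> polyfun g -> polyfun (fun z => f z * g z).
Proof. by move=> [A fA] [B gB]; exists (A *m B); exact: calc_mul. Qed.

Lemma polyfun_prod I (r : seq I) (F : I -> 'rV[C]_n -> C) :
  (forall i, polyfun (F i)) -> polyfun (fun z => \prod_(i <- r) F i z).
Proof.
move=> h; elim: r => [|i r IHr].
  have -> : (fun z => \prod_(i <- [::]) F i z) = fun=> 1.
    by apply/funext => z; rewrite big_nil.
  exact: polyfun_cst.
have -> : (fun z => \prod_(j <- i :: r) F j z) = fun z => F i z * \prod_(j <- r) F j z.
  by apply/funext => z; rewrite big_cons.
exact: polyfun_mul.
Qed.

Lemma polyfun_det k (F : 'rV[C]_n -> 'M[C]_k) :
  (forall i j, polyfun (fun z => F z i j)) -> polyfun (fun z => \det (F z)).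
Proof.
move=> hF; apply: polyfun_sum => s; apply: polyfun_mul; first exact: polyfun_cst.
by apply: polyfun_prod => i; exact: hF.
Qed.

Lemma polyfun_adj k (F : 'rV[C]_n -> 'M[C]_k) i j :
  (forall i j, polyfun (fun z => F z i j)) -> polyfun (fun z => (\adj (F z)) i j).
Proof.
move=> hF.
have -> : (fun z => (\adj (F z)) i j) = fun z => cofactor (F z) j i.
  by apply/funext => z; rewrite mxE.
apply: polyfun_mul; first exact: polyfun_cst.
apply: polyfun_det => i' j'.
have -> : (fun z => row' j (col' i (F z)) i' j') = fun z => F z (lift j i') (lift i j').
  by apply/funext => z; rewrite !mxE.
exact: hF.
Qed.

Lemma calc_differentiable f A z : calc f A -> differentiable f z.
Proof.
elim=> {f A} [c|i|f g A B _ IHf _ IHg|f g A B _ IHf _ IHg].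
- exact: differentiable_cst.
- exact: differentiable_coord.
- exact: differentiableD.
- exact: differentiableM.
Qed.

Definition upd z (j : 'I_n) w : 'rV[C]_n := \row_i if i == j then w else z 0 i.

Lemma calc_slice f A z j : calc f A ->
  exists u : {poly C}, forall w, f (symmetrization (upd z j w)) = u.[w].
Proof.
elim=> {f A} [c|i|f g A B _ [u fu] _ [v gv]|f g A B _ [u fu] _ [v gv]].
- by exists c%:P => w; rewrite hornerC.
- exists (\sum_(I : {set 'I_n} | #|I| == i.+1)
    \prod_(k in I) if k == j then 'X else (z 0 k)%:P) => w.
  rewrite mxE horner_sum; apply: eq_bigr => I _; rewrite horner_prod.
  by apply: eq_bigr => k _; rewrite mxE; case: ifP; rewrite ?hornerX ?hornerC.
- by exists (u + v) => w; rewrite hornerD fu gv.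
- by exists (u * v) => w; rewrite hornerM fu gv.
Qed.

(** The one-variable principle is applied to one coordinate after the other; composed
with the symmetrization, [f] is a polynomial in each coordinate. *)
Lemma calc_re_polydisc f A : calc f A ->
  (forall z, (forall i, `|z 0 i| = 1) -> 0 <= re (f (symmetrization z))) ->
  forall z, (forall i, `|z 0 i| <= 1) -> 0 <= re (f (symmetrization z)).
Proof.
move=> fA f0.
(* The coordinates from k on are still on the circle. *)
suff step k z : (forall i : 'I_n, `|z 0 i| <= 1) ->
    (forall i : 'I_n, (k <= i)%N -> `|z 0 i| = 1) -> 0 <= re (f (symmetrization z)).
  move=> z z1; apply: (step n) => // i; by rewrite leqNgt ltn_ord.
elim: k z => [|k IHk] z z1 zk; first by apply: f0 => i; exact: zk.
have [kn|nk] := ltnP k n; last first.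
  by apply: IHk => // i ki; have := leq_trans nk ki; rewrite leqNgt ltn_ord.
pose j := Ordinal kn; have [u fu] := calc_slice z j fA.
have zE : z = upd z j (z 0 j).
  by apply/rowP => i; rewrite mxE; case: eqP => [->|].
rewrite zE fu; apply: re_max_principle (z1 j) => w w1; rewrite -fu.
apply: IHk => i; rewrite mxE; case: eqP => [_|/eqP ij //]; rewrite ?w1 //.
move=> ki; apply: zk; rewrite ltn_neqAle ki andbT eq_sym.
by apply: contraNneq ij => h; apply/eqP/val_inj.
Qed.

End PolynomialCalculus.

(** * Consequences of the spectral set hypothesis *)

Section OperatorNorm.
Variables (R : realType) (H : hilbertType R).
Local Notation C := (complexC R).

Lemma rnorm_rc (V : normedModType C) (x : V) : rc (rnorm x) = `|x|.
Proof. exact: rc_re. Qed.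

Lemma rnormZ (V : normedModType C) (a : C) (x : V) : rnorm (a *: x) = re `|a| * rnorm x.
Proof.
rewrite -[RHS]re_rc rcM rnorm_rc rc_re // -normrZ -rnorm_rc re_rc //.
Qed.

Lemma opnorm_le (A : H -> H) x : bounded_operator A ->
  rnorm (A x) <= opnorm A * rnorm x.
Proof.
move=> [lA cA].
pose Al : {linear H -> H} := HB.pack A (GRing.isLinear.Build _ _ _ _ _ lA).
have /linear_boundedP/pinfty_ex_gt0[r r0 hr] : bounded_near Al (nbhs (0 : H)).
  by apply/linear_bounded_continuous.
have ub : has_ubound [set rnorm (A x) | x in [set x : H | rnorm x <= 1]].
  exists (re r) => _ [y y1 <-]; rewrite -ler_rc rnorm_rc rc_re ?(ltW r0) //.
  apply: le_trans (hr y) _; rewrite ger_pMr // -rnorm_rc -rc1 ler_rc.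
  exact: y1.
have [->|x0] := eqVneq x 0.
  have -> : A 0 = 0 by exact: (raddf0 Al).
  by rewrite /rnorm normr0 /= mulr0.
have nx : 0 < rnorm x by rewrite -ltr_rc rnorm_rc normr_gt0.
pose y := rc (rnorm x)^-1 *: x.
have ny : rnorm y = 1.
  rewrite rnormZ ger0_norm -?rc0 ?ler_rc ?invr_ge0 ?(ltW nx) // re_rc mulVf //.
  by rewrite gt_eqF.
have xE : x = rc (rnorm x) *: y.
  by rewrite scalerA -rcM mulfV ?gt_eqF // rc1 scale1r.
have -> : A x = rc (rnorm x) *: A y by rewrite [in LHS]xE; exact: (linearZ_LR Al).
rewrite rnormZ ger0_norm -?rc0 ?ler_rc ?(ltW nx) // re_rc mulrC ler_wpM2r ?(ltW nx) //.
by apply: ub_le_sup => //; exists y => //=; rewrite ny.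
Qed.

Lemma opnorm_eq0 (A : H -> H) x : bounded_operator A -> opnorm A = 0 -> A x = 0.
Proof.
move=> bA A0; have := opnorm_le x bA; rewrite A0 mul0r => h.
apply/normr0_eq0/le_anti; rewrite normr_ge0 andbT.
by rewrite -rnorm_rc -rc0 ler_rc.
Qed.

End OperatorNorm.

Section FunctionalCalculus.
Variables (R : realType) (H : hilbertType R) (n : nat) (T : 'I_n -> H -> H).
Local Notation C := (complexC R).
Variable Phi : ('rV[C]_n -> C) -> H -> H.
Hypothesis hPhi : holomorphic_calculus T Phi.

Lemma holomorphic_near_entire (K : set 'rV[C]_n) f :
  (forall z, differentiable f z) -> holomorphic_near K f.
Proof. by move=> df; exists setT => //; split => //; exact: openT. Qed.

(** The continuity of the calculus, applied to a constant sequence. *)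
Lemma calculus_germ (U : set 'rV[C]_n) f g : joint_spectrum T `<=` U ->
  holomorphic_on U f -> holomorphic_on U g -> (forall z, U z -> f z = g z) ->
  forall x, Phi f x = Phi g x.
Proof.
move=> TU Uf Ug fg x.
have bD : bounded_operator (fun x => Phi f x - Phi g x).
  have [lf cf] : bounded_operator (Phi f) by apply: hc_bounded hPhi _ _; exists U.
  have [lg cg] : bounded_operator (Phi g) by apply: hc_bounded hPhi _ _; exists U.
  split; first by move=> a u v; rewrite lf lg scalerBr opprD addrACA.
  by move=> y; apply: cvgB; [exact: cf|exact: cg].
have := @hc_cont _ _ _ _ _ hPhi U (fun _ => f) g TU (fun _ => Uf) Ug.
have unif : forall K, compact K -> K `<=` U -> {uniform K, (fun _ : nat => f) @ \oo --> g}.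
  move=> K _ KU P /uniform_nbhs [E [entE EP]].
  have -> : ((fun _ : nat => f) @ \oo) P = \oo ((fun _ : nat => f) @^-1` P) by [].
  apply: filterE => k; apply: EP => y Ky; change (E (g y, f y)).
  by rewrite (fg y (KU _ Ky)); exact: entourage_refl.
move=> /(_ unif) h; apply/eqP; rewrite -subr_eq0; apply/eqP.
apply: (opnorm_eq0 x bD); apply: (@cvg_unique _ (@Rhausdorff R) _ _ _ _ _ h).
exact: cvg_cst.
Qed.

End FunctionalCalculus.

Section SpectralSetEstimate.
Variables (R : realType) (n d : nat) (S : 'I_n -> 'M[complexC R]_d).
Local Notation C := (complexC R).
Local Notation T := (fun i => @matrix_op R d (S i)).

Lemma calculus_calc Phi f A : holomorphic_calculus T Phi -> calc S f A ->
  forall x, Phi f x = A *m x.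
Proof.
move=> hPhi; have ent g B : calc S g B -> holomorphic_near (joint_spectrum T) g.
  by move=> gB; apply: holomorphic_near_entire => z; exact: calc_differentiable gB.
elim=> {f A} [c|i|f g A B fA IHf gB IHg|f g A B fA IHf gB IHg] x.
- by rewrite (hc_cst hPhi) mul_scalar_mx.
- by rewrite (hc_coord hPhi).
- by rewrite (hc_add hPhi) ?IHf ?IHg ?mulmxDl //; [exact: ent fA|exact: ent gB].
- by rewrite (hc_mul hPhi) ?IHf ?IHg ?mulmxA //; [exact: ent fA|exact: ent gB].
Qed.

(** A joint eigenvector, placed in degree 0, is a cocycle of the Koszul complex,
and there are no coboundaries in degree 0. *)
Lemma eigenvector_spectrum (v : 'cV[C]_d) (l : 'rV[C]_n) : v != 0 ->
  (forall i, S i *m v = l 0 i *: v) -> joint_spectrum T l.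
Proof.
move=> v0 Sv ex.
have [|u hu] := ex (fun I => if I == finset.set0 then (v : euclid R d) else 0).
  move=> I; apply: big1 => i iI; case: eqP => [_|_].
    by rewrite /matrix_op Sv subrr scaler0.
  by rewrite /matrix_op mulmx0 scaler0 subrr scaler0.
have := hu finset.set0; rewrite eqxx /koszul_d big1 => [/eqP|i]; last by rewrite inE.
by rewrite eq_sym (negbTE v0).
Qed.

Lemma Gamma_nonempty : exists z, @Gamma R n z.
Proof. by exists (symmetrization 0); exists 0 => //= i; rewrite mxE normr0. Qed.

Hypothesis spec : spectral_set (@Gamma R n) T.

(** The hypothesis applied to [p / q], whose value at [T] is [A] times the inverse
of [B]. In this form it involves polynomials only. *)
Lemma spectral_set_quotient (p q : 'rV[C]_n -> C) (A B : 'M[C]_d) (k : R) :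
  calc S p A -> calc S q B -> 0 <= k ->
  (forall z, Gamma z -> q z != 0) ->
  (forall z, Gamma z -> `|p z| <= rc k * `|q z|) ->
  forall w : euclid R d, rnorm (A *m w : euclid R d) <= k * rnorm (B *m w : euclid R d).
Proof.
move=> pA qB k0 q0 pq w.
have [TG [Phi hPhi hle]] := spec.
have dp z : differentiable p z by exact: calc_differentiable pA.
have dq z : differentiable q z by exact: calc_differentiable qB.
have cp : continuous p by move=> z; exact: differentiable_continuous.
have cq : continuous q by move=> z; exact: differentiable_continuous.
pose U : set 'rV[C]_n := [set z | q z != 0] `&` [set z | `|p z / q z| < rc (k + 1)].
pose f z := p z / q z.
have df z : q z != 0 -> differentiable f z.
  by move=> qz; exact: (differentiableM (dp z) (differentiableV (dq z) qz)).
have oU : open U.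
  rewrite openE => z [qz fz]; apply: filterI; first exact: cvgr_neq0 (cq z) qz.
  have cfz : f @ z --> f z by exact: differentiable_continuous (df _ qz).
  exact: cvgr_norm_lt cfz _ fz.
have GU : @Gamma R n `<=` U.
  move=> z Gz; split; first exact: q0.
  rewrite /= normf_div ltr_pdivrMr ?normr_gt0 ?q0 //.
  apply: le_lt_trans (pq z Gz) _; rewrite ltr_pM2r ?normr_gt0 ?q0 // ltr_rc.
  by rewrite ltrDl.
have fU : holomorphic_on U f by split; [exact: oU|move=> z [qz _]; exact: df].
have Phif x : Phi f (B *m x) = A *m x.
  rewrite -(calculus_calc hPhi pA) -(calculus_calc hPhi qB).
  have ent g : (forall z, differentiable g z) -> holomorphic_near (joint_spectrum T) g.
    exact: holomorphic_near_entire.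
  rewrite -(hc_mul hPhi); [|exists U; [exact: subset_trans GU|exact: fU]|exact: ent].
  apply: (calculus_germ hPhi (U := U)).
  - exact: subset_trans GU.
  - split; first exact: oU.
    move=> z Uz; case: fU => _ /(_ _ Uz) dfz.
    exact: (differentiableM dfz (dq z)).
  - by split; [exact: oU|move=> z _; exact: dp].
  - by move=> z [qz _]; rewrite /f divfK.
have bf : bounded_holomorphic_near (@Gamma R n) f.
  exists U; split; [exact: GU|exact: fU|].
  by exists (rc (k + 1)) => z [_ h]; exact: ltW.
rewrite -Phif; apply: le_trans (opnorm_le _ _) _.
  by apply: hc_bounded hPhi _ _; exists U; [exact: subset_trans GU|exact: fU].
rewrite ler_wpM2r //; first by rewrite -ler_rc rnorm_rc rc0.
apply: le_trans (hle f bf) _; apply: ge_sup.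
  by have [z Gz] := Gamma_nonempty; exists (rnorm (f z)); exists z.
move=> _ [z Gz <-]; rewrite -ler_rc rnorm_rc /f normf_div.
by rewrite ler_pdivrMr ?normr_gt0 ?q0 // pq.
Qed.

End SpectralSetEstimate.

(** * Commuting 2 x 2 matrices *)

Section TwoByTwo.
Variable R : realType.
Local Notation C := (complexC R).

Lemma sum2 (V : nmodType) (F : 'I_2 -> V) : \sum_i F i = F 0 + F 1.
Proof.
rewrite !big_ord_recl big_ord0 addr0; congr (_ + F _); exact/val_inj.
Qed.

Lemma ord2P (P : 'I_2 -> Prop) : P 0 -> P 1 -> forall i, P i.
Proof. by move=> P0 P1 [[|[|//]] i2]; [move: P0|move: P1]; congr P; exact/val_inj. Qed.

Lemma mul2E m k (A : 'M[C]_(m, 2)) (B : 'M[C]_(2, k)) i j :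
  (A *m B) i j = A i 0 * B 0 j + A i 1 * B 1 j.
Proof. by rewrite mxE sum2. Qed.

(** Commutation of the matrices with entries [a b c d] and [p q s u], read
entrywise; any of the quotients [q / b], [s / c] and [(p - u) / (a - d)] with nonzero
denominator serves as [y]. *)
Lemma commutant_entries (a b c d p q s u : C) :
  a * p + b * s = p * a + q * c -> a * q + b * u = p * b + q * d ->
  c * p + d * s = s * a + u * c -> ~ [/\ b = 0, c = 0 & a = d] ->
  exists x y, [/\ p = x + y * a, q = y * b, s = y * c & u = x + y * d].
Proof.
move=> e00 e01 e10 ns.
have [b0|b0] := eqVneq b 0; last first.
  exists (p - q / b * a), (q / b); split; first by rewrite subrK.
  - by rewrite divfK.
  - apply: (mulfI b0); have -> : b * (q / b * c) = q * c by field.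
    by apply: (addrI (a * p)); rewrite e00; ring.
  - apply: (mulfI b0); have -> : b * (p - q / b * a + q / b * d) = p * b + q * d - a * q by field.
    by rewrite -e01; ring.
have [c0|c0] := eqVneq c 0; last first.
  exists (p - s / c * a), (s / c); split; first by rewrite subrK.
  - apply: (mulfI c0); have -> : c * (s / c * b) = s * b by field.
    by apply: (addrI (p * a)); rewrite [c * q]mulrC -e00; ring.
  - by rewrite divfK.
  - apply: (mulfI c0); have -> : c * (p - s / c * a + s / c * d) = c * p + d * s - s * a by field.
    by rewrite e10; ring.
have ad : a - d != 0 by apply/eqP => /eqP; rewrite subr_eq0 => /eqP ad; apply: ns.
subst b c; exists (p - (p - u) / (a - d) * a), ((p - u) / (a - d)); split.
- by rewrite subrK.
- apply: (mulfI ad); rewrite !mulr0 mulrBl; apply/eqP; rewrite subr_eq0; apply/eqP.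
  by move: e01; rewrite mul0r mulr0 addr0 add0r [d * q]mulrC.
- apply: (mulfI ad); rewrite !mulr0 mulrBl; apply/eqP; rewrite subr_eq0; apply/eqP.
  by move: e10; rewrite mul0r mulr0 addr0 add0r [a * s]mulrC.
- by field.
Qed.

Lemma commutant_nonscalar (A B : 'M[C]_2) : (forall c, A <> c%:M) ->
  A *m B = B *m A -> exists x y, B = x%:M + y *: A.
Proof.
move=> nA AB.
have e i j : A i 0 * B 0 j + A i 1 * B 1 j = B i 0 * A 0 j + B i 1 * A 1 j.
  by rewrite -!mul2E AB.
have [|x [y [h00 h01 h10 h11]]] := commutant_entries (e 0 0) (e 0 1) (e 1 0).
  move=> [b0 c0 ad]; apply: (nA (A 0 0)); apply/matrixP.
  by apply: ord2P; apply: ord2P; rewrite mxE /= ?mulr0n ?mulr1n.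
exists x, y; apply/matrixP; apply: ord2P; apply: ord2P;
  by rewrite !mxE /= ?mulr0n ?mulr1n ?add0r.
Qed.

(** Take for [l] an eigenvalue, for [e] a unit eigenvector, for [r] a unit vector
orthogonal to [e], and [t = (A - l) r]. *)
Lemma rank_one_decomposition (A : 'M[C]_2) : exists l (e r t : 'cV[C]_2),
  [/\ ctr e *m e = 1%:M, ctr r *m r = 1%:M, ctr r *m e = 0,
     e *m ctr e + r *m ctr r = 1%:M & A = l%:M + t *m ctr r].
Proof.
have [l rl] : exists l, root (char_poly A^T) l.
  by apply/closed_rootP; rewrite size_char_poly.
have [v Av v0] : exists2 v : 'cV[C]_2, A *m v = l *: v & v != 0.
  have /eigenvalueP[w wA w0] : eigenvalue A^T l by rewrite eigenvalue_root_char.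
  by exists w^T; rewrite ?trmx_eq0 // -[A]trmxK -trmx_mul wA linearZ.
pose N := `|v 0 0| ^+ 2 + `|v 1 0| ^+ 2.
have N0 : 0 < N.
  rewrite lt_neqAle addr_ge0 ?exprn_ge0 // andbT eq_sym; apply: contraNneq v0 => N0.
  have := paddr_eq0 (exprn_ge0 2 (normr_ge0 (v 0 0))) (exprn_ge0 2 (normr_ge0 (v 1 0))).
  rewrite -/N N0 eqxx => /esym /andP[]; rewrite !expf_eq0 /= !normr_eq0 => /eqP h0 /eqP h1.
  by apply/eqP/matrixP; apply: ord2P => j; rewrite ord1 mxE.
pose e := (sqrtC N)^-1 *: v.
have Ae : A *m e = l *: e by rewrite -scalemxAr Av !scalerA mulrC.
have e1 : e 0 0 * (e 0 0)^* + e 1 0 * (e 1 0)^* = 1.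
  rewrite -!normCK !mxE !normrM !exprMn -mulrDr -/N normfV exprVn ger0_norm ?sqrtC_ge0 ?ltW //.
  by rewrite sqrtCK mulVf // gt_eqF.
clearbody e; clear N N0 v v0 Av.
pose r : 'cV[C]_2 := \col_i if i == 0 then - (e 1 0)^* else (e 0 0)^*.
have r0 : r 0 0 = - (e 1 0)^* by rewrite mxE.
have r1 : r 1 0 = (e 0 0)^* by rewrite mxE.
have id1 : e *m ctr e + r *m ctr r = 1%:M.
  apply/matrixP; apply: ord2P; apply: ord2P; rewrite !mxE !big_ord1 !ctrE ?r0 ?r1
    ?rmorphN /= ?conjCK ?mulr1n ?mulr0n -?e1; ring.
exists l, e, r, ((A - l%:M) *m r); split=> //.
- by apply/matrixP => i j; rewrite !ord1 mul2E !ctrE mxE mulr1n -e1; ring.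
- apply/matrixP => i j; rewrite !ord1 mul2E !ctrE r0 r1 rmorphN /= !conjCK mxE mulr1n -e1; ring.
- by apply/matrixP => i j; rewrite !ord1 mul2E !ctrE r0 r1 rmorphN /= !conjCK mxE; ring.
- have : (A - l%:M) *m (e *m ctr e + r *m ctr r) = A - l%:M by rewrite id1 mulmx1.
  rewrite mulmxDr !mulmxA.
  have -> : (A - l%:M) *m e = 0 by rewrite mulmxBl Ae mul_scalar_mx subrr.
  by rewrite mul0mx add0r => ->; rewrite addrC subrK.
Qed.

(** A commuting family lies in the algebra generated by any of its nonscalar
members, so one rank-one matrix [t r^*] serves for the whole family. *)
Lemma commuting_structure n (S : 'I_n -> 'M[C]_2) :
  (forall i j, S i *m S j = S j *m S i) ->
  exists (x nu : 'rV[C]_n) (e r t : 'cV[C]_2),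
  [/\ ctr e *m e = 1%:M, ctr r *m r = 1%:M, ctr r *m e = 0,
     e *m ctr e + r *m ctr r = 1%:M &
     forall i, S i = (x 0 i)%:M + nu 0 i *: (t *m ctr r)].
Proof.
move=> SC; have [[k Sk]|sc] := pselect (exists k, forall c, S k <> c%:M).
  have [l [e [r [t [ee rr re id1 St]]]]] := rank_one_decomposition (S k).
  have /choice[x hx] i : exists ab : C * C, S i = ab.1%:M + ab.2 *: S k.
    by have [a [b h]] := commutant_nonscalar Sk (SC k i); exists (a, b).
  exists (\row_i ((x i).1 + (x i).2 * l)), (\row_i (x i).2), e, r, t; split=> // i.
  rewrite !mxE hx [in LHS]St scalerDr scale_scalar_mx addrA; congr (_ + _).
  by rewrite raddfD.
have [l [e [r [t [ee rr re id1 _]]]]] := rank_one_decomposition 0.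
exists (\row_i S i 0 0), 0, e, r, 0; split=> // i.
rewrite mxE mxE scale0r addr0; apply: contrapT => h; apply: sc; exists i => c Sc.
by apply: h; rewrite Sc mxE eqxx mulr1n.
Qed.

End TwoByTwo.

(** * Complete positivity of the polynomial calculus *)

Section Entry.
Variables (R : realType) (d : nat).
Local Notation C := (complexC R).
Implicit Types (u v : 'cV[C]_d) (B : 'M[C]_d).

Definition sc u B v : C := (ctr u *m B *m v) 0 0.

Lemma sc_addm u B B' v : sc u (B + B') v = sc u B v + sc u B' v.
Proof. by rewrite /sc mulmxDr mulmxDl mxE. Qed.
Lemma sc_scalem u a B v : sc u (a *: B) v = a * sc u B v.
Proof. by rewrite /sc -scalemxAr -scalemxAl mxE. Qed.
Lemma sc_addr u B v v' : sc u B (v + v') = sc u B v + sc u B v'.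
Proof. by rewrite /sc mulmxDr mxE. Qed.
Lemma sc_scaler u B a v : sc u B (a *: v) = a * sc u B v.
Proof. by rewrite /sc -scalemxAr mxE. Qed.
Lemma sc_conj u B v : (sc u B v)^* = sc v (ctr B) u.
Proof. by rewrite /sc -ctrE !ctrM ctrK mulmxA. Qed.
Lemma sc_mul u B v : sc u B v = (ctr u *m (B *m v)) 0 0.
Proof. by rewrite /sc mulmxA. Qed.

Lemma ctr_sqr_gt0 v : v != 0 -> 0 < re ((ctr v *m v) 0 0).
Proof.
move=> v0; have := @euclid_inner_gt0 R d v v0.
have -> : euclid_inner v v = (ctr v *m v) 0 0.
  by rewrite mxE; apply: eq_bigr => i _; rewrite ctrE mulrC.
by move=> h; rewrite -ltr_rc rc_re // ltW.
Qed.

(** A vector in the kernel of [B] makes [sc v B v] vanish. *)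
Lemma re_unitmx B : (forall v, v != 0 -> 0 < re (sc v B v)) -> B \in unitmx.
Proof.
move=> hB; rewrite unitmxE unitfE; apply/negP => /eqP dB.
have /eqP/det0P[w w0 wB] : \det B^T = 0 by rewrite det_tr.
have := hB w^T; rewrite trmx_eq0 => /(_ w0).
by rewrite sc_mul -[B]trmxK -trmx_mul wB trmx0 mulmx0 mxE re0 ltxx.
Qed.

Lemma rnorm_euclid v : rnorm (v : euclid R d) ^+ 2 = re ((ctr v *m v) 0 0).
Proof.
rewrite -[LHS]re_rc expr2 rcM rnorm_rc -expr2 euclid_sqr_norm.
by congr re; rewrite mxE; apply: eq_bigr => i _; rewrite ctrE mulrC.
Qed.

End Entry.

Section TwoPointCalculus.
Variables (R : realType) (n : nat) (S : 'I_n -> 'M[complexC R]_2).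
Local Notation C := (complexC R).
Variables (x nu : 'rV[C]_n) (e r t : 'cV[C]_2).
Hypotheses (ee : ctr e *m e = 1%:M) (rr : ctr r *m r = 1%:M)
  (re_orth : ctr r *m e = 0) (id1 : e *m ctr e + r *m ctr r = 1%:M).
Hypothesis SE : forall i, S i = (x 0 i)%:M + nu 0 i *: (t *m ctr r).

(** The trace of [M = t r^*], so that [M ^ 2 = delta M]. *)
Definition rank_one_trace : C := (ctr r *m t) 0 0.
Local Notation delta := rank_one_trace.
(** The joint eigenvalues of the tuple are [x] and [y]; they coincide for
instance when [M] is nilpotent. *)
Definition second_point : 'rV[C]_n := x + delta *: nu.
Local Notation y := second_point.
Local Notation M := (t *m ctr r).

Lemma rank_one_sqr : M *m M = delta *: M.
Proof.
by rewrite mulmxA -(mulmxA t) (mx11_scalar (ctr r *m t)) mul_mx_scalar -scalemxAl.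
Qed.

(** The coefficient [f'] is the divided difference of [f] between [x] and [y], or the
derivative of [f] at [x] in the direction [nu] when [x = y]. Treating the two cases
at once, the formula spares a distinction between diagonalizable and
nondiagonalizable tuples. *)
Lemma calc_form f A : calc S f A -> exists f',
  A = (f x)%:M + f' *: M /\ f y = f x + f' * delta.
Proof.
elim=> {f A} [c|i|f g A B _ [f' [-> fy]] _ [g' [-> gy]]|f g A B _ [f' [-> fy]] _ [g' [-> gy]]].
- by exists 0; rewrite scale0r addr0 mul0r addr0.
- by exists (nu 0 i); rewrite SE !mxE mulrC.
- exists (f' + g'); rewrite fy gy raddfD scalerDl addrACA; split => //; ring.
- exists (f x * g' + f' * g x + f' * g' * delta); rewrite fy gy; split; last by ring.
  rewrite mulmxDl !mulmxDr -scalar_mxM !mul_scalar_mx mul_mx_scalar -!scalemxAl -!scalemxAr.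
  by rewrite rank_one_sqr !scalerA !scalerDl !addrA [g x * f']mulrC.
Qed.

(** [ctr r] is a common left eigenvector for the eigenvalue [y]. *)
Lemma calc_left f A : calc S f A -> ctr r *m A = f y *: ctr r.
Proof.
move=> /calc_form[f' [-> ->]]; rewrite mulmxDr mul_mx_scalar -scalemxAr mulmxA.
by rewrite (mx11_scalar (ctr r *m t)) mul_scalar_mx scalerA scalerDl.
Qed.

Hypothesis spec : spectral_set (@Gamma R n) (fun i => @matrix_op R 2 (S i)).

(** [e] is an eigenvector. *)
Lemma first_point_Gamma : Gamma x.
Proof.
apply: (proj1 spec); apply: (@eigenvector_spectrum R n 2 S e).
  apply/eqP => e0; have := congr1 (fun B : 'M[C]_1 => B 0 0) ee.
  by rewrite e0 mulmx0 !mxE => /eqP; rewrite eq_sym oner_eq0.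
by move=> i; rewrite SE mulmxDl mul_scalar_mx -scalemxAl -mulmxA re_orth mulmx0 scaler0 addr0.
Qed.

(** [t] is an eigenvector when [x] and [y] differ. *)
Lemma second_point_Gamma : Gamma y.
Proof.
have [d0|d0] := eqVneq delta 0.
  by rewrite /second_point d0 scale0r addr0; exact: first_point_Gamma.
apply: (proj1 spec); apply: (@eigenvector_spectrum R n 2 S t).
  by apply: contraNneq d0 => t0; rewrite /rank_one_trace t0 mulmx0 mxE.
move=> i; rewrite SE mulmxDl mul_scalar_mx -scalemxAl -mulmxA (mx11_scalar (ctr r *m t)).
rewrite mul_mx_scalar scalerA -scalerDl -/rank_one_trace; congr (_ *: t).
by rewrite /second_point [RHS]mxE [X in _ = _ + X]mxE mulrC.
Qed.

Variables (P : 'rV[C]_n -> 'M[C]_2) (A : 'I_2 -> 'I_2 -> 'M[C]_2).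
Hypothesis calcP : forall i j, calc S (fun z => P z i j) (A i j).
Local Notation P0 := (P x).
Local Notation Y := (P0 + ctr P0).

Section Strict.
Variable eps : R.
Hypothesis eps0 : 0 < eps.
Hypothesis Ppos : forall z, Gamma z -> forall v : 'cV[C]_2,
  eps * re ((ctr v *m v) 0 0) <= re (sc v (P z) v).

Lemma re_sc_gt0 z v : Gamma z -> v != 0 -> 0 < re (sc v (P z) v).
Proof.
by move=> Gz v0; apply: lt_le_trans (Ppos Gz v); rewrite mulr_gt0 // ctr_sqr_gt0.
Qed.

Lemma re_sc_ge0 z v : Gamma z -> 0 <= re (sc v (P z) v).
Proof.
move=> Gz; have [->|v0] := eqVneq v 0; last by rewrite ltW // re_sc_gt0.
by rewrite /sc mulmx0 mxE.
Qed.

Lemma shifted_unit z : Gamma z -> P z + ctr P0 \in unitmx.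
Proof.
move=> Gz; apply: re_unitmx => v v0; rewrite sc_addm reD -sc_conj re_conj.
by rewrite addr_gt0 // re_sc_gt0 //; exact: first_point_Gamma.
Qed.

(** Twice the real part of [P x] measures vectors: it makes the Cayley transform of
[P] centred at [x] contractive. *)
Definition yform_fun (u v : 'cV[C]_2) : C := sc v Y u.

Lemma yform_linear a u v w :
  yform_fun (a *: u + v) w = a * yform_fun u w + yform_fun v w.
Proof. by rewrite /yform_fun sc_addr sc_scaler. Qed.

Lemma yform_conj u v : yform_fun u v = (yform_fun v u)^*.
Proof. by rewrite /yform_fun sc_conj ctrD ctrK [ctr P0 + _]addrC. Qed.

Lemma yform_diag v : re (yform_fun v v) = 2 * re (sc v P0 v).
Proof. by rewrite /yform_fun sc_addm reD -sc_conj re_conj; ring. Qed.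

Lemma yform_ge0 v : 0 <= re (yform_fun v v).
Proof. by rewrite yform_diag mulr_ge0 // re_sc_ge0 //; exact: first_point_Gamma. Qed.

Definition yform := PsdForm yform_linear yform_conj yform_ge0.

Lemma yform_cauchy_schwarz u v :
  re (`|yform u v| ^+ 2) <= re (yform u u) * re (yform v v).
Proof.
have := gns_inner_le (iota yform u) (iota yform v).
by rewrite gns_inner_iota (gns_sqn_form (@iotaE _ _ _ u)) (gns_sqn_form (@iotaE _ _ _ v)).
Qed.

(** The Cayley transform [(P - P0) (P + ctr P0)^-1] vanishes at [x] and maps [Y c'] to
[(P - P0) h = Y (c' - h)]. It is contractive in the geometry of [Y]: the squared
norm of [c' - h] is that of [c'] minus twice the real part of [sc h P h]. *)
Lemma schwarz_pick_bound z (h c' d' : 'cV[C]_2) : Gamma z ->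
  (P z + ctr P0) *m h = Y *m c' ->
  re (`|sc d' (P z - P0) h| ^+ 2) <= re (yform c' c') * re (yform d' d').
Proof.
move=> Gz hc.
have -> : sc d' (P z - P0) h = yform (c' - h) d'.
  rewrite -[yform _ _]/(sc d' Y (c' - h)) !sc_mul mulmxBr -hc; congr ((_ *m _) 0 0).
  by rewrite -mulmxBl; congr (_ *m _); rewrite opprD addrACA subrr addr0.
apply: le_trans (yform_cauchy_schwarz _ _) _.
rewrite ler_wpM2r ?(psd_ge0 yform) //.
have -> : c' - h = c' + (-1) *: h by rewrite scaleN1r.
rewrite psdDD psdZZ psdZr rmorphN /= conjC1 mulN1r reN oppr0 expr0n addr0 sqrrN expr1n mul1r.
have -> : re (yform_fun c' h) = re (sc h (P z) h) + re (sc h P0 h).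
  rewrite /yform_fun sc_mul -hc -sc_mul sc_addm reD; congr (_ + _).
  by rewrite -sc_conj re_conj.
rewrite (yform_diag h); have := re_sc_ge0 h Gz.
by move: (re _) (re _) (re _) => a b c; lra.
Qed.

(** Entrywise conjugation. It appears because the trace pairing
[\sum_ij A_ij i j] transposes one of the two tensor factors. *)
Definition cj (u : 'cV[C]_2) : 'cV[C]_2 := (ctr u)^T.

Lemma ctr_cj u : ctr (cj u) = u^T.
Proof. by apply/matrixP => i j; rewrite /cj ctrE !mxE conjCK. Qed.

Lemma cj_outer u : cj u *m ctr (cj u) = (u *m ctr u)^T.
Proof. by rewrite ctr_cj trmx_mul. Qed.

Lemma sc_trace (u : 'cV[C]_2) B : sc u B u = \tr (B *m (u *m ctr u)).
Proof. by rewrite mulmxA mxtrace_mulC mulmxA [X in _ = \tr X]mx11_scalar mxtrace_scalar. Qed.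

Lemma trace_cj B : sc (cj e) B (cj e) + sc (cj r) B (cj r) = \tr B.
Proof.
by rewrite !sc_trace !cj_outer -raddfD -mulmxDr -raddfD /= id1 trmx1 mulmx1.
Qed.

Lemma trace_inequality (pa pb N T2 D2 u v : R) : 0 <= N ->
  0 <= 2 * pa + T2 * N + 2 * u -> 0 <= 2 * pb + D2 * N + 2 * v ->
  N * N * (T2 + D2) <= N * (2 * pb + D2 * N + 2 * v) ->
  0 <= pa + pb + (u + v).
Proof.
rewrite le_eqVlt => /orP[/eqP <-|N0]; first by rewrite !mulr0; lra.
move=> h1 h2; rewrite -mulrA ler_pM2l // => h3; lra.
Qed.

(** With [A i j = P0 i j + G i j * M] the sum is [\tr P0 + tau <G b, a> + delta <G b, b>],
where [a] and [b] are the conjugates of [e] and [r] and [t = tau e + delta r]. Put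
[Y e' = G b] and let [N] be the squared norm of [e'] for [Y]. Minimizing over [a], the
sum is nonnegative as soon as
[|tau| ^ 2 N <= |b| ^ 2 + 2 re (delta <G b, b>)],
that is [N |t| ^ 2 <= |c'| ^ 2] with [c' = b + delta e'].
This is the estimate of the Cayley transform at the tuple: being zero at [x], it takes
there a value of the form [W' * M], so that its norm is controlled by its scalar
matrix coefficients, to which the spectral set hypothesis applies. The relevant
coefficient [p / q] is the one between the vectors [Y c'] and [e']; [p] and [q] are
obtained by clearing the denominator [q = \det (P + ctr P0)], and [Y c'] is chosen so that
the adjugate simplifies at [y]. *)
Lemma strict_trace_ge0 : 0 <= re (\sum_i \sum_j A i j i j).
Proof.
have Gx := first_point_Gamma; have Gy := second_point_Gamma.
have /choice[g' hg'] (ij : 'I_2 * 'I_2) : exists f', A ij.1 ij.2 = (P x ij.1 ij.2)%:M + f' *: M /\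
    P y ij.1 ij.2 = P x ij.1 ij.2 + f' * delta.
  exact: calc_form (calcP _ _).
pose G : 'M[C]_2 := \matrix_(i, j) g' (i, j).
have AE i j : A i j = (P x i j)%:M + G i j *: M by rewrite mxE; exact: (hg' (i, j)).1.
have PyE : P y = P0 + delta *: G.
  by apply/matrixP => i j; rewrite !mxE (hg' (i, j)).2 /= mulrC.
pose a := cj e; pose b := cj r.
have Yu : Y \in unitmx by exact: shifted_unit.
pose e' := invmx Y *m (G *m b).
have Ye' : Y *m e' = G *m b by rewrite mulKVmx.
pose c' := b + delta *: e'.
have Yc' : Y *m c' = (P y + ctr P0) *m b.
  by rewrite mulmxDr -scalemxAr Ye' PyE addrAC [RHS]mulmxDl -scalemxAl.
have scG u : sc u G b = yform e' u by rewrite sc_mul -Ye' -sc_mul.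
pose q z := \det (P z + ctr P0).
pose gg z := \adj (P z + ctr P0) *m (Y *m c').
pose p z := sc e' (P z - P0) (gg z).
have pfB i j : polyfun S (fun z => (P z + ctr P0) i j).
  have -> : (fun z => (P z + ctr P0) i j) = (fun z => P z i j + ctr P0 i j).
    by apply/funext => z; rewrite mxE.
  apply: polyfun_add; last exact: polyfun_cst.
  by exists (A i j); exact: calcP.
have [B qB] : polyfun S q by exact: polyfun_det pfB.
have /choice[GG hGG] j : polyfun S (fun z => gg z j 0).
  have -> : (fun z => gg z j 0) = (fun z => \sum_k (\adj (P z + ctr P0)) j k * (Y *m c') k 0).
    by apply/funext => z; rewrite mxE.
  apply: polyfun_sum => k; apply: polyfun_mul; last exact: polyfun_cst.
  exact: polyfun_adj pfB.
have ggy : gg y = q y *: b.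
  by rewrite /gg Yc' mulmxA mul_adj_mx mul_scalar_mx.
have pA : calc S p ((q y * sc e' G b) *: M).
  have -> : p = fun z => \sum_i \sum_j (e' i 0)^* * ((P z i j + - P x i j) * gg z j 0).
    apply/funext => z; rewrite /p /sc mxE exchange_big /=; apply: eq_bigr => j _.
    rewrite mxE mulr_suml; apply: eq_bigr => i _.
    by rewrite ctrE !mxE mulrA.
  have -> : (q y * sc e' G b) *: M = \sum_i \sum_j
      ((e' i 0)^*)%:M *m ((A i j + (- P x i j)%:M) *m GG j).
    transitivity (\sum_i \sum_j ((e' i 0)^* * (G i j * gg y j 0)) *: M).
      rewrite exchange_big /=; under eq_bigr => j _ do rewrite -scaler_suml.
      rewrite -scaler_suml; congr (_ *: _).
      rewrite /sc mxE mulr_sumr; apply: eq_bigr => j _.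
      rewrite mxE ggy mulr_suml mulr_sumr; apply: eq_bigr => i _.
      by rewrite ctrE [(q y *: b) j 0]mxE; ring.
    apply: eq_bigr => i _; apply: eq_bigr => j _.
    rewrite AE raddfN addrAC subrr add0r mul_scalar_mx -scalemxAl -mulmxA.
    by rewrite (calc_left (hGG j)) -scalemxAr !scalerA mulrA.
  apply: calc_sum => i; apply: calc_sum => j; apply: calc_mul; first exact: calc_cst.
  apply: calc_mul; last exact: hGG.
  by apply: calc_add; [exact: calcP|exact: calc_cst].
have q0 z : Gamma z -> q z != 0.
  by move=> Gz; have := shifted_unit Gz; rewrite unitmxE unitfE.
have ggE z : (P z + ctr P0) *m gg z = q z *: (Y *m c').
  by rewrite /gg mulmxA mul_mx_adj mul_scalar_mx.
have pE z : p z = sc e' (P z - P0) (gg z) by [].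
clearbody p gg q.
set N := re (yform e' e'); set Nc := re (yform c' c').
have N0 : 0 <= N by exact: psd_ge0.
have Nc0 : 0 <= Nc by exact: psd_ge0.
pose k := Num.sqrt (Nc * N); have k2 : k ^+ 2 = Nc * N by rewrite sqr_sqrtr // mulr_ge0.
have pq z : Gamma z -> `|p z| <= rc k * `|q z|.
  move=> Gz; pose h := (q z)^-1 *: gg z.
  have hc : (P z + ctr P0) *m h = Y *m c'.
    by rewrite -scalemxAr ggE scalerA mulVf ?scale1r ?q0.
  have -> : p z = q z * sc e' (P z - P0) h.
    by rewrite pE sc_scaler mulrA mulfV ?mul1r ?q0.
  rewrite normrM mulrC ler_wpM2r // -(ler_pXn2r (n:=2)) ?nnegrE //; last first.
    by rewrite -rc0 ler_rc sqrtr_ge0.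
  rewrite -[leLHS]rc_re ?exprn_ge0 // -[rc k ^+ 2]rcX ler_rc k2.
  exact: schwarz_pick_bound.
have est := spectral_set_quotient spec pA qB (sqrtr_ge0 _) q0 pq.
have [q' [BE qy]] := calc_form qB.
pose tau := (ctr e *m t) 0 0.
have tE : t = tau *: e + delta *: r.
  rewrite -[LHS]mul1mx -id1 mulmxDl -!mulmxA (mx11_scalar (ctr e *m t)) (mx11_scalar (ctr r *m t)).
  by rewrite !mul_mx_scalar.
(* This vector is sent to a multiple of r by q, so that both norms are explicit. *)
pose w := q x *: r - (q' * tau) *: e.
have rw : ctr r *m w = (q x)%:M.
  by rewrite mulmxBr -!scalemxAr rr re_orth scaler0 subr0 scalemx1.
have Mw : M *m w = q x *: t by rewrite -mulmxA rw mul_mx_scalar.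
have Bw : B *m w = (q x * q y) *: r.
  rewrite BE mulmxDl mul_scalar_mx -scalemxAl Mw.
  have -> : q' *: (q x *: t) = q' *: (q x *: (tau *: e + delta *: r)) by rewrite -tE.
  have aux (c1 c2 c3 c4 : C) : c1 *: (c1 *: r - (c2 * c3) *: e) +
      c2 *: (c1 *: (c3 *: e + c4 *: r)) = (c1 * (c1 + c2 * c4)) *: r.
    by apply/matrixP => i j; rewrite !mxE; ring.
  by rewrite qy /w aux.
have scN : sc e' G b = rc N by rewrite scG psd_real.
have K0 : 0 < re `|q x * q y|.
  by rewrite -ltr_rc rc_re // normr_gt0 mulf_neq0 // q0.
have nr : rnorm (r : euclid R 2) = 1.
  by apply/eqP; rewrite -(@pexpr_eq1 _ _ 2) ?re_ge0 // rnorm_euclid rr mxE eqxx mulr1n.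
have NT : N * rnorm (t : euclid R 2) <= k.
  have := est w; rewrite Bw -scalemxAl Mw scalerA rnormZ rnormZ nr mulr1 scN.
  have -> : re `|q y * rc N * q x| = re `|q x * q y| * N.
    rewrite mulrAC [q y * _]mulrC normrM mulrC.
    by rewrite [`|rc N|]ger0_norm -?rc0 ?ler_rc // re_rcM mulrC.
  by rewrite -mulrA mulrC [k * _]mulrC mulrC ler_pM2l.
have t2 : rnorm (t : euclid R 2) ^+ 2 = re (`|tau| ^+ 2) + re (`|delta| ^+ 2).
  rewrite rnorm_euclid -reD; congr re.
  have -> : ctr t *m t = (ctr t *m e) *m (ctr e *m t) + (ctr t *m r) *m (ctr r *m t).
    by rewrite -[in LHS](mulmx1 (ctr t)) -id1 mulmxDr mulmxDl !mulmxA.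
  have te : (ctr t *m e) 0 0 = tau^* by rewrite /tau -ctrE ctrM ctrK.
  have tr : (ctr t *m r) 0 0 = delta^* by rewrite /rank_one_trace -ctrE ctrM ctrK.
  rewrite mxE [X in X + _]mxE [X in _ + X]mxE !big_ord1 te tr !normCK.
  by rewrite mulrC [delta^* * _]mulrC.
have shift u s : re (yform (u + s *: e') (u + s *: e')) =
    re (yform u u) + re (`|s| ^+ 2) * N + 2 * re (s * yform e' u).
  rewrite psdDD psdZZ psdZr sqr_norm; congr (_ + 2 * _).
  by rewrite [yform u e']psd_conj -rmorphM /= re_conj.
have ya : re (yform a a) = 2 * re (sc a P0 a) := yform_diag a.
have yb : re (yform b b) = 2 * re (sc b P0 b) := yform_diag b.
have h1 := psd_ge0 yform (a + tau *: e'); rewrite shift ya in h1.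
have h2 := Nc0; rewrite /Nc /c' shift yb in h2.
have := @trace_inequality (re (sc a P0 a)) (re (sc b P0 b)) N (re (`|tau| ^+ 2))
  (re (`|delta| ^+ 2)) (re (tau * yform e' a)) (re (delta * yform e' b)) N0 h1 h2.
have -> : 2 * re (sc b P0 b) + re (`|delta| ^+ 2) * N + 2 * re (delta * yform e' b) = Nc.
  by rewrite -yb -shift.
rewrite -t2; have prem : N * N * rnorm (t : euclid R 2) ^+ 2 <= N * Nc.
  have NT0 : 0 <= N * rnorm (t : euclid R 2) by rewrite mulr_ge0 // re_ge0.
  have : (N * rnorm (t : euclid R 2)) ^+ 2 <= k ^+ 2.
    by rewrite ler_pXn2r ?nnegrE // sqrtr_ge0.
  by rewrite k2 exprMn expr2 [Nc * N]mulrC.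
move=> /(_ prem) fin.
have tT : t^T = tau *: ctr a + delta *: ctr b.
  by rewrite [in LHS]tE linearD !linearZ /= /a /b !ctr_cj.
have tGb : (t^T *m G *m b) 0 0 = tau * sc a G b + delta * sc b G b.
  by rewrite tT !mulmxDl -!scalemxAl [LHS]mxE [X in X + _]mxE [X in _ + X]mxE.
have Aij i j : A i j i j = P0 i j *+ (i == j) + t i 0 * G i j * b j 0.
  rewrite AE [LHS]mxE [X in X + _]mxE [X in _ + X]mxE [X in _ * X]mxE big_ord1 ctrE.
  have -> : b j 0 = (r j 0)^* by rewrite /b /cj mxE ctrE.
  by rewrite mulrCA mulrA.
have -> : \sum_i \sum_j A i j i j = \tr P0 + (t^T *m G *m b) 0 0.
  rewrite !sum2 !Aij /mxtrace sum2 !mul2E [t^T 0 0]mxE [t^T 0 1]mxE /= !mulr1n !mulr0n; ring.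
rewrite tGb !scG -trace_cj -/a -/b reD (reD (sc a P0 a)) (reD (tau * _)).
exact: fin.
Qed.

End Strict.

End TwoPointCalculus.

Section CompletePositivity.
Variables (R : realType) (n : nat) (S : 'I_n -> 'M[complexC R]_2).
Local Notation C := (complexC R).
Hypothesis S_comm : forall i j, S i *m S j = S j *m S i.
Hypothesis spec : spectral_set (@Gamma R n) (fun i => @matrix_op R 2 (S i)).
Variables (P : 'rV[C]_n -> 'M[C]_2) (A : 'I_2 -> 'I_2 -> 'M[C]_2).
Hypothesis calcP : forall i j, calc S (fun z => P z i j) (A i j).

Lemma polyfun_sc v : polyfun S (fun z => sc v (P z) v).
Proof.
have -> : (fun z => sc v (P z) v) =
    fun z => \sum_j (\sum_i (ctr v) 0 i * P z i j) * v j 0.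
  by apply/funext => z; rewrite /sc mxE; apply: eq_bigr => j _; rewrite mxE.
apply: polyfun_sum => j; apply: polyfun_mul; last exact: polyfun_cst.
apply: polyfun_sum => i; apply: polyfun_mul; first exact: polyfun_cst.
by exists (A i j); exact: calcP.
Qed.

Hypothesis Ptorus : forall z : 'rV[C]_n, (forall i, `|z 0 i| = 1) -> posre (P (symmetrization z)).

(** By the maximum principle positivity on the torus gives positivity on the whole of
[Gamma]; adding [eps] to [P] makes it strict. *)
Lemma calc_trace_ge0 : 0 <= re (\sum_i \sum_j A i j i j).
Proof.
have PG z : Gamma z -> forall v : 'cV[C]_2, 0 <= re (sc v (P z) v).
  move=> [w w1 <-] v; have [B fB] := polyfun_sc v.
  apply: (calc_re_polydisc fB) w w1 => w w1.
  by have := Ptorus w1 (ctr v); rewrite ctrK.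
have [x [nu [e [r [t [ee rr re_orth id1 SE]]]]]] := commuting_structure S_comm.
have strict eps : 0 < eps -> 0 <= re (\sum_i \sum_j A i j i j) + 2 * eps.
  move=> eps0.
  have := @strict_trace_ge0 R n S x nu e r t ee rr re_orth id1 SE spec
    (fun z => P z + (rc eps)%:M) (fun i j => A i j + (rc eps *+ (i == j))%:M) _ eps eps0.
  rewrite -[2 * eps]re_rc -reD => h.
  have -> : \sum_i \sum_j A i j i j + rc (2 * eps) =
      \sum_i \sum_j (A i j + (rc eps *+ (i == j))%:M) i j.
    rewrite !sum2 !mxE /= !mulr1n !mulr0n; have -> : rc (2 * eps) = rc eps + rc eps.
      by rewrite -rcD; congr rc; ring.
    ring.
  apply: h => [i j|z Gz v].
    have -> : (fun z => (P z + (rc eps)%:M) i j) = fun z => P z i j + rc eps *+ (i == j).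
      by apply/funext => z; rewrite !mxE.
    by apply: calc_add => //; exact: calc_cst.
  rewrite sc_addm reD -[(rc eps)%:M]scalemx1 sc_scalem re_rcM.
  by rewrite /sc mulmx1 lerDr PG.
rewrite -oppr_le0; apply: (@le0_small _ _ 2) => s s0.
by have := strict s s0; lra.
Qed.

End CompletePositivity.

(** * Multiplication operators and the unitary tuple *)

HB.lock Definition mop (R : realType) (X : Type) (k : nat) (L : bmx R X k k -> R)
  (lL : real_linear L) (pL : forall G, @cone R X k G -> 0 <= L G) (f : X -> complexC R)
  (x : gns (outer_form lL pL)) : gns (outer_form lL pL) :=
  gns_op (mulb (fun p => (f p)^*)) x.

Section Multipliers.
Variables (R : realType) (X : Type) (k : nat).
Local Notation C := (complexC R).
Variable L : bmx R X k k -> R.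
Hypotheses (lL : real_linear L) (pL : forall G, @cone R X k G -> 0 <= L G).
Local Notation Q := (outer_form lL pL).
Local Notation bounded_fun := (@bounded_fun R X).
Implicit Types (f g : X -> C) (x : gns Q).

Local Notation mop := (@mop R X k L lL pL).

Lemma mopEop f : mop f = gns_op (mulb (fun p => (f p)^*)) :> (gns Q -> gns Q).
Proof. by apply/funext => x; rewrite mop.unlock. Qed.

Lemma mop_form_bounded f : bounded_fun f ->
  form_bounded Q (mulb (fun p => (f p)^*)).
Proof. by move=> bf; apply: mulb_form_bounded; exact: bounded_fun_conj. Qed.

Lemma mopE f x w : bounded_fun f -> mop f x w = x (mulb (fun p => (f p)^*) w).
Proof. by move=> bf; rewrite mopEop gns_opE //; exact: mop_form_bounded. Qed.

Lemma mop_bounded f : bounded_fun f -> bounded_operator (mop f : gns Q -> gns Q).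
Proof. by move=> bf; rewrite mopEop; apply: gns_op_bounded; exact: mop_form_bounded. Qed.

Lemma mop_iota f v : bounded_fun f -> mop f (iota Q v) = iota Q (mulb f v).
Proof.
move=> bf; rewrite mopEop; apply: gns_op_iota; first exact: mop_form_bounded.
by move=> u w; exact: mulb_adjoint.
Qed.

Lemma mop_adjoint f x x' : bounded_fun f ->
  inner (mop f x) x' = inner x (mop (fun p => (f p)^*) x').
Proof.
move=> bf; have bc := bounded_fun_conj bf; rewrite !mopEop.
have -> : (fun p => ((f p)^*)^*) = f by apply/funext => p; rewrite conjCK.
apply: gns_op_adjoint; [exact: mulb_form_bounded|exact: mulb_form_bounded|].
by move=> u w; exact: mulb_adjoint.
Qed.

Lemma bounded_fun_cst (a : C) : bounded_fun (fun=> a).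
Proof. by exists (re `|a|) => p; rewrite rc_re. Qed.

Lemma bounded_funD f g : bounded_fun f -> bounded_fun g ->
  bounded_fun (fun p => f p + g p).
Proof.
move=> [M fM] [N gN]; exists (M + N) => p; rewrite rcD.
by apply: le_trans (ler_normD _ _) _; exact: lerD.
Qed.

Lemma bounded_funM f g : bounded_fun f -> bounded_fun g ->
  bounded_fun (fun p => f p * g p).
Proof.
by move=> [M fM] [N gN]; exists (M * N) => p; rewrite rcM normrM ler_pM.
Qed.

Lemma mulbM f g h v : bounded_fun f -> bounded_fun g -> bounded_fun h ->
  (forall p, h p = f p * g p) -> mulb f (mulb g v) = mulb h v :> bmx R X 1 k.
Proof.
move=> bf bg bh hE; apply: bmx_ext => p.
by rewrite (mulbE _ _ bf) (mulbE _ _ bg) (mulbE _ _ bh) hE scalerA.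
Qed.

Lemma mopM f g h x : bounded_fun f -> bounded_fun g -> bounded_fun h ->
  (forall p, h p = f p * g p) -> mop f (mop g x) = mop h x.
Proof.
move=> bf bg bh hE; apply: gns_ext => w.
rewrite (mopE _ _ bf) (mopE _ _ bg) (mopE _ _ bh); congr (x _).
apply: mulbM; do ?exact: bounded_fun_conj.
by move=> p; rewrite hE rmorphM mulrC.
Qed.

Lemma mopC f g x : bounded_fun f -> bounded_fun g -> mop f (mop g x) = mop g (mop f x).
Proof.
move=> bf bg; have [h [bh hE]] : exists h, bounded_fun h /\ forall p, h p = f p * g p.
  by exists (fun p => f p * g p); split => //; exact: bounded_funM.
rewrite (mopM _ bf bg bh hE); symmetry; apply: mopM => // p.
by rewrite hE mulrC.
Qed.

Lemma mopD f g h x : bounded_fun f -> bounded_fun g -> bounded_fun h ->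
  (forall p, h p = f p + g p) -> mop h x = mop f x + mop g x.
Proof.
move=> bf bg bh hE; apply: gns_ext => w.
rewrite gnsD (mopE _ _ bf) (mopE _ _ bg) (mopE _ _ bh).
rewrite -antilinearD; last exact: gns_antilinear.
congr (x _); apply: bmx_ext => p; rewrite bmxD.
rewrite (mulbE _ _ (bounded_fun_conj bf)) (mulbE _ _ (bounded_fun_conj bg)).
by rewrite (mulbE _ _ (bounded_fun_conj bh)) hE rmorphD scalerDl.
Qed.

Lemma mop_cst a x : mop (fun=> a) x = a *: x.
Proof.
apply: gns_ext => w; rewrite gnsZ mopE; last exact: bounded_fun_cst.
rewrite -[a in RHS]conjCK -antilinearZ; last exact: gns_antilinear.
congr (x _); apply: bmx_ext => p; rewrite bmxZ mulbE //.
exact: bounded_fun_cst.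
Qed.

Lemma bounded_fun_sum I (r : seq I) (f : I -> X -> C) : (forall i, bounded_fun (f i)) ->
  bounded_fun (fun p => \sum_(i <- r) f i p).
Proof.
move=> bf; elim: r => [|i s IHs].
  have -> : (fun p => \sum_(i <- [::]) f i p) = fun=> 0.
    by apply/funext => p; rewrite big_nil.
  exact: bounded_fun_cst.
have -> : (fun p => \sum_(j <- i :: s) f j p) = fun p => f i p + \sum_(j <- s) f j p.
  by apply/funext => p; rewrite big_cons.
exact: bounded_funD.
Qed.

Lemma mop_sum I (r : seq I) (f : I -> X -> C) h x : (forall i, bounded_fun (f i)) ->
  bounded_fun h -> (forall p, h p = \sum_(i <- r) f i p) ->
  mop h x = \sum_(i <- r) mop (f i) x.
Proof.
move=> bf; elim: r h => [|i r IHr] h bh hE.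
  rewrite big_nil -(scale0r x) -mop_cst; congr mop.
  by apply/funext => p; rewrite hE big_nil.
have [h' [bh' h'E]] : exists h', bounded_fun h' /\ forall p, h' p = \sum_(j <- r) f j p.
  by exists (fun p => \sum_(j <- r) f j p); split => //; exact: bounded_fun_sum.
rewrite big_cons -(IHr _ bh' h'E); apply: mopD => // p.
by rewrite hE big_cons h'E.
Qed.

Lemma mop_normal f : bounded_fun f -> normal_operator (mop f : gns Q -> gns Q).
Proof.
move=> bf; have bc := bounded_fun_conj bf.
exists (mop (fun p => (f p)^*)); split; first exact: mop_bounded.
- by move=> x x'; exact: mop_adjoint.
- by move=> x; exact: mopC.
Qed.

End Multipliers.

Section TorusDilation.
Variables (R : realType) (n : nat).
Local Notation C := (complexC R).

Definition torus := {z : 'rV[C]_n | forall i, `|z 0 i| = 1}.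

Definition torus_sym (p : torus) : 'rV[C]_n := symmetrization (sval p).

Lemma torus_sym_bounded i : @bounded_fun R torus (fun p => torus_sym p 0 i).
Proof.
exists (\sum_(I : {set 'I_n} | #|I| == i.+1) 1) => p; rewrite mxE.
apply: le_trans (ler_norm_sum _ _ _) _; rewrite /rc rmorph_sum /=.
apply: ler_sum => I _; rewrite normr_prod big1 // => j _; exact: (svalP p).
Qed.

Lemma calc_bounded d (S : 'I_n -> 'M[C]_d) f A : calc S f A ->
  @bounded_fun R torus (fun p => f (torus_sym p)).
Proof.
elim=> {f A} [c|i|f g A B _ IHf _ IHg|f g A B _ IHf _ IHg].
- exact: bounded_fun_cst.
- exact: torus_sym_bounded.
- exact: bounded_funD.
- exact: bounded_funM.
Qed.

Variables (k : nat) (L : bmx R torus k k -> R).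
Hypotheses (lL : real_linear L) (pL : forall G, @cone R torus k G -> 0 <= L G).
Local Notation Q := (outer_form lL pL).
Local Notation N := (fun i => @mop R torus k L lL pL (fun p => torus_sym p 0 i)).

(** Outside the distinguished boundary some combination [g] of the [s_i - l_i] is
bounded below on the torus, and multiplication by [c_i / g] inverts the tuple. *)
Lemma torus_Gamma_unitary : Gamma_unitary (N : 'I_n -> gns Q -> gns Q).
Proof.
split.
- split; first by move=> i; apply: mop_bounded; exact: torus_sym_bounded.
  by move=> i j x; apply: mopC; exact: torus_sym_bounded.
- by move=> i; apply: mop_normal; exact: torus_sym_bounded.
move=> l; apply: contraPP => /outside_bGamma[c [d d0 hd]] h; apply: h.
have [g [gd gE]] : exists g : torus -> C, (forall p, rc d <= `|g p|) /\
    forall p, g p = \sum_i c i * (torus_sym p 0 i - l 0 i).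
  exists (fun p => \sum_i c i * (torus_sym p 0 i - l 0 i)); split => // p.
  by apply: hd; exact: (svalP p).
have g0 p : g p != 0.
  by rewrite -normr_gt0; apply: lt_le_trans (gd p); rewrite -rc0 ltr_rc.
have [s [bs sE]] : exists s : 'I_n -> torus -> C, (forall i, bounded_fun (s i)) /\
    forall i p, s i p = torus_sym p 0 i - l 0 i.
  exists (fun i p => torus_sym p 0 i - l 0 i); split => // i.
  by apply: bounded_funD; [exact: torus_sym_bounded|exact: bounded_fun_cst].
have [b [bb bE]] : exists b : 'I_n -> torus -> C, (forall i, bounded_fun (b i)) /\
    forall i p, b i p = c i * (g p)^-1.
  exists (fun i p => c i * (g p)^-1); split => // i.
  apply: bounded_funM; first exact: bounded_fun_cst.
  exists d^-1 => p; rewrite normfV rcV lef_pV2 ?posrE //.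
    by rewrite normr_gt0.
  by rewrite -rc0 ltr_rc.
have [u [bu uE]] : exists u : 'I_n -> torus -> C, (forall i, bounded_fun (u i)) /\
    forall i p, u i p = s i p * b i p.
  exists (fun i p => s i p * b i p); split => // i; exact: bounded_funM.
have E : (fun i (x : gns Q) => N i x - l 0 i *: x) = (fun i => mop (s i)).
  apply/funext => i; apply/funext => x; rewrite -scaleNr -mop_cst; symmetry.
  by apply: mopD => //; [exact: torus_sym_bounded|exact: bounded_fun_cst].
change (koszul_exact (fun i (x : gns Q) => N i x - l 0 i *: x)); rewrite E.
apply: (@koszul_exact_of_inverse R (gns Q) n _ (fun i => mop (b i))).
- by move=> i; exact: (proj1 (mop_bounded _ _ (bs i))).
- by move=> i; exact: (proj1 (mop_bounded _ _ (bb i))).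
- by move=> i j x; exact: mopC.
- move=> x; rewrite -[RHS]scale1r -mop_cst.
  rewrite (eq_bigr (fun i => mop (u i) x)) => [|i _]; last by apply: mopM.
  symmetry; apply: mop_sum => // [|p]; first exact: bounded_fun_cst.
  rewrite -(mulfV (g0 p)) {1}gE mulr_suml.
  by apply: eq_bigr => i _; rewrite uE sE bE mulrCA mulrA.
Qed.

End TorusDilation.

(** * The dilation *)

Section Extension.
Variables (R : realType) (n : nat) (S : 'I_n -> 'M[complexC R]_2).
Local Notation C := (complexC R).
Local Notation torus := (torus R n).
Local Notation E := (bmx R torus 2 2).
Hypothesis S_comm : forall i j, S i *m S j = S j *m S i.
Hypothesis spec : spectral_set (@Gamma R n) (fun i => @matrix_op R 2 (S i)).

(** The pairing of a matrix [A] of operators with the canonical basis,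
[\sum_ij <A_ij e_j, e_i>]: its positivity on positive elements is the 2-positivity
of the calculus, and all that is needed for a dilation of operators on a
two-dimensional space. *)
Definition calc_graph : set (E * R) := [set u : E * R | exists P : 'rV[C]_n -> 'M[C]_2,
  exists A : 'I_2 -> 'I_2 -> 'M[C]_2,
  [/\ forall i j, calc S (fun z => P z i j) (A i j),
      forall p, u.1 p = P (torus_sym p) & u.2 = re (\sum_i \sum_j A i j i j)]].

Lemma bmx_order_unit (G : E) : exists K : R,
  forall p, posre ((rc K)%:M - G p).
Proof.
have [m hm] := bmxP G; exists (2 * re `|m|) => p c.
have Gm i j : `|G p i j| <= rc (re `|m|).
  have h := hm p i j; have m0 : 0 <= m by exact: le_trans h.
  by rewrite rc_re // [`|m|]ger0_norm.
rewrite mulmxBr mulmxBl mxE [X in _ + X]mxE reB subr_ge0.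
apply: le_trans (re_le_norm _) _.
set a := re `|c 0 0|; set b := re `|c 0 1|; set M := re `|m|.
have ca : `|c 0 0| = rc a by rewrite rc_re.
have cb : `|c 0 1| = rc b by rewrite rc_re.
have M0 : 0 <= M by exact: re_ge0.
have a0 : 0 <= a by exact: re_ge0.
have b0 : 0 <= b by exact: re_ge0.
have -> : re ((c *m (rc (2 * M))%:M *m ctr c) 0 0) = 2 * M * (a ^+ 2 + b ^+ 2).
  rewrite mul_mx_scalar -scalemxAl mxE re_rcM mul2E !ctrE -!normCK reD ca cb.
  by rewrite -!rcX !re_rc.
have : `|(c *m G p *m ctr c) 0 0| <= rc (M * (a + b) ^+ 2).
  rewrite !mul2E !ctrE; apply: le_trans (ler_normD _ _) _.
  rewrite !normrM !norm_conjC ca cb.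
  have -> : rc (M * (a + b) ^+ 2) =
     (rc a * rc M + rc b * rc M) * rc a + (rc a * rc M + rc b * rc M) * rc b.
    by rewrite -!(rcM, rcD); congr rc; ring.
  have n0 (t : R) : 0 <= t -> 0 <= rc t by rewrite -rc0 ler_rc.
  apply: lerD; apply: ler_wpM2r; rewrite ?n0 //; apply: le_trans (ler_normD _ _) _;
    by rewrite !normrM ca cb; apply: lerD; apply: ler_wpM2l; rewrite ?n0.
rewrite -[leLHS]rc_re ?normr_ge0 // ler_rc => /le_trans; apply.
have : 0 <= M * (a - b) ^+ 2 by rewrite mulr_ge0 ?sqr_ge0.
lra.
Qed.

Lemma calc_functional : exists L : E -> R, [/\ real_linear L,
  forall G, cone G -> 0 <= L G & forall u, calc_graph u -> L u.1 = u.2].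
Proof.
apply: positive_extension.
- by move=> p c; rewrite mulmx0 mul0mx mxE.
- move=> G H hG hH p c; rewrite bmxD mulmxDr mulmxDl mxE reD.
  by apply: addr_ge0; [exact: hG|exact: hH].
- move=> a G a0 hG p c; rewrite bmxZ -scalemxAr -scalemxAl mxE re_rcM.
  by apply: mulr_ge0; [exact: ltW|exact: hG].
- move=> u v [P [A [hP uP uA]]] [P' [A' [hP' vP' vA']]].
  exists (fun z => P z + P' z), (fun i j => A i j + A' i j); split=> [i j|p|] /=.
  + have -> : (fun z => (P z + P' z) i j) = fun z => P z i j + P' z i j.
      by apply/funext => z; rewrite mxE.
    by apply: calc_add.
  + by rewrite -uP -vP'.
  + rewrite uA vA' -reD -big_split; congr re; apply: eq_bigr => i _ /=.
    by rewrite -big_split; apply: eq_bigr => j _; rewrite mxE.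
- move=> a u [P [A [hP uP uA]]].
  exists (fun z => rc a *: P z), (fun i j => rc a *: A i j); split=> [i j|p|] /=.
  + have -> : (fun z => (rc a *: P z) i j) = fun z => rc a * P z i j.
      by apply/funext => z; rewrite mxE.
    exact: calc_scale.
  + by rewrite -uP.
  + rewrite uA -re_rcM mulr_sumr; congr re; apply: eq_bigr => i _.
    by rewrite mulr_sumr; apply: eq_bigr => j _; rewrite mxE.
- move=> u [P [A [hP uP uA]]] uc; rewrite uA; apply: (calc_trace_ge0 S_comm spec hP).
  by move=> z z1; have := uc (exist _ z z1); rewrite uP.
- move=> G; have [K hK] := bmx_order_unit G.
  have cst : to_bmx (fun _ : torus => (rc K)%:M) = (fun _ => (rc K)%:M) :> (torus -> 'M[C]_2).
    apply: (@to_bmxE _ _ _ _ _ `|rc K|) => p i j; rewrite mxE.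
    by case: (i == j); rewrite ?mulr1n ?mulr0n ?normr0.
  pose D : 'M[C]_2 := (rc K)%:M; pose DA (i j : 'I_2) : 'M[C]_2 := (D i j)%:M.
  exists (to_bmx (fun _ => D), re (\sum_i \sum_j DA i j i j)).
    exists (fun _ => D), DA; split=> //= [i j|p].
      exact: calc_cst.
    by rewrite cst.
  by move=> p; rewrite bmxD bmxN cst; exact: hK.
Qed.

Variable L : E -> R.
Hypotheses (lL : real_linear L) (pL : forall G, cone G -> 0 <= L G)
  (FL : forall u, calc_graph u -> L u.1 = u.2).

Lemma cplx_fun_calc (P : 'rV[C]_n -> 'M[C]_2) (A : 'I_2 -> 'I_2 -> 'M[C]_2) (G : E) :
  (forall i j, calc S (fun z => P z i j) (A i j)) ->
  (forall p, G p = P (torus_sym p)) -> cplx_fun L G = \sum_i \sum_j A i j i j.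
Proof.
move=> hP GP; rewrite /cplx_fun.
have -> : L G = re (\sum_i \sum_j A i j i j).
  by apply: (@FL (G, re (\sum_i \sum_j A i j i j))); exists P, A.
have -> : L ('i *: G) = re ('i * \sum_i \sum_j A i j i j).
  apply: (@FL ('i *: G, re ('i * \sum_i \sum_j A i j i j))); exists (fun z => 'i *: P z), (fun i j => 'i *: A i j).
  split=> [i j|p|] /=.
  - have -> : (fun z => ('i *: P z) i j) = fun z => 'i * P z i j.
      by apply/funext => z; rewrite mxE.
    exact: calc_scale.
  - by rewrite -GP.
  - congr re; rewrite mulr_sumr; apply: eq_bigr => i _.
    by rewrite mulr_sumr; apply: eq_bigr => j _; rewrite mxE.
by rewrite re_iM opprK -complex_parts.
Qed.

Local Notation Q := (outer_form lL pL).
Local Notation N := (fun i => @mop R torus 2 L lL pL (fun p => torus_sym p 0 i)).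

Definition const_row (c : euclid R 2) : bmx R torus 1 2 := to_bmx (fun _ => c^T).

Lemma const_rowE c p : const_row c p = c^T.
Proof.
rewrite /const_row (@to_bmxE _ _ _ _ _ (`|c 0 0| + `|c 1 0|)) // => q i j.
by rewrite mxE ord1; move: j; apply: ord2P; rewrite ?lerDl ?lerDr.
Qed.

Definition embed (c : euclid R 2) : gns Q := iota Q (const_row c).

Lemma embed_linear : linear embed.
Proof.
move=> a c d; rewrite /embed -iota_linear; congr iota; apply: bmx_ext => p.
by rewrite bmxD bmxZ !const_rowE linearP.
Qed.

(** The form of the extended functional restricted to constant rows reproduces the
matrix coefficients of the calculus: this is the dilation property. *)
Lemma embed_calc f A c d : calc S f A ->
  inner (iota Q (mulb (fun p => f (torus_sym p)) (const_row c))) (embed d) =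
  inner (A *m c : euclid R 2) d.
Proof.
move=> fA; rewrite inner_iota iotaE.
transitivity (cplx_fun L (outer (const_row d) (mulb (fun p => f (torus_sym p)) (const_row c)))).
  by [].
rewrite (@cplx_fun_calc (fun z => f z *: (ctr (d^T) *m c^T))
  (fun i j => ((d i 0)^* * c j 0) *: A)).
- rewrite [RHS]/(euclid_inner (A *m c) d) /euclid_inner.
  apply: eq_bigr => i _; rewrite mxE mulr_suml; apply: eq_bigr => j _.
  by rewrite mxE; ring.
- move=> i j; have -> : (fun z => (f z *: (ctr d^T *m c^T)) i j) =
      fun z => ((d i 0)^* * c j 0) * f z.
    by apply/funext => z; rewrite mxE mxE big_ord1 ctrE !mxE mulrC.
  exact: calc_scale.
- move=> p; rewrite outerE const_rowE mulbE ?const_rowE; last exact: calc_bounded fA.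
  by rewrite -scalemxAr.
Qed.

Lemma monomial_calc (m : 'I_n -> nat) : exists f A, [/\ calc S f A,
  forall v, monomial_op N m (iota Q v) = iota Q (mulb (fun p => f (torus_sym p)) v) &
  forall c, monomial_op (fun i => @matrix_op R 2 (S i)) m c = A *m c].
Proof.
rewrite /monomial_op; elim: (index_enum _) => [|i r [f [A [fA hN hS]]]].
  exists (fun=> 1), 1%:M; split; first exact: calc_cst.
  - move=> v; rewrite big_nil; congr iota; apply: bmx_ext => p.
    by rewrite mulbE ?scale1r //; exact: bounded_fun_cst.
  - by move=> c; rewrite big_nil mul1mx.
have step k : exists g B, [/\ calc S g B,
    forall v, iter k (N i) (iota Q v) = iota Q (mulb (fun p => g (torus_sym p)) v) &
    forall c, iter k (@matrix_op R 2 (S i)) c = B *m c].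
  elim: k => [|k [g [B [gB gN gS]]]].
    exists (fun=> 1), 1%:M; split; first exact: calc_cst.
    - move=> v; congr iota; apply: bmx_ext => p.
      by rewrite mulbE ?scale1r //; exact: bounded_fun_cst.
    - by move=> c; rewrite mul1mx.
  have cg := calc_mul (calc_coord S i) gB.
  exists (fun z : 'rV[C]_n => z 0 i * g z), (S i *m B); split=> // [v|c] /=.
    rewrite gN mop_iota; last exact: torus_sym_bounded.
    congr iota; apply: mulbM => //; [exact: torus_sym_bounded|exact: calc_bounded gB|
      exact: calc_bounded cg].
  by rewrite gS /matrix_op mulmxA.
have [g [B [gB gN gS]]] := step (m i); have cg := calc_mul gB fA.
exists (fun z => g z * f z), (B *m A); split=> // [v|c]; rewrite big_cons /=.
  rewrite hN gN; congr iota; apply: mulbM => //;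
    [exact: calc_bounded gB|exact: calc_bounded fA|exact: calc_bounded cg].
by rewrite hS gS mulmxA.
Qed.

Lemma embed_isometric : hilbert_embedding (embed : euclid R 2 -> gns Q).
Proof.
split; first exact: embed_linear.
move=> c d; have := embed_calc c d (calc_cst S 1); rewrite mul1mx => <-.
congr (inner _ (embed d)); rewrite /embed; congr iota; apply: bmx_ext => p.
by rewrite mulbE ?scale1r //; exact: bounded_fun_cst.
Qed.

Lemma embed_dilates m c : is_projection (embed : euclid R 2 -> gns Q)
  (monomial_op N m (embed c)) (monomial_op (fun i => @matrix_op R 2 (S i)) m c).
Proof.
move=> d; have [f [A [fA hN hS]]] := monomial_calc m.
rewrite hS /embed hN -/(embed (A *m c)) -/(embed d).
rewrite linearBl /= (embed_calc _ _ fA) (proj2 embed_isometric).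
exact: subrr.
Qed.

End Extension.

Theorem theorem1p6 (R : realType) (n : nat) (n_ge2 : (2 <= n)%N)
    (S : 'I_n -> 'M[complexC R]_2)
    (S_comm : forall i j, S i *m S j = S j *m S i)
    (S_contr : Gamma_contraction (fun i => matrix_op (S i))) :
  has_Gamma_isometric_dilation (fun i => matrix_op (S i)).
Proof.
have [_ spec] := S_contr.
have [L [lL pL FL]] := calc_functional S_comm spec.
exists (gns (outer_form lL pL)), (embed lL pL),
  (fun i => @mop R _ 2 L lL pL (fun p => torus_sym p 0 i)).
have unit := torus_Gamma_unitary lL pL.
split; [exact: embed_isometric FL| |by move=> m c; exact: embed_dilates FL _ _].
split; first by case: unit.
exists (gns (outer_form lL pL)), id, (fun i => @mop R _ 2 L lL pL (fun p => torus_sym p 0 i)).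
by split=> //; split.
Qed.
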